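(* Let $0 < n < N$ be integers, let $2 \le k \le \infty$ or $k = \omega$, and let $f(\mathbf{x}) \in C^k(\mathfrak{D}, \mathbb{R}^N)$ be a function on a simply-connected open subset $\mathfrak{D} \subset \mathbb{R}^n$ with Jacobian matrix $J_f(\mathbf{x})$ (of size $N \times n$). Suppose that, for some constant $\alpha \in \mathbb{R}$ and some antisymmetric real matrix $A$ of degree $N$, $f$ satisfies (i) and (ii): (i) ${}^tJ_f(\mathbf{x})\, Q(\mathbf{x})\, J_f(\mathbf{x}) = O$ for any $\mathbf{x} \in \mathfrak{D}$, where $$f^*(\mathbf{x}) := (\alpha I + A) f(\mathbf{x}), \qquad Q(\mathbf{x}) := f^*(\mathbf{x})\,{}^tf^*(\mathbf{x}) A + A f^*(\mathbf{x})\,{}^tf^*(\mathbf{x}) - (f^*(\mathbf{x})\cdot f^*(\mathbf{x})) A.$$ (ii) For any $\mathbf{x} \in \mathfrak{D}$, $\det({}^tJ_f(\mathbf{x}) J_f(\mathbf{x})) \ne 0$ and $f^*(\mathbf{x})$ is linearly independent of $f_{x_1}(\mathbf{x}), \ldots, f_{x_n}(\mathbf{x})$ over $\mathbb{R}$. Let $H_f$ be the function on $\mathfrak{D}$ determined, up to an additive constant, by $$(H_f)_{x_j}(\mathbf{x}) = \frac{f^*(\mathbf{x})\cdot f_{x_j}(\mathbf{x})}{f^*(\mathbf{x})\cdot f^*(\mathbf{x})} \quad (j = 1,\ldots,n),$$ and let $q_f = (q_{ij})_{1\le i,j\le n}$ be the positive-definite symmetric matrix $$q_f(\mathbf{x})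 := e^{-\frac{2(n+1)}{n}\alpha H_f(\mathbf{x})} \left(f^*(\mathbf{x})\cdot f^*(\mathbf{x})\right)^{\frac1n}\, {}^tJ_f(\mathbf{x}) \left(I - \frac{f^*(\mathbf{x})\,{}^tf^*(\mathbf{x})}{{}^tf^*(\mathbf{x}) f^*(\mathbf{x})}\right) J_f(\mathbf{x}),$$ so that $g_f = \sum_{i,j=1}^n q_{ij}\, dx_i dx_j$ is a Riemannian metric on $\mathfrak{D}$. For any function $h(\mathbf{x}, x_{n+1})$ on $\mathfrak{D}\times\mathbb{R}_{>0}$ define $F_{f,h}: \mathfrak{D}\times\mathbb{R}_{>0} \to \mathbb{R}^N$ by $$F_{f,h}(\mathbf{x}, x_{n+1}) := e^{\alpha h(\mathbf{x},x_{n+1})} \exp(A h(\mathbf{x},x_{n+1})) f(\mathbf{x}).$$ Then the following (a) and (b) are equivalent: (a) $F_{f,h}$ satisfies ($\star$) and ($\star\star$) for some $h \in C^k(\mathfrak{D}\times\mathbb{R}_{>0}, \mathbb{R})$. (b) The metric $g_f$ is diagonal and has a constant determinant on $\mathfrak{D}$. Moreover, for any $C^k$ diffeomorphism $\mathbf{x} = \sigma(\mathbf{y})$ on $\mathfrak{D}$, the following (a$'$) and (b$'$) are equivalent: (a$'$) $F_{f\circ\sigma,h}(\mathbf{y},x_{n+1})$ satisfies ($\star$) and ($\star\star$) for some $h(\mathbf{y},x_{n+1}) \in C^k(\mathfrak{D}\times\mathbb{R}_{>0}, \mathbb{R})$. (b$'$) The pull-back $\sigma^* g_f = g_{f\circ\sigma}$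 is diagonal and has a constant determinant on $\mathfrak{D}$.
   Context: Subscripts $x_j$ denote partial derivatives, ${}^tX$ is the transpose, vectors in $\mathbb{R}^N$ are columns, $\cdot$ is the Euclidean inner product, and $C^\omega$ means real analytic. For a map $F$ from an open subset $E \subset \mathbb{R}^m$ to $\mathbb{R}^N$ ($m \le N$) with $N\times m$ Jacobian matrix $DF$, the conditions are: ($\star$) ${}^t(DF) DF$ is an invertible diagonal matrix at every point of $E$; ($\star\star$) $\det({}^t(DF) DF) = c^2$ on $E$ for some constant $c \ne 0$. Here they are applied with $m = n+1$ and $E = \mathfrak{D}\times\mathbb{R}_{>0}$. A metric $\sum q_{ij}dx_idx_j$ is diagonal (resp. has constant determinant) if the matrix $(q_{ij})$ is diagonal at every point (resp. $\det(q_{ij})$ is a constant function). The pullback metric is $(\sigma^*g)_p(u,v) = g_{\sigma(p)}(d\sigma_p(u), d\sigma_p(v))$. The additive constant in $H_f$ only rescales $g_f$ by a positive constant; in the identity $\sigma^*g_f = g_{f\circ\sigma}$ the constants are chosen so that $H_{f\circ\sigma} = H_f\circ\sigma$. In (a$'$) and (b$'$), $(f\circ\sigma)^* = (\alpha I + A)(f\circ\sigma)$ with the same $\alpha$ and $A$. *)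

(* Defs.v *)
From HB Require Import structures.
From mathcomp Require Import all_boot all_order all_algebra.
From mathcomp Require Import all_classical all_reals all_analysis.

Set Implicit Arguments.
Unset Strict Implicit.
Unset Printing Implicit Defensive.

Import Order.TTheory GRing.Theory Num.Theory.
Import numFieldNormedType.Exports.

Local Open Scope classical_set_scope.
Local Open Scope ring_scope.

(* Functions on a subset of R^m are total functions on 'cV[R]_m; all notions
   below take the domain as an argument and, for open domains, depend only on
   the values there. *)

Definition basis_vec (R : realType) (m : nat) (j : 'I_m) : 'cV[R]_m :=
  delta_mx j 0.

Definition partial (R : realType) (m : nat) (j : 'I_m) (g : 'cV[R]_m -> R)
  (x : 'cV[R]_m) : R := 'D_(basis_vec R j) g x.

Definition Jac (R : realType) (m p : nat) (g : 'cV[R]_m -> 'cV[R]_p)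
  (x : 'cV[R]_m) : 'M[R]_(p, m) :=
  \matrix_(i, j) partial j (fun y => g y i 0) x.

Definition dot (R : realType) (p : nat) (u v : 'cV[R]_p) : R :=
  (u^T *m v) 0 0.

Inductive smoothness := SmoothFin of nat | SmoothInfty | SmoothOmega.

Definition at_least_C2 (k : smoothness) : bool :=
  if k is SmoothFin r then (2 <= r)%N else true.

Fixpoint Cfin (R : realType) (m : nat) (E : set 'cV[R]_m) (r : nat)
    (g : 'cV[R]_m -> R) : Prop :=
  (forall x, E x -> {for x, continuous g}) /\
  if r is r'.+1 then
    forall j : 'I_m,
      (forall x, E x -> derivable g x (basis_vec R j)) /\
      Cfin E r' (partial j g)
  else True.

Definition power_term (R : realType) (m : nat) (c : {ffun 'I_m -> nat} -> R)
    (v : 'cV[R]_m) (b : {ffun 'I_m -> nat}) : R :=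
  c b * \prod_(i < m) v i 0 ^+ b i.

(* Sum over the multi-indices all of whose entries are < N. *)
Definition box_sum (R : realType) (m : nat) (t : {ffun 'I_m -> nat} -> R)
    (N : nat) : R :=
  \sum_(b : {ffun 'I_m -> 'I_N}) t [ffun i => b i : nat].

(* Near each point of E, g is the sum of an absolutely convergent power
   series; the order of summation is thus immaterial. *)
Definition analytic_on (R : realType) (m : nat) (E : set 'cV[R]_m)
    (g : 'cV[R]_m -> R) : Prop :=
  forall a, E a ->
  exists (r : R) (c : {ffun 'I_m -> nat} -> R), 0 < r /\
    forall x, ball a r x ->
      cvgn (box_sum (fun b => `|power_term c (x - a) b|)) /\
      box_sum (power_term c (x - a)) @ \oo --> g x.

Definition C_on (R : realType) (m : nat) (k : smoothness) (E : set 'cV[R]_m)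
    (g : 'cV[R]_m -> R) : Prop :=
  match k with
  | SmoothFin r => Cfin E r g
  | SmoothInfty => forall r, Cfin E r g
  | SmoothOmega => analytic_on E g
  end.

Definition C_map (R : realType) (m p : nat) (k : smoothness)
    (E : set 'cV[R]_m) (g : 'cV[R]_m -> 'cV[R]_p) : Prop :=
  forall i : 'I_p, C_on k E (fun x => g x i 0).

Definition diffeo_on (R : realType) (n : nat) (k : smoothness)
    (D : set 'cV[R]_n) (s : 'cV[R]_n -> 'cV[R]_n) : Prop :=
  C_map k D s /\
  exists t : 'cV[R]_n -> 'cV[R]_n,
    [/\ C_map k D t,
        forall x, D x -> D (s x) /\ t (s x) = x &
        forall y, D y -> D (t y) /\ s (t y) = y].

Definition unit_itv {R : realType} : set R := `[0, 1].

Definition path_in (R : realType) (n : nat) (D : set 'cV[R]_n)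
    (g : R -> 'cV[R]_n) : Prop :=
  {within @unit_itv R, continuous g} /\ forall t, unit_itv t -> D (g t).

Definition path_connected (R : realType) (n : nat) (D : set 'cV[R]_n) : Prop :=
  forall x y, D x -> D y -> exists g, [/\ path_in D g, g 0 = x & g 1 = y].

Definition null_homotopic (R : realType) (n : nat) (D : set 'cV[R]_n)
    (g : R -> 'cV[R]_n) : Prop :=
  exists K : R * R -> 'cV[R]_n,
    [/\ {within @unit_itv R `*` @unit_itv R, continuous K},
        forall p, (@unit_itv R `*` @unit_itv R) p -> D (K p),
        forall t, unit_itv t -> K (0, t) = g t,
        forall t, unit_itv t -> K (1, t) = g 0 &
        forall s, unit_itv s -> K (s, 0) = g 0 /\ K (s, 1) = g 0].

Definition simply_connected (R : realType) (n : nat) (D : set 'cV[R]_n) : Prop :=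
  path_connected D /\
  forall g, path_in D g -> g 0 = g 1 -> null_homotopic D g.

Definition expmx (R : realType) (N : nat) (B : 'M[R]_N) : 'M[R]_N :=
  limn (fun r => \sum_(i < r) (i`!%:R^-1 : R) *: B ^+ i).

Definition fstar (R : realType) (n N : nat) (alpha : R) (A : 'M[R]_N)
    (f : 'cV[R]_n -> 'cV[R]_N) (x : 'cV[R]_n) : 'cV[R]_N :=
  (alpha%:M + A) *m f x.

Definition Qmx (R : realType) (n N : nat) (alpha : R) (A : 'M[R]_N)
    (f : 'cV[R]_n -> 'cV[R]_N) (x : 'cV[R]_n) : 'M[R]_N :=
  let fs := fstar alpha A f x in
  fs *m fs^T *m A + A *m fs *m fs^T - dot fs fs *: A.

Definition cond_i (R : realType) (n N : nat) (D : set 'cV[R]_n) (alpha : R)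
    (A : 'M[R]_N) (f : 'cV[R]_n -> 'cV[R]_N) : Prop :=
  forall x, D x -> (Jac f x)^T *m Qmx alpha A f x *m Jac f x = 0.

Definition cond_ii (R : realType) (n N : nat) (D : set 'cV[R]_n) (alpha : R)
    (A : 'M[R]_N) (f : 'cV[R]_n -> 'cV[R]_N) : Prop :=
  forall x, D x ->
    \det ((Jac f x)^T *m Jac f x) != 0 /\
    fstar alpha A f x \notin <<[seq col j (Jac f x) | j <- enum 'I_n]>>%VS.

(* H is (a choice of) the function H_f. *)
Definition is_H (R : realType) (n N : nat) (D : set 'cV[R]_n) (alpha : R)
    (A : 'M[R]_N) (f : 'cV[R]_n -> 'cV[R]_N) (H : 'cV[R]_n -> R) : Prop :=
  forall x, D x -> forall j : 'I_n,
    derivable H x (basis_vec R j) /\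
    partial j H x =
      dot (fstar alpha A f x) (col j (Jac f x)) /
      dot (fstar alpha A f x) (fstar alpha A f x).

Definition qmx (R : realType) (n N : nat) (alpha : R) (A : 'M[R]_N)
    (f : 'cV[R]_n -> 'cV[R]_N) (H : 'cV[R]_n -> R) (x : 'cV[R]_n) : 'M[R]_n :=
  let fs := fstar alpha A f x in
  (expR (- (2 * n.+1%:R / n%:R) * alpha * H x) * (dot fs fs) `^ (n%:R^-1)) *:
  ((Jac f x)^T *m (1%:M - (dot fs fs)^-1 *: (fs *m fs^T)) *m Jac f x).

Definition sym_posdef (R : realType) (n : nat) (q : 'M[R]_n) : Prop :=
  q^T = q /\ forall u : 'cV[R]_n, u != 0 -> 0 < dot u (q *m u).

(* g p u v: the value at the point p on the tangent vectors u and v. *)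
Definition metric (R : realType) (n : nat) :=
  'cV[R]_n -> 'cV[R]_n -> 'cV[R]_n -> R.

Definition metric_of_mx (R : realType) (n : nat) (q : 'cV[R]_n -> 'M[R]_n) :
  metric R n := fun p u v => dot u (q p *m v).

Definition mx_of_metric (R : realType) (n : nat) (g : metric R n)
    (p : 'cV[R]_n) : 'M[R]_n :=
  \matrix_(i, j) g p (basis_vec R i) (basis_vec R j).

Definition gmetric (R : realType) (n N : nat) (alpha : R) (A : 'M[R]_N)
    (f : 'cV[R]_n -> 'cV[R]_N) (H : 'cV[R]_n -> R) : metric R n :=
  metric_of_mx (qmx alpha A f H).

Definition pullback (R : realType) (n : nat) (s : 'cV[R]_n -> 'cV[R]_n)
    (g : metric R n) : metric R n :=
  fun p u v => g (s p) (Jac s p *m u) (Jac s p *m v).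

Definition diagonal_metric (R : realType) (n : nat) (D : set 'cV[R]_n)
    (g : metric R n) : Prop :=
  forall p, D p -> is_diag_mx (mx_of_metric g p).

Definition constant_det_metric (R : realType) (n : nat) (D : set 'cV[R]_n)
    (g : metric R n) : Prop :=
  exists c : R, forall p, D p -> \det (mx_of_metric g p) = c.

(* D x R_{>0}, a point (x, x_{n+1}) being the column col_mx x x_{n+1}%:M. *)
Definition cylinder (R : realType) (n : nat) (D : set 'cV[R]_n) :
    set 'cV[R]_(n + 1) :=
  [set z | D (usubmx z) /\ 0 < dsubmx z 0 0].

Definition Fmap (R : realType) (n N : nat) (alpha : R) (A : 'M[R]_N)
    (f : 'cV[R]_n -> 'cV[R]_N) (h : 'cV[R]_(n + 1) -> R)
    (z : 'cV[R]_(n + 1)) : 'cV[R]_N :=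
  expR (alpha * h z) *: (expmx (h z *: A) *m f (usubmx z)).

Definition star (R : realType) (m N : nat) (E : set 'cV[R]_m)
    (F : 'cV[R]_m -> 'cV[R]_N) : Prop :=
  forall p, E p ->
    is_diag_mx ((Jac F p)^T *m Jac F p) /\
    (Jac F p)^T *m Jac F p \in unitmx.

Definition starstar (R : realType) (m N : nat) (E : set 'cV[R]_m)
    (F : 'cV[R]_m -> 'cV[R]_N) : Prop :=
  exists c : R, c != 0 /\
    forall p, E p -> \det ((Jac F p)^T *m Jac F p) = c ^+ 2.

(* Main.v *)
Require Import Defs.
From HB Require Import structures.
From mathcomp Require Import all_boot all_order all_algebra.
From mathcomp Require Import all_classical all_reals all_analysis.
From mathcomp Require Import ring lra zify.

Set Implicit Arguments.
Unset Strict Implicit.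
Unset Printing Implicit Defensive.

Import Order.TTheory GRing.Theory Num.Theory.
Import numFieldNormedType.Exports.

Local Open Scope classical_set_scope.
Local Open Scope ring_scope.

(* Since A is antisymmetric, exp(h A) is orthogonal and commutes with
   alpha I + A. Hence, with K := J_f + f* (d_x h), the Gram matrix of DF is
   e^(2 alpha h) times the block matrix with diagonal blocks tK K and
   (h_t)^2 |f*|^2 and off-diagonal block h_t tK f*. If it is diagonal and
   invertible, then tK f* = 0, i.e. d_x h = - (f* . df) / |f*|^2 = - dH, and then
   tK K is a positive multiple of q_f. So (star) says that g_f is diagonal and
   that h(x, t) = psi(t) - H(x); the determinant of the Gram matrix is then
   e^(2 (n+1) alpha psi) (psi')^2 det q_f, a product of a function of t and a
   function of x. It is constant iff both factors are, and the first one is for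
   psi(t) = ln t / ((n+1) alpha) (for psi(t) = t if alpha = 0).

   By the symmetry of second derivatives, condition (i) makes the 1-form
   (f* . df) / |f*|^2 closed; H is its primitive, which exists because D is simply
   connected: local primitives come from differentiating under the integral sign
   along rays, and their increments are added up along curves.

   Everything is natural under diffeomorphisms, so that (a') <-> (b') is
   (a) <-> (b) for f o sigma. *)

(** * Partial derivatives and the classes C^k *)

(** The scalar factor of [qmx] is dictated by a count of dimensions: its n-th power is e^(-2(n+1)
    alpha H) |f*|^2, so that det q_f contains the last entry |f*|^2 of the Gram matrix, while the n
    + 1 factors e^(2 alpha h) combine with the remaining exponential into a function of h + H = psi.
    Conversely, a constant determinant must be a square to give (starstar); it is positive because
    q_f is positive definite.

    The obstacle is regularity: h must be of the same class as f although its gradient in x already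
    contains first derivatives of f. The class of H and of h therefore comes from a lemma on
    primitives: partial derivatives of class C^(k-1) give a function of class C^k. For k = omega a
    convergent series has to be rebuilt from those of the partial derivatives, whence the calculus
    of majorized series. The logarithm in psi then costs nothing, since psi' is rational.

    Condition (i) and the second derivatives of f enter through the existence of H. The equivalence
    is proved for a given H, which is why it applies verbatim to f o sigma with H o sigma. *)

Lemma ball_colP (R : realType) m (a x : 'cV[R]_m) r :
  ball a r x <-> 0 < r /\ forall i, `|x i 0 - a i 0| < r.
Proof.
split=> [[r0 H]|[r0 H]].
  by split=> // i; rewrite distrC; exact: H.
by split=> // i j; rewrite (ord1 j) /ball /= distrC; exact: H.
Qed.

(** A directional derivative is an ordinary derivative along a line; this and the converse at 0
    reduce partial derivatives to calculus in one variable. *)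
Lemma derivable_line (R : realType) (V W : normedModType R) (g : V -> W) x v t :
  derivable g (x + t *: v) v ->
  is_derive t 1 (fun s : R => g (x + s *: v)) ('D_v g (x + t *: v)).
Proof.
move=> dg.
have E : (fun h : R => h^-1 *: (((fun s : R => g (x + s *: v)) \o shift t) (h *: 1) - g (x + t *: v)))
   = (fun h : R => h^-1 *: ((g \o shift (x + t *: v)) (h *: v) - g (x + t *: v))).
  apply/funext => h /=; congr (_ *: (g _ - _)).
  by rewrite [h *: 1]mulr1 scalerDl addrCA.
by apply: DeriveDef; rewrite /derivable /derive /= E.
Qed.

Lemma line_derivable (R : realType) (V W : normedModType R) (g : V -> W) x v l :
  is_derive (0 : R) (1 : R) (fun s : R => g (x + s *: v)) l -> is_derive x v g l.
Proof.
move=> [dg <-].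
have E : (fun h : R => h^-1 *: (((fun s : R => g (x + s *: v)) \o shift 0) (h *: 1) - g (x + 0 *: v)))
   = (fun h : R => h^-1 *: ((g \o shift x) (h *: v) - g x)).
  apply/funext => h /=; congr (_ *: (g _ - g _)); last by rewrite scale0r addr0.
  by rewrite [h *: 1]mulr1 addr0 addrC.
by apply: DeriveDef; [move: dg; rewrite /derivable E | rewrite /derive /= E].
Qed.

(** Bounding s by |t|, instead of placing it between 0 and t, treats both signs of the increment at
    once, as the coordinate steps below require. *)
Lemma MVT_between (R : realType) (p : R -> R) (dp : R -> R) (t : R) :
  (forall s : R, `|s| <= `|t| -> is_derive s 1 p (dp s)) ->
  exists2 s, `|s| <= `|t| & p t - p 0 = t * dp s.
Proof.
move=> H; have cont a b : `|a| <= `|t| -> `|b| <= `|t| ->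
    {within `[a, b], continuous p}.
  move=> ha hb; apply: derivable_within_continuous => s; rewrite in_itv /= => /andP[sa sb].
  by have [] := H s _ => //; move: ha hb; rewrite !ler_norml; lra.
have [t0|t0] := leP 0 t.
- have [||s] := @MVT_segment R p dp 0 t t0.
  + move=> s; rewrite in_itv /= => /andP[s0 st]; apply: H.
    by rewrite !ger0_norm //; lra.
  + by apply: cont; rewrite ?normr0.
  rewrite in_itv /= => /andP[s0 st] ->; exists s; first by rewrite !ger0_norm //; lra.
  by rewrite subr0 mulrC.
- have [||s] := @MVT_segment R p dp t 0 (ltW t0).
  + move=> s; rewrite in_itv /= => /andP[s0 st]; apply: H.
    by rewrite !ler0_norm //; lra.
  + by apply: cont; rewrite ?normr0.
  rewrite in_itv /= => /andP[s0 st] e; exists s; first by rewrite !ler0_norm //; lra.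
  by rewrite -opprB e sub0r mulrN opprK mulrC.
Qed.

Lemma partial_MVT (R : realType) m (g : 'cV[R]_m -> R) x j t :
  (forall s, `|s| <= `|t| -> derivable g (x + s *: basis_vec R j) (basis_vec R j)) ->
  exists2 s, `|s| <= `|t| &
    g (x + t *: basis_vec R j) - g x = t * partial j g (x + s *: basis_vec R j).
Proof.
move=> H.
have [s|s st E] := @MVT_between R (fun s => g (x + s *: basis_vec R j))
   (fun s => partial j g (x + s *: basis_vec R j)) t.
  by move=> st; apply: derivable_line; exact: H.
by exists s => //; move: E; rewrite scale0r addr0.
Qed.

Lemma col_basis (R : realType) m (v : 'cV[R]_m) :
  v = \sum_j v j 0 *: basis_vec R j.
Proof.
apply/matrixP => i k; rewrite (ord1 k) summxE (bigD1 i) //= !mxE !eqxx mulr1.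
by rewrite big1 ?addr0 // => j ji; rewrite !mxE eq_sym (negbTE ji) mulr0.
Qed.

(* The points of the staircase from x to x + v, one coordinate at a time. *)
Definition stair (R : realType) m (v : 'cV[R]_m) (k : nat) : 'cV[R]_m :=
  \col_i (if (i < k)%N then v i 0 else 0).

Lemma stairS (R : realType) m (v : 'cV[R]_m) (k : 'I_m) :
  stair v k.+1 = stair v k + v k 0 *: basis_vec R k.
Proof.
apply/matrixP => i j; rewrite (ord1 j) !mxE ltnS leq_eqVlt.
have [/val_inj->|ne] := eqVneq (i : nat) k; first by rewrite ltnn !eqxx mulr1 add0r.
by rewrite -(inj_eq val_inj) /= (negbTE ne) /= mulr0 addr0.
Qed.

Lemma stair0 (R : realType) m (v : 'cV[R]_m) : stair v 0 = 0.
Proof. by apply/matrixP => i j; rewrite !mxE. Qed.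

Lemma stairm (R : realType) m (v : 'cV[R]_m) : stair v m = v.
Proof. by apply/matrixP => i j; rewrite (ord1 j) !mxE ltn_ord. Qed.

Lemma stair_telescope (R : realType) m (g : 'cV[R]_m -> R) x v :
  g (x + v) - g x = \sum_(k < m) (g (x + stair v k.+1) - g (x + stair v k)).
Proof.
rewrite -(big_mkord xpredT (fun k => g (x + stair v k.+1) - g (x + stair v k))).
by rewrite telescope_sumr // stair0 addr0 stairm.
Qed.

Lemma coord_le_norm (R : realType) m (v : 'cV[R]_m) i : `|v i 0| <= `|v|.
Proof. by rewrite [leRHS]/Num.Def.normr /= mx_normrE; exact: (le_bigmax _ _ (i, 0)). Qed.

Lemma cvg_finsum (R : realType) (T I : Type) (r : seq I) (F : set_system T)
    (f : I -> T -> R) (l : I -> R) {FF : Filter F} :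
  (forall i, f i x @[x --> F] --> l i) ->
  \sum_(i <- r) f i x @[x --> F] --> \sum_(i <- r) l i.
Proof. by move=> H; apply: cvg_big => //; exact: add_continuous. Qed.

Lemma differentiable_intro (R : realType) (V W : normedModType R) (f : V -> W)
    (df : {linear V -> W}) (x : V) : continuous df ->
  (forall e : R, 0 < e -> \forall v \near (0 : V),
     `|f (v + x) - (f x + df v)| <= e * `|v|) ->
  differentiable f x.
Proof.
move=> dfc H.
have E : f \o shift x = cst (f x) + df +o_ (0 : V) id by apply/eqaddoP.
by apply/diff_locallyP; rewrite (diff_unique dfc E).
Qed.

(** Along the staircase from a to a + v, the mean value theorem turns each coordinate step into v_k
    times a partial derivative at a point near a, which continuity compares with the one at a. *)
Lemma partials_differentiable (R : realType) m (g : 'cV[R]_m -> R) (a : 'cV[R]_m) :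
  (\forall x \near a, forall j, derivable g x (basis_vec R j)) ->
  (forall j, {for a, continuous (partial j g)}) ->
  differentiable g a.
Proof.
move=> dg cg.
pose L (v : 'cV[R]_m) : R := \sum_j v j 0 * partial j g a.
have L_lin : linear L.
  move=> k u v; rewrite /L -[k *: (\sum_j _)]/(k * (\sum_j u j 0 * partial j g a)) mulr_sumr -big_split; apply: eq_bigr => j _ /=.
  by rewrite !mxE mulrDl mulrA.
pose LM := GRing.isLinear.Build _ _ _ _ L L_lin.
pose Lf : {linear _ -> _} := HB.pack L LM.
have Lc : continuous Lf.
  move=> v; apply: (@cvg_finsum R _ _ _ (nbhs v) (fun j (v : 'cV[R]_m) => v j 0 * partial j g a)) => j.
  by apply: cvgMr_tmp; exact: coord_continuous.
apply: (differentiable_intro Lc) => e e0.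
  (* The m errors e' |v| add up to at most e |v|; dividing by m + 1 also covers m = 0. *)
  pose e' := e / m.+1%:R.
  have e'0 : 0 < e' by rewrite divr_gt0.
  have [r r0 Hr] : exists2 r : R, 0 < r & forall x : 'cV[R]_m, ball a r x ->
     (forall j, derivable g x (basis_vec R j)) /\
     (forall j, `|partial j g a - partial j g x| < e').
    have : \forall x \near a, (forall j, derivable g x (basis_vec R j)) /\
       (forall j, `|partial j g a - partial j g x| < e').
      apply: filterI; first exact: dg.
      apply: (@filter_forall _ _ (fun j x => `|partial j g a - partial j g x| < e') (nbhs a)) => j.
      by have /cvgrPdist_lt := cg j; exact.
    by move=> /nbhs_ballP[r /= r0 Hr]; exists r.
  apply: filterS (@pseudometric_normed_Zmodule.nbhs0_lt R 'cV[R]_m r r0) => v vr.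
  rewrite -[Lf v]/(L v) [v + a]addrC opprD addrA.
  rewrite stair_telescope /L -sumrB.
  apply: le_trans (ler_norm_sum _ _ _) _.
  apply: (@le_trans _ _ (\sum_(j < m) e' * `|v|)); last first.
    rewrite sumr_const card_ord -mulr_natl mulrA ler_wpM2r ?normr_ge0 //.
    by rewrite /e' mulrA ler_pdivrMr // mulrC ler_pM2l // ler_nat.
  apply: ler_sum => k _; rewrite stairS addrA.
  have inb (s : R) : `|s| <= `|v k 0| -> ball a r (a + stair v k + s *: basis_vec R k).
    move=> sv; apply/ball_colP; split=> // i.
    rewrite !mxE !eqxx andbT -[a i 0 + _ + _]addrA addrAC subrr add0r.
    apply: le_lt_trans vr.
    have [->|ne] /= := eqVneq i k.
      by rewrite ltnn add0r mulr1 (le_trans sv) // coord_le_norm.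
    by rewrite mulr0 addr0; case: ifP; rewrite ?normr0 // coord_le_norm.
  have [s|s sv ->] := @partial_MVT R m g (a + stair v k) k (v k 0).
    by move=> sv; have [+ _] := Hr _ (inb s sv).
  rewrite -mulrBr normrM mulrC ler_pM //; last exact: coord_le_norm.
  by rewrite distrC ltW //; have [_ +] := Hr _ (inb s sv).
Qed.

Lemma derive_partials (R : realType) m (g : 'cV[R]_m -> R) (a v : 'cV[R]_m) :
  differentiable g a -> 'D_v g a = \sum_j v j 0 * partial j g a.
Proof.
move=> dg; rewrite deriveE // {1}(col_basis v) linear_sum; apply: eq_bigr => j _.
by rewrite linearZ /= /partial deriveE.
Qed.

(** Restricted to the line through t in the direction w, the map c depends on one real variable,
    where derivability is differentiability. So c only needs a derivative along w, coordinate by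
    coordinate. *)
Lemma is_derive_curve (R : realType) m (V : normedModType R) (g : 'cV[R]_m -> R)
    (c : V -> 'cV[R]_m) (dc : 'I_m -> R) (t w : V) :
  differentiable g (c t) ->
  (forall i, is_derive t w (fun s => c s i 0) (dc i)) ->
  is_derive t w (g \o c) (\sum_i dc i * partial i g (c t)).
Proof.
move=> dg H.
pose c1 : R -> 'cV[R]_m := fun s => c (t + s *: w).
have ct : c1 0 = c t by rewrite /c1 scale0r addr0.
have H1 i : is_derive (0 : R) 1 (fun s => c1 s i 0) (dc i).
  have [d <-] := H i; rewrite /c1.
  have := @derivable_line R _ _ (fun s => c s i 0) t w 0.
  by rewrite scale0r addr0; apply.
have dc1 : derivable c1 0 1.
  by apply/derivable_mxP => i j; rewrite (ord1 j); have [] := H1 i.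
have fc1 : differentiable c1 0 by apply/derivable1_diffP.
apply: line_derivable; apply: DeriveDef.
  apply/derivable1_diffP; apply: (@differentiable_comp _ _ _ _ c1 g) => //.
  by rewrite ct.
rewrite deriveE; last by apply: (@differentiable_comp _ _ _ _ c1 g); rewrite ?ct.
rewrite (@diff_comp _ _ _ _ c1 g) ?ct //= -!deriveE ?ct //.
rewrite derive_partials //; apply: eq_bigr => i _; congr (_ * _).
by rewrite derive_mx // mxE; apply: derive_val.
Qed.

Lemma open_near (T : topologicalType) (E : set T) (x : T) :
  open E -> E x -> \forall y \near x, E y.
Proof. by move=> oE Ex; apply: open_nbhs_nbhs; split. Qed.

Lemma continuous_near_eq (T U : topologicalType) (g g' : T -> U) (x : T) :
  (\forall y \near x, g y = g' y) ->
  {for x, continuous g} -> {for x, continuous g'}.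
Proof.
move=> E c; rewrite /prop_for /continuous_at -(nbhs_singleton E).
exact: cvg_trans (near_eq_cvg E) c.
Qed.

Lemma continuous_col (R : realType) (T : topologicalType) p (c : T -> 'cV[R]_p) x :
  (forall i, {for x, continuous (fun y => c y i 0)}) -> {for x, continuous c}.
Proof.
move=> H; apply/cvgrPdist_lt => e e0.
have : \forall y \near x, forall i, `|c x i 0 - c y i 0| < e.
  apply: (@filter_forall _ _ (fun i y => `|c x i 0 - c y i 0| < e) (nbhs x)) => i.
  by have /cvgrPdist_lt := H i; exact.
apply: filterS => y Hy; rewrite [ltLHS]/Num.Def.normr /= mx_normrE.
by apply/bigmax_ltP; split => //= -[i j] _; rewrite !mxE (ord1 j).
Qed.

(** * Closure properties of the classes C^r, r finite *)

Section Cfin_calculus.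
Variable R : realType.

Lemma Cfin_ext m (E : set 'cV[R]_m) r (g g' : 'cV[R]_m -> R) : open E ->
  (forall x, E x -> g x = g' x) -> Cfin E r g -> Cfin E r g'.
Proof.
move=> oE; elim: r g g' => [|r IH] g g' gg' /= [c H]; split.
- move=> x Ex; apply: (@continuous_near_eq _ _ g); last exact: c.
  by apply: filterS (open_near oE Ex) => y /gg'.
- by [].
- move=> x Ex; apply: (@continuous_near_eq _ _ g); last exact: c.
  by apply: filterS (open_near oE Ex) => y /gg'.
have N x : E x -> \forall y \near x, g y = g' y.
  by move=> Ex; apply: filterS (open_near oE Ex) => y /gg'.
move=> j; have [d Hj] := H j; split.
  by move=> x Ex; apply: near_eq_derivable (d x Ex); exact: N.
by apply: IH Hj => x Ex; apply: near_eq_derive; exact: N.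
Qed.

Lemma CfinW m (E : set 'cV[R]_m) r s (g : 'cV[R]_m -> R) :
  (r <= s)%N -> Cfin E s g -> Cfin E r g.
Proof.
elim: r s g => [|r IH] [|s] g //= rs [c H]; split=> // j.
by have [d Hj] := H j; split=> //; exact: IH Hj.
Qed.

Lemma Cfin_continuous m (E : set 'cV[R]_m) r (g : 'cV[R]_m -> R) x :
  Cfin E r g -> E x -> {for x, continuous g}.
Proof. by case: r => [|r] /= [c _]; exact: c. Qed.

Lemma Cfin_differentiable m (E : set 'cV[R]_m) r (g : 'cV[R]_m -> R) x :
  open E -> Cfin E r.+1 g -> E x -> differentiable g x.
Proof.
move=> oE [c H] Ex; apply: partials_differentiable.
  by apply: filterS (open_near oE Ex) => y Ey j; have [d _] := H j; exact: d.
by move=> j; have [_ Hj] := H j; exact: Cfin_continuous Hj Ex.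
Qed.

Lemma Cfin_derivable m (E : set 'cV[R]_m) r (g : 'cV[R]_m -> R) x j :
  Cfin E r.+1 g -> E x -> derivable g x (basis_vec R j).
Proof. by move=> [_ H] Ex; have [d _] := H j; exact: d. Qed.

Lemma Cfin_partial m (E : set 'cV[R]_m) r (g : 'cV[R]_m -> R) j :
  Cfin E r.+1 g -> Cfin E r (partial j g).
Proof. by move=> [_ H]; have [_] := H j. Qed.

(* Continuity of g comes for free from that of its partial derivatives. *)
Lemma Cfin_primitive m (E : set 'cV[R]_m) r (g : 'cV[R]_m -> R) : open E ->
  (forall j x, E x -> derivable g x (basis_vec R j)) ->
  (forall j, Cfin E r (partial j g)) -> Cfin E r.+1 g.
Proof.
move=> oE d H; split=> [x Ex|j]; last by split=> //; exact: d.
apply: differentiable_continuous; apply: partials_differentiable.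
  by apply: filterS (open_near oE Ex) => y Ey j; exact: d.
by move=> j; exact: Cfin_continuous (H j) Ex.
Qed.

Lemma Cfin_cst m (E : set 'cV[R]_m) r (a : R) : Cfin E r (fun=> a).
Proof.
elim: r a => [|r IH] a; first by split=> // x _; exact: cst_continuous.
split=> [x _|j]; first exact: cst_continuous.
split=> [x _|]; first exact: derivable_cst.
rewrite (_ : partial _ _ = fun=> 0); first exact: IH.
by apply/funext => x; rewrite /partial derive_cst.
Qed.

Lemma is_derive_affine (a b t : R) : is_derive t (1 : R) (fun s => a + s * b) b.
Proof.
rewrite (_ : (fun s => _) = cst a + (b *: (@id R))); last first.
  by apply/funext => s /=; rewrite mulrC.
have H := is_deriveD (is_derive_cst a t (1 : R)) (is_deriveZ b (is_derive_id t (1 : R))).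
have E : 0 + b *: (1 : R) = b by rewrite add0r; exact: mulr1.
by rewrite E in H.
Qed.

Lemma is_derive_coord m (x : 'cV[R]_m) i j :
  is_derive x (basis_vec R j) (fun y : 'cV[R]_m => y i 0 : R) (i == j)%:R.
Proof.
apply: line_derivable.
rewrite (_ : (fun s => _) = (fun s : R => x i 0 + s * (i == j)%:R)); last first.
  by apply/funext => s; rewrite !mxE eqxx andbT.
exact: is_derive_affine.
Qed.

Lemma Cfin_coord m (E : set 'cV[R]_m) r i : Cfin E r (fun x => x i 0).
Proof.
case: r => [|r]; first by split=> // x _; exact: coord_continuous.
split=> [x _|j]; first exact: coord_continuous.
split=> [x _|]; first by have [] := is_derive_coord x i j.
rewrite (_ : partial _ _ = fun=> (i == j)%:R); first exact: Cfin_cst.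
by apply/funext => x; have [_ <-] := is_derive_coord x i j.
Qed.

Lemma CfinD m (E : set 'cV[R]_m) r (g h : 'cV[R]_m -> R) : open E ->
  Cfin E r g -> Cfin E r h -> Cfin E r (fun x => g x + h x).
Proof.
move=> oE; elim: r g h => [|r IH] g h gr hr.
  by split=> // x Ex; exact: (continuousD (Cfin_continuous gr Ex) (Cfin_continuous hr Ex)).
split=> [x Ex|j].
  by exact: (continuousD (Cfin_continuous gr Ex) (Cfin_continuous hr Ex)).
split=> [x Ex|].
  by apply: (@derivableD _ _ _ g h); [exact: Cfin_derivable gr Ex|exact: Cfin_derivable hr Ex].
apply: (@Cfin_ext _ _ _ (fun x => partial j g x + partial j h x)) => //.
  move=> x Ex; symmetry; apply: (@deriveD _ _ _ g h).
    exact: Cfin_derivable gr Ex.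
  exact: Cfin_derivable hr Ex.
by apply: IH; exact: Cfin_partial.
Qed.

Lemma CfinM m (E : set 'cV[R]_m) r (g h : 'cV[R]_m -> R) : open E ->
  Cfin E r g -> Cfin E r h -> Cfin E r (fun x => g x * h x).
Proof.
move=> oE; elim: r g h => [|r IH] g h gr hr.
  by split=> // x Ex; exact: (continuousM (Cfin_continuous gr Ex) (Cfin_continuous hr Ex)).
split=> [x Ex|j].
  by exact: (continuousM (Cfin_continuous gr Ex) (Cfin_continuous hr Ex)).
split=> [x Ex|].
  by apply: (@derivableM _ _ g h); [exact: Cfin_derivable gr Ex|exact: Cfin_derivable hr Ex].
apply: (@Cfin_ext _ _ _ (fun x => g x * partial j h x + h x * partial j g x)) => //.
  move=> x Ex; symmetry; apply: (@deriveM _ _ g h).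
    exact: Cfin_derivable gr Ex.
  exact: Cfin_derivable hr Ex.
by apply: CfinD => //; apply: IH => //;
  [exact: CfinW gr|exact: Cfin_partial|exact: CfinW hr|exact: Cfin_partial].
Qed.

Lemma Cfin_sum m (E : set 'cV[R]_m) r (I : Type) (s : seq I)
    (g : I -> 'cV[R]_m -> R) : open E ->
  (forall i, Cfin E r (g i)) -> Cfin E r (fun x => \sum_(i <- s) g i x).
Proof.
move=> oE H; elim: s => [|i s IH].
  by apply: Cfin_ext (Cfin_cst E r 0) => // x _; rewrite big_nil.
by apply: Cfin_ext (CfinD oE (H i) IH) => // x _; rewrite big_cons.
Qed.

Lemma CfinV m (E : set 'cV[R]_m) r (g : 'cV[R]_m -> R) : open E ->
  (forall x, E x -> g x != 0) -> Cfin E r g -> Cfin E r (fun x => (g x)^-1).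
Proof.
move=> oE g0; elim: r => [|r IH] gr.
  by split=> // x Ex; exact: (continuousV (g0 x Ex) (Cfin_continuous gr Ex)).
split=> [x Ex|j].
  by exact: (continuousV (g0 x Ex) (Cfin_continuous gr Ex)).
split=> [x Ex|].
  by apply: (@derivableV _ _ g); [exact: g0|exact: Cfin_derivable gr Ex].
apply: (@Cfin_ext _ _ _ (fun x => -1 * ((g x)^-1 * (g x)^-1) * partial j g x)) => //.
  move=> x Ex; rewrite [RHS](@deriveV _ _ g _ _ (g0 x Ex)) ?mulN1r //.
    by rewrite expr2 invfM.
  exact: Cfin_derivable gr Ex.
have gV : Cfin E r (fun x => (g x)^-1) by apply: IH; exact: CfinW gr.
by apply: CfinM => //; [apply: CfinM => //; [exact: Cfin_cst|exact: CfinM]|exact: Cfin_partial].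
Qed.

Lemma partial_comp m p (g : 'cV[R]_p -> R) (s : 'cV[R]_m -> 'cV[R]_p) x j :
  differentiable g (s x) ->
  (forall i, derivable (fun y => s y i 0) x (basis_vec R j)) ->
  derivable (g \o s) x (basis_vec R j) /\
  partial j (g \o s) x = \sum_i partial j (fun y => s y i 0) x * partial i g (s x).
Proof.
move=> dg ds.
have [] := @is_derive_curve R p _ g s (fun i => partial j (fun y => s y i 0) x)
  x (basis_vec R j) dg.
  by move=> i; apply: DeriveDef => //; exact: ds.
by [].
Qed.

Lemma Cfin_comp m p (E : set 'cV[R]_m) (E' : set 'cV[R]_p) r
    (g : 'cV[R]_p -> R) (s : 'cV[R]_m -> 'cV[R]_p) : open E -> open E' ->
  (forall x, E x -> E' (s x)) -> (forall i, Cfin E r (fun x => s x i 0)) ->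
  Cfin E' r g -> Cfin E r (g \o s).
Proof.
move=> oE oE' ss; elim: r g => [|r IH] g sr gr.
  split=> // x Ex; apply: continuous_comp; last exact: Cfin_continuous gr (ss x Ex).
  by apply: continuous_col => i; exact: Cfin_continuous (sr i) Ex.
have pc j x : E x -> _ := fun Ex => @partial_comp m p g s x j
  (Cfin_differentiable oE' gr (ss x Ex)) (fun i => Cfin_derivable (sr i) Ex).
apply: Cfin_primitive => // [j x Ex|j]; first by have [] := pc j x Ex.
apply: (@Cfin_ext _ _ _ (fun x => \sum_i
   partial j (fun y => s y i 0) x * partial i g (s x))) => //.
  by move=> x Ex; have [_ ->] := pc j x Ex.
apply: Cfin_sum => // i; apply: CfinM => //; first exact: Cfin_partial.
apply: (IH (partial i g)); last exact: Cfin_partial.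
by move=> k; apply: CfinW (sr k).
Qed.

End Cfin_calculus.

(** * Analytic functions as majorized series of polynomials *)

(* Polynomial expressions: a function is analytic near a iff it is a sum of
   polynomials e_k whose majorants, obtained by replacing the constants by their
   absolute values, have a convergent sum. This avoids rearranging multiple
   series. *)
Inductive pexp (R : Type) (m : nat) : Type :=
  | PCst of R
  | PVar of 'I_m
  | PAdd of pexp R m & pexp R m
  | PMul of pexp R m & pexp R m.
Arguments PCst {R m}. Arguments PVar {R m}.
Arguments PAdd {R m}. Arguments PMul {R m}.

Section pexp_algebra.
Variable R : realType.
Implicit Types m p : nat.

Fixpoint ev m (e : pexp R m) (x : 'I_m -> R) : R :=
  match e with
  | PCst c => c
  | PVar i => x i
  | PAdd a b => ev a x + ev b x
  | PMul a b => ev a x * ev b x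
  end.

Fixpoint mj m (e : pexp R m) (r : 'I_m -> R) : R :=
  match e with
  | PCst c => `|c|
  | PVar i => r i
  | PAdd a b => mj a r + mj b r
  | PMul a b => mj a r * mj b r
  end.

Lemma mj_ge0 m (e : pexp R m) r : (forall i, 0 <= r i) -> 0 <= mj e r.
Proof. by move=> r0; elim: e => //= a Ha b Hb; [exact: addr_ge0|exact: mulr_ge0]. Qed.

Lemma mj_le m (e : pexp R m) r s :
  (forall i, 0 <= r i) -> (forall i, r i <= s i) -> mj e r <= mj e s.
Proof.
move=> r0 rs; elim: e => //= a Ha b Hb; first exact: lerD.
by apply: ler_pM => //; exact: mj_ge0.
Qed.

Lemma ev_le_mj m (e : pexp R m) x r : (forall i, `|x i| <= r i) -> `|ev e x| <= mj e r.
Proof.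
move=> xr; elim: e => //= a Ha b Hb; first exact: le_trans (ler_normD _ _) (lerD Ha Hb).
by rewrite normrM; exact: ler_pM.
Qed.

Fixpoint psub m p (s : 'I_m -> pexp R p) (e : pexp R m) : pexp R p :=
  match e with
  | PCst c => PCst c
  | PVar i => s i
  | PAdd a b => PAdd (psub s a) (psub s b)
  | PMul a b => PMul (psub s a) (psub s b)
  end.

Lemma ev_psub m p (s : 'I_m -> pexp R p) e x :
  ev (psub s e) x = ev e (fun i => ev (s i) x).
Proof. by elim: e => //= a -> b ->. Qed.

Lemma mj_psub m p (s : 'I_m -> pexp R p) e x :
  mj (psub s e) x = mj e (fun i => mj (s i) x).
Proof. by elim: e => //= a -> b ->. Qed.

(* The expression e(s + d) - e(s), written without cancellation. *)
Fixpoint pdif m p (s d : 'I_m -> pexp R p) (e : pexp R m) : pexp R p :=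
  match e with
  | PCst c => PCst 0
  | PVar i => d i
  | PAdd a b => PAdd (pdif s d a) (pdif s d b)
  | PMul a b => PAdd (PMul (pdif s d a) (psub (fun i => PAdd (s i) (d i)) b))
                     (PMul (psub s a) (pdif s d b))
  end.

Lemma ev_pdif m p (s d : 'I_m -> pexp R p) e x :
  ev (pdif s d e) x =
  ev e (fun i => ev (s i) x + ev (d i) x) - ev e (fun i => ev (s i) x).
Proof.
elim: e => [c|i|a Ha b Hb|a Ha b Hb] /=; first by rewrite subrr.
- by rewrite addrAC subrr add0r.
- by rewrite Ha Hb; ring.
- by rewrite Ha Hb !ev_psub /=; ring.
Qed.

Lemma mj_pdif m p (s d : 'I_m -> pexp R p) e x :
  mj (pdif s d e) x =
  mj e (fun i => mj (s i) x + mj (d i) x) - mj e (fun i => mj (s i) x).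
Proof.
elim: e => [c|i|a Ha b Hb|a Ha b Hb] /=; first by rewrite subrr normr0.
- by rewrite addrAC subrr add0r.
- by rewrite Ha Hb; ring.
- by rewrite Ha Hb !mj_psub /=; ring.
Qed.

(** A polynomial with nonnegative coefficients is convex along nonnegative directions; the chord
    inequality makes bounds on increments shrink linearly with t. *)
Lemma mj_convex m (e : pexp R m) (r d : 'I_m -> R) t :
  (forall i, 0 <= r i) -> (forall i, 0 <= d i) -> 0 <= t <= 1 ->
  mj e (fun i => r i + t * d i) - mj e r <= t * (mj e (fun i => r i + d i) - mj e r).
Proof.
move=> r0 d0 /andP[t0 t1].
have m1 (a : pexp R m) : mj a (fun i => r i + t * d i) <= mj a (fun i => r i + d i).
  by apply: mj_le => i; rewrite ?addr_ge0 ?mulr_ge0 // lerD2l ler_piMl.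
have m0 (a : pexp R m) : mj a r <= mj a (fun i => r i + t * d i).
  by apply: mj_le => // i; rewrite lerDl mulr_ge0.
have p0 (a : pexp R m) := mj_ge0 a r0.
elim: e => [c|i|a Ha b Hb|a Ha b Hb] /=; first by rewrite !subrr mulr0.
- by rewrite [r i + _]addrC addrK [r i + _]addrC addrK.
- lra.
- move: (m1 a) (m0 a) (p0 a) (m1 b) (m0 b) (p0 b) Ha Hb.
  set A0 := mj a r; set At := mj a _; set A1 := mj a _.
  set B0 := mj b r; set Bt := mj b _; set B1 := mj b _ => *.
  have h1 : (At - A0) * Bt <= (t * (A1 - A0)) * B1 by apply: ler_pM => //; lra.
  have h2 : A0 * (Bt - B0) <= A0 * (t * (B1 - B0)) by apply: ler_wpM2l.
  by lra.
Qed.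

Fixpoint pd m (j : 'I_m) (e : pexp R m) : pexp R m :=
  match e with
  | PCst c => PCst 0
  | PVar i => PCst (i == j)%:R
  | PAdd a b => PAdd (pd j a) (pd j b)
  | PMul a b => PAdd (PMul (pd j a) b) (PMul a (pd j b))
  end.

Definition incr m (j : 'I_m) (t : R) (x : 'I_m -> R) : 'I_m -> R :=
  fun i => x i + t * (i == j)%:R.

(** The first-order Taylor remainder of the majorant in the direction j: [mj (pd j e)] is the
    derivative of [mj e], since the formal derivative introduces no signs. *)
Definition mrem m (j : 'I_m) (e : pexp R m) r t :=
  mj e (incr j t r) - mj e r - t * mj (pd j e) r.

Lemma mj_incr_le m j (e : pexp R m) r t :
  (forall i, 0 <= r i) -> 0 <= t -> mj e r <= mj e (incr j t r).
Proof. by move=> r0 t0; apply: mj_le => // i; rewrite lerDl mulr_ge0. Qed.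

Lemma mrem_ge0 m j (e : pexp R m) r t :
  (forall i, 0 <= r i) -> 0 <= t -> 0 <= mrem j e r t.
Proof.
move=> r0 t0; rewrite /mrem.
elim: e => [c|i|a Ha b Hb|a Ha b Hb] /=; first by rewrite normr0; lra.
- by rewrite /incr normr_nat; lra.
- lra.
- move: (mj_incr_le j a r0 t0) (mj_ge0 a r0) (mj_incr_le j b r0 t0) (mj_ge0 b r0) Ha Hb.
  set A0 := mj a r; set At := mj a _; set A1 := mj (pd j a) _.
  set B0 := mj b r; set Bt := mj b _; set B1 := mj (pd j b) _ => *.
  (* The remainder of a product ab is rem(a) b + a rem(b) + (increment of a)(increment of b). The
     same identity carries the next estimates through products. *)
  have h1 : 0 <= (At - A0 - t * A1) * B0 by apply: mulr_ge0.
  have h2 : 0 <= A0 * (Bt - B0 - t * B1) by apply: mulr_ge0.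
  have h3 : 0 <= (At - A0) * (Bt - B0) by apply: mulr_ge0; lra.
  by lra.
Qed.

Lemma pd_rem m j (e : pexp R m) x r t : (forall i, `|x i| <= r i) ->
  `|ev e (incr j t x) - ev e x - t * ev (pd j e) x| <= mrem j e r `|t|.
Proof.
move=> xr; have r0 i : 0 <= r i := le_trans (normr_ge0 _) (xr i).
have P a : `|ev a x| <= mj a r by exact: ev_le_mj.
have D a : `|ev a (incr j t x) - ev a x| <= mj a (incr j `|t| r) - mj a r.
  pose s (i : 'I_m) : pexp R m := PVar i.
  pose d (i : 'I_m) : pexp R m := PCst (t * (i == j)%:R).
  have := @ev_le_mj _ (pdif s d a) x r xr.
  rewrite ev_pdif mj_pdif /=.
  by rewrite [X in mj _ X](_ : _ = incr j `|t| r) //; apply/funext => i;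
    rewrite /incr normrM normr_nat.
rewrite /mrem; elim: e => [c|i|a Ha b Hb|a Ha b Hb] /=.
- by rewrite subrr mulr0 subrr normr0 subrr add0r mulr0 oppr0.
- rewrite /incr normr_nat [x i + _]addrC addrK [r i + _]addrC addrK !subrr normr0 //.
- rewrite (_ : _ - _ = (ev a (incr j t x) - ev a x - t * ev (pd j a) x) +
    (ev b (incr j t x) - ev b x - t * ev (pd j b) x)); last by ring.
  by apply: le_trans (ler_normD _ _) _; lra.
- have -> : ev a (incr j t x) * ev b (incr j t x) - ev a x * ev b x -
     t * (ev (pd j a) x * ev b x + ev a x * ev (pd j b) x) =
     (ev a (incr j t x) - ev a x - t * ev (pd j a) x) * ev b x +
     ev a x * (ev b (incr j t x) - ev b x - t * ev (pd j b) x) +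
     (ev a (incr j t x) - ev a x) * (ev b (incr j t x) - ev b x) by ring.
  have -> : mj a (incr j `|t| r) * mj b (incr j `|t| r) - mj a r * mj b r -
     `|t| * (mj (pd j a) r * mj b r + mj a r * mj (pd j b) r) =
     (mj a (incr j `|t| r) - mj a r - `|t| * mj (pd j a) r) * mj b r +
     mj a r * (mj b (incr j `|t| r) - mj b r - `|t| * mj (pd j b) r) +
     (mj a (incr j `|t| r) - mj a r) * (mj b (incr j `|t| r) - mj b r) by ring.
  apply: le_trans (ler_normD _ _) _; apply: lerD; last by rewrite normrM; exact: ler_pM.
  apply: le_trans (ler_normD _ _) _; apply: lerD; rewrite normrM; exact: ler_pM.
Qed.

(** The remainder only has terms of degree at least 2 in t, with nonnegative coefficients. The
    resulting factor s^2 is the same for every polynomial, so it survives summation over a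
    series. *)
Lemma mrem_scale m j (e : pexp R m) r t s :
  (forall i, 0 <= r i) -> 0 <= t -> 0 <= s <= 1 ->
  mrem j e r (s * t) <= s ^+ 2 * mrem j e r t.
Proof.
move=> r0 t0 s01; have /andP[s0 s1] := s01; rewrite /mrem.
have C a : mj a (incr j (s * t) r) - mj a r <= s * (mj a (incr j t r) - mj a r).
  have := @mj_convex _ a r (fun i => t * (i == j)%:R) s r0 _ s01.
  rewrite [X in mj _ X - _](_ : _ = incr j (s * t) r); last first.
    by apply/funext => i; rewrite /incr mulrA.
  by apply=> i; exact: mulr_ge0.
have st0 : 0 <= s * t by exact: mulr_ge0.
elim: e => [c|i|a Ha b Hb|a Ha b Hb] /=; first by rewrite normr0; lra.
- by rewrite /incr normr_nat; lra.
- lra.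
- move: (mj_ge0 a r0) (mj_ge0 b r0) (mj_incr_le j a r0 st0) (mj_incr_le j b r0 st0).
  move: (C a) (C b) Ha Hb.
  set A0 := mj a r; set As := mj a (incr j (s * t) r); set At := mj a (incr j t r).
  set A1 := mj (pd j a) _.
  set B0 := mj b r; set Bs := mj b (incr j (s * t) r); set Bt := mj b (incr j t r).
  set B1 := mj (pd j b) _ => CA CB Ha Hb A00 B00 AA BB.
  have h1 : (As - A0 - s * t * A1) * B0 <= s ^+ 2 * (At - A0 - t * A1) * B0.
    exact: ler_wpM2r.
  have h2 : A0 * (Bs - B0 - s * t * B1) <= A0 * (s ^+ 2 * (Bt - B0 - t * B1)).
    exact: ler_wpM2l.
  have h3 : (As - A0) * (Bs - B0) <= (s * (At - A0)) * (s * (Bt - B0)).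
    by apply: ler_pM => //; lra.
  by lra.
Qed.

(** A Cauchy estimate: the derivative at radius r is controlled by the majorant at the larger radius
    r + t, because the Taylor remainder is nonnegative. *)
Lemma mj_pd_bound m j (e : pexp R m) r t : (forall i, 0 <= r i) -> 0 <= t ->
  t * mj (pd j e) r <= mj e (incr j t r).
Proof.
move=> r0 t0; have := mrem_ge0 j e r0 t0; rewrite /mrem.
by have := mj_ge0 e r0; lra.
Qed.

Fixpoint psum m (u : nat -> pexp R m) (K : nat) : pexp R m :=
  if K is K'.+1 then PAdd (psum u K') (u K') else PCst 0.

Lemma ev_psum m (u : nat -> pexp R m) K x :
  ev (psum u K) x = \sum_(0 <= k < K) ev (u k) x.
Proof. by elim: K => [|K IH]; [rewrite big_geq|rewrite big_nat_recr //= IH]. Qed.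

Lemma mj_psum m (u : nat -> pexp R m) K x :
  mj (psum u K) x = \sum_(0 <= k < K) mj (u k) x.
Proof. by elim: K => [|K IH]; [rewrite big_geq //= normr0|rewrite big_nat_recr //= IH]. Qed.

Lemma ev_continuous m (T : Type) (F : set_system T) {FF : Filter F}
    (e : pexp R m) (u : T -> 'I_m -> R) (l : 'I_m -> R) :
  (forall i, u t i @[t --> F] --> l i) -> ev e (u t) @[t --> F] --> ev e l.
Proof.
move=> H; elim: e => [c|i|a Ha b Hb|a Ha b Hb] /=.
- exact: cvg_cst.
- exact: H.
- exact: cvgD.
- exact: cvgM.
Qed.

End pexp_algebra.

(** * Majorized series: composition and termwise differentiation *)

Section majorized_series.
Variable R : realType.

Lemma bounded_tail (u : nat -> R) (M : R) : (forall k, 0 <= u k) ->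
  (forall K, \sum_(0 <= k < K) u k <= M) ->
  forall e : R, 0 < e -> exists J, forall K, (J <= K)%N -> \sum_(J <= k < K) u k <= e.
Proof.
move=> u0 uM e e0.
have nd : nondecreasing_seq (series u).
  by apply/nondecreasing_seqP => n; rewrite /series /= big_nat_recr //= lerDl.
have cu : cvgn (series u).
  by apply: nondecreasing_is_cvgn nd _; exists M => _ [n _ <-]; exact: uM.
have /cvgrPdist_lt/(_ e e0)[J _ HJ] := cu.
exists J => K JK; have := HJ J (leqnn J); rewrite /= ger0_norm; last first.
  by rewrite subr_ge0; exact: nondecreasing_cvgn_le.
have := nondecreasing_cvgn_le nd cu K.
move: (limn _) => l; rewrite /series /= (big_cat_nat (leq0n J) JK) /=.
by lra.
Qed.

Lemma lim_dist_le (S : nat -> R) l c e J :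
  (forall K, (J <= K)%N -> `|S K - c| <= e) -> S @ \oo --> l -> `|l - c| <= e.
Proof.
move=> H /cvgrPdist_lt Sl; apply/ler_addgt0Pr => d d0.
have [K0 _ HK] := Sl d d0.
have := HK (maxn K0 J) (leq_maxl _ _); have := H (maxn K0 J) (leq_maxr _ _).
rewrite /= => h1 h2; rewrite (_ : l - c = (l - S (maxn K0 J)) + (S (maxn K0 J) - c)); last by ring.
by apply: le_trans (ler_normD _ _) _; lra.
Qed.

Lemma tail_dist_le (a u : nat -> R) l e J : (forall k, `|a k| <= u k) ->
  (forall K, (J <= K)%N -> \sum_(J <= k < K) u k <= e) ->
  (fun K => \sum_(0 <= k < K) a k) @ \oo --> l ->
  `|l - \sum_(0 <= k < J) a k| <= e.
Proof.
move=> au H; apply: (lim_dist_le (J := J)) => K JK.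
rewrite (big_cat_nat (leq0n J) JK) /= addrAC subrr add0r.
apply: le_trans (ler_norm_sum _ _ _) _; apply: le_trans (H K JK).
by apply: ler_sum => k _; exact: au.
Qed.

Lemma dominated_cvg (a u : nat -> R) M : (forall k, `|a k| <= u k) ->
  (forall K, \sum_(0 <= k < K) u k <= M) -> cvgn (fun K => \sum_(0 <= k < K) a k).
Proof.
move=> au uM; have u0 k : 0 <= u k := le_trans (normr_ge0 _) (au k).
apply: normed_cvg; apply: (series_le_cvg (v_ := u)) => //; first by move=> n /=.
apply: nondecreasing_is_cvgn; last by exists M => _ [n _ <-]; exact: uM.
by apply/nondecreasing_seqP => n; rewrite /series /= big_nat_recr //= lerDl.
Qed.

(** The inverse of 1 plus the sum of the 1 / r i plays the role of a minimum and makes sense for an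
    empty index type too. *)
Lemma common_radius (I : finType) (r : I -> R) : (forall i, 0 < r i) ->
  exists2 r0 : R, 0 < r0 & forall i, r0 <= r i.
Proof.
move=> r_gt0; have s0 : 0 <= \sum_i (r i)^-1 by apply: sumr_ge0 => i _; rewrite invr_ge0 ltW.
exists (\sum_i (r i)^-1 + 1)^-1; first by rewrite invr_gt0 ltr_wpDl.
move=> i; rewrite -[leRHS]invrK lef_pV2 ?posrE ?invr_gt0 ?ltr_wpDl //.
rewrite (bigD1 i) //= -addrA lerDl addr_ge0 // sumr_ge0 // => j _.
by rewrite invr_ge0 ltW.
Qed.

Definition mseries m (a : 'cV[R]_m) (r : R) (e : nat -> pexp R m)
    (g : 'cV[R]_m -> R) : Prop :=
  (exists M, forall K, \sum_(0 <= k < K) mj (e k) (fun=> r) <= M) /\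
  forall x : 'cV[R]_m, (forall i, `|x i 0 - a i 0| <= r) ->
    (fun K => \sum_(0 <= k < K) ev (e k) (fun i => x i 0 - a i 0)) @ \oo --> g x.

Definition an_at m (a : 'cV[R]_m) (g : 'cV[R]_m -> R) : Prop :=
  exists r e, 0 < r /\ mseries a r e g.

Lemma mseriesW m (a : 'cV[R]_m) r s e g :
  0 <= s <= r -> mseries a r e g -> mseries a s e g.
Proof.
move=> /andP[s0 sr] [[M HM] H]; split.
  exists M => K; apply: le_trans (HM K).
  by apply: ler_sum => k _; apply: mj_le.
by move=> x xs; apply: H => i; exact: le_trans (xs i) sr.
Qed.

Lemma mseries_ext m (a : 'cV[R]_m) r e g h :
  (forall x : 'cV[R]_m, (forall i, `|x i 0 - a i 0| <= r) -> g x = h x) ->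
  mseries a r e g -> mseries a r e h.
Proof. by move=> E [M H]; split=> // x xr; rewrite -E //; exact: H. Qed.

Lemma mseries_finite m (a : 'cV[R]_m) r (e : pexp R m) :
  mseries a r (fun k => if k is 0%N then e else PCst 0)
    (fun x => ev e (fun i => x i 0 - a i 0)).
Proof.
have S (u : nat -> R) K : (forall k, u k.+1 = 0) -> \sum_(0 <= k < K.+1) u k = u 0.
  by move=> u0; rewrite big_nat_recl // big1 ?addr0.
split.
  exists (Num.max 0 (mj e (fun=> r))) => -[|K].
    by rewrite big_geq // le_max lexx.
  by rewrite S /= ?le_max ?lexx ?orbT // => k; rewrite normr0.
move=> x _; rewrite -(cvg_shiftS _ _) /=.
rewrite (_ : (fun K => _) = fun=> ev e (fun i => x i 0 - a i 0)); first exact: cvg_cst.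
by apply/funext => K; rewrite S.
Qed.

Lemma an_at_pexp m (a : 'cV[R]_m) (e : pexp R m) :
  an_at a (fun x => ev e (fun i => x i 0)).
Proof.
pose s i : pexp R m := PAdd (PCst (a i 0)) (PVar i).
exists 1, (fun k => if k is 0%N then psub s e else PCst 0); split=> //.
apply: mseries_ext (mseries_finite a 1 (psub s e)) => x _.
by rewrite ev_psub /=; congr ev; apply/funext => i; rewrite addrC subrK.
Qed.

(** Each term loses its value at the centre of expansion. By convexity the majorants of what remains
    become small with the radius, which constant terms would prevent; a composition needs the inner
    increments to be that small. *)
Definition centre m (e : nat -> pexp R m) k : pexp R m :=
  pdif (fun i => PCst 0) PVar (e k).

Lemma centre_bound m (e : nat -> pexp R m) r M t : 0 <= r -> 0 <= t <= 1 ->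
  (forall K, \sum_(0 <= k < K) mj (e k) (fun=> r) <= M) ->
  forall K, \sum_(0 <= k < K) mj (centre e k) (fun=> t * r) <= t * M.
Proof.
move=> r0 t01 HM K; have /andP[t0 _] := t01.
apply: (@le_trans _ _ (t * \sum_(0 <= k < K) mj (e k) (fun=> r))); last first.
  by rewrite ler_wpM2l.
rewrite mulr_sumr; apply: ler_sum => k _.
rewrite mj_pdif /= normr0.
have := @mj_convex R m (e k) (fun=> 0) (fun=> r) t _ _ t01.
move=> /(_ _ _)/le_trans -> //; rewrite ler_wpM2l // add0r.
by rewrite lerBlDr lerDl mj_ge0.
Qed.

Lemma centre_cvg m (a : 'cV[R]_m) r e g (x : 'cV[R]_m) : 0 <= r -> mseries a r e g ->
  (forall i, `|x i 0 - a i 0| <= r) ->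
  (fun K => \sum_(0 <= k < K) ev (centre e k) (fun i => x i 0 - a i 0)) @ \oo
    --> g x - g a.
Proof.
move=> r0 [_ H] xr.
have Ha := H a _; rewrite (_ : (fun K => _) = (fun K =>
   \sum_(0 <= k < K) ev (e k) (fun i => x i 0 - a i 0)) \-
   (fun K => \sum_(0 <= k < K) ev (e k) (fun i => a i 0 - a i 0))).
  apply: cvgB; first exact: H.
  by apply: Ha => i; rewrite subrr normr0.
apply/funext => K /=; rewrite -sumrB; apply: eq_bigr => k _.
rewrite ev_pdif /=; congr (_ - _); congr ev; apply/funext => i.
  by rewrite add0r.
by rewrite subrr.
Qed.

(* Terms of the telescoping series with partial sums
   sum_(k < K) e k o (sum_(l < K) d l). *)
Definition comp_term m p (e : nat -> pexp R p) (d : 'I_p -> nat -> pexp R m) K : pexp R m :=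
  PAdd (psub (fun i => psum (d i) K.+1) (e K))
       (psum (fun k => pdif (fun i => psum (d i) K) (fun i => d i K) (e k)) K).

Lemma ev_comp_term m p (e : nat -> pexp R p) (d : 'I_p -> nat -> pexp R m) K x :
  \sum_(0 <= k < K) ev (comp_term e d k) x =
  \sum_(0 <= k < K) ev (e k) (fun i => \sum_(0 <= l < K) ev (d i l) x).
Proof.
elim: K => [|K IH]; first by rewrite !big_geq.
rewrite big_nat_recr //= IH [RHS]big_nat_recr //= ev_psub ev_psum.
have S : (fun i => ev (PAdd (psum (d i) K) (d i K)) x) =
   (fun i => \sum_(0 <= l < K.+1) ev (d i l) x).
  by apply/funext => i; rewrite /= ev_psum big_nat_recr.
rewrite S addrCA [RHS]addrC; congr (_ + _).
rewrite -big_split /=; apply: eq_bigr => k _.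
rewrite ev_pdif (_ : (fun i => ev (psum (d i) K) x) = fun i => \sum_(0 <= l < K) ev (d i l) x).
  rewrite addrC subrK; congr ev; rewrite -S /=; apply/funext => i.
  by rewrite ev_psum.
by apply/funext => i; rewrite ev_psum.
Qed.

Lemma mj_comp_term m p (e : nat -> pexp R p) (d : 'I_p -> nat -> pexp R m) K x :
  \sum_(0 <= k < K) mj (comp_term e d k) x =
  \sum_(0 <= k < K) mj (e k) (fun i => \sum_(0 <= l < K) mj (d i l) x).
Proof.
elim: K => [|K IH]; first by rewrite !big_geq.
rewrite big_nat_recr //= IH [RHS]big_nat_recr //= mj_psub mj_psum.
have S : (fun i => mj (PAdd (psum (d i) K) (d i K)) x) =
   (fun i => \sum_(0 <= l < K.+1) mj (d i l) x).
  by apply/funext => i; rewrite /= mj_psum big_nat_recr.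
rewrite S addrCA [RHS]addrC; congr (_ + _).
rewrite -big_split /=; apply: eq_bigr => k _.
rewrite mj_pdif (_ : (fun i => mj (psum (d i) K) x) = fun i => \sum_(0 <= l < K) mj (d i l) x).
  rewrite addrC subrK; congr mj; rewrite -S /=; apply/funext => i.
  by rewrite mj_psum.
by apply/funext => i; rewrite mj_psum.
Qed.

Lemma an_at_comp m p (a : 'cV[R]_m) (g : 'cV[R]_p -> R) (s : 'cV[R]_m -> 'cV[R]_p) :
  an_at (s a) g -> (forall i, an_at a (fun x => s x i 0)) -> an_at a (g \o s).
Proof.
move=> [rho [e [rho0 [[M HM] H]]]] /choice[ri /choice[di Hd]].
have [r0 r00 r0r] := common_radius (fun i => (Hd i).1).
have Sd i : mseries a r0 (di i) (fun x => s x i 0).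
  by apply: mseriesW (Hd i).2; rewrite ltW //= r0r.
have /choice[Mi HMi] : forall i, exists M, forall K, \sum_(0 <= k < K) mj (di i k) (fun=> r0) <= M.
  by move=> i; have [] := Sd i.
pose B := \sum_i `|Mi i|.
have B0 : 0 <= B by apply: sumr_ge0.
have MB i : Mi i <= B.
  rewrite /B (bigD1 i) //=; apply: le_trans (ler_norm _) _.
  by rewrite lerDl sumr_ge0.
(* Shrinking the radius by t brings the inner majorants below rho: the denominator gives both t <= 1
   and t B <= rho. *)
pose t := rho / (B + rho + 1).
have D0 : 0 < B + rho + 1 by rewrite ltr_wpDl // addr_ge0 // ltW.
have t0 : 0 < t by rewrite divr_gt0.
have t1 : t <= 1 by rewrite ler_pdivrMr // mul1r -addrA addrCA lerDl addr_ge0.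
have tB : t * B <= rho.
  rewrite /t mulrAC ler_pdivrMr // ler_wpM2l ?ltW // -addrA ltrDl.
  by rewrite ltr_wpDl // ltW.
pose d i := centre (di i).
have t01 : 0 <= t <= 1 by rewrite t1 ltW.
have Hdb i K : \sum_(0 <= k < K) mj (d i k) (fun=> t * r0) <= rho.
  apply: le_trans tB; apply: (centre_bound (ltW r00) t01) => {}K.
  exact: le_trans (HMi i K) (MB i).
exists (t * r0), (comp_term e d); split; first exact: mulr_gt0.
have tr0 : 0 <= t * r0 by rewrite mulr_ge0 // ltW.
split.
  exists M => K; rewrite mj_comp_term; apply: le_trans (HM K).
  apply: ler_sum => k _; apply: mj_le => i //.
  by apply: sumr_ge0 => l _; exact: mj_ge0.
move=> x xr.
pose v : 'I_m -> R := fun i => x i 0 - a i 0.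
pose y : 'I_p -> R := fun i => s x i 0 - s a i 0.
pose S K i := \sum_(0 <= l < K) ev (d i l) v.
have Sy i : S K i @[K --> \oo] --> y i.
  apply: (centre_cvg (ltW r00) (Sd i)) => j; apply: le_trans (xr j) _.
  by rewrite ler_piMl // ltW.
have S_le K i : `|S K i| <= rho.
  apply: le_trans (Hdb i K); apply: le_trans (ler_norm_sum _ _ _) _.
  by apply: ler_sum => l _; exact: ev_le_mj.
have y_le i : `|y i| <= rho.
  rewrite -[y i]subr0; apply: (lim_dist_le (J := 0) _ (Sy i)) => K _.
  by rewrite subr0.
have Hg : (fun K => \sum_(0 <= k < K) ev (e k) y) @ \oo --> g (s x) by exact: H.
rewrite (_ : (fun K => _) = fun K => \sum_(0 <= k < K) ev (e k) (S K)); last first.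
  by apply/funext => K; rewrite ev_comp_term.
have ej0 k : 0 <= mj (e k) (fun=> rho) by apply: mj_ge0 => _; exact: ltW.
(* The partial sums evaluate the first K outer terms at the K-th partial sums of the inner series.
   The terms k < J converge by continuity of polynomials; those with k >= J are small uniformly in
   K, by the majorants at radius rho. *)
apply/cvgrPdist_le => eps eps0.
have e3 : 0 < eps / 3 by rewrite divr_gt0.
have [J HJ] := bounded_tail ej0 HM e3.
have HSJ : \sum_(0 <= k < J) ev (e k) (S K) @[K --> \oo] --> \sum_(0 <= k < J) ev (e k) y.
  by apply: cvg_finsum => k; apply: ev_continuous => i; exact: Sy.
have /cvgrPdist_le/(_ _ e3)[K0 _ HK0] := HSJ.
have gJ : `|g (s x) - \sum_(0 <= k < J) ev (e k) y| <= eps / 3.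
  by apply: (tail_dist_le _ HJ Hg) => k; exact: ev_le_mj.
near=> K.
have JK : (J <= K)%N by near: K; exact: nbhs_infty_ge.
have K0K : (K0 <= K)%N by near: K; exact: nbhs_infty_ge.
rewrite (big_cat_nat (leq0n J) JK) /=.
have h1 := HK0 K K0K; rewrite /= in h1.
have h2 : `|\sum_(J <= k < K) ev (e k) (S K)| <= eps / 3.
  apply: le_trans (ler_norm_sum _ _ _) _; apply: le_trans (HJ K JK).
  by apply: ler_sum => k _; apply: ev_le_mj => i; exact: S_le.
rewrite [X in `|X|](_ : _ = (g (s x) - \sum_(0 <= k < J) ev (e k) y) +
  (\sum_(0 <= k < J) ev (e k) y - \sum_(0 <= k < J) ev (e k) (S K)) -
  \sum_(J <= k < K) ev (e k) (S K)); last by rewrite /comp; ring.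
apply: le_trans (ler_normB _ _) _.
apply: le_trans (lerD (ler_normD _ _) (lexx _)) _.
lra.
Unshelve. all: by end_near. Qed.

(** Half the radius is kept as room for the increment. The Cauchy estimate sums the derived series,
    and the Taylor remainders of all terms sum to a multiple of t^2, so the derived series gives the
    derivative of the sum. *)
Lemma mseries_derive m (a : 'cV[R]_m) r e g j : 0 < r -> mseries a r e g ->
  (forall x : 'cV[R]_m, (forall i, `|x i 0 - a i 0| <= r / 2) -> derivable g x (basis_vec R j)) /\
  mseries a (r / 2) (fun k => pd j (e k)) (partial j g).
Proof.
move=> r0 [[M HM] H]; pose q := r / 2.
have q0 : 0 < q by rewrite divr_gt0.
have qr : r = q + q by rewrite /q; lra.
have mj_bound k t : 0 <= t <= q -> mj (e k) (incr j t (fun=> q)) <= mj (e k) (fun=> r).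
  move=> /andP[t0 tq]; apply: mj_le => i; first by rewrite addr_ge0 ?mulr_ge0 // ltW.
  rewrite /incr qr lerD2l; case: (i == j); rewrite ?mulr1 ?mulr0 // ltW //.
have pd_bd K : \sum_(0 <= k < K) mj (pd j (e k)) (fun=> q) <= M / q.
  rewrite ler_pdivlMr // mulr_suml; apply: le_trans (HM K).
  apply: ler_sum => k _; rewrite mulrC.
  apply: le_trans (mj_pd_bound _ _ _ _) (mj_bound k q _) => //; rewrite ?lexx ?andbT ltW //.
have main (x : 'cV[R]_m) : (forall i, `|x i 0 - a i 0| <= q) ->
   exists2 l, is_derive x (basis_vec R j) g l &
   (fun K => \sum_(0 <= k < K) ev (pd j (e k)) (fun i => x i 0 - a i 0)) @ \oo --> l.
  move=> xq; pose v i := x i 0 - a i 0.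
  have C : cvgn (fun K => \sum_(0 <= k < K) ev (pd j (e k)) v).
    by apply: (dominated_cvg (u := fun k => mj (pd j (e k)) (fun=> q)) _ pd_bd) => k;
      exact: ev_le_mj.
  pose l := limn (fun K => \sum_(0 <= k < K) ev (pd j (e k)) v).
  exists l => //.
  have M0 : 0 <= M by have := HM 0%N; rewrite big_geq.
  (* quadratic remainder: |g(x + t) - g(x) - t l| <= (t / q)^2 M *)
  have rem t : `|t| <= q ->
     `|g (x + t *: basis_vec R j) - g x - t * l| <= (`|t| / q) ^+ 2 * M.
    move=> tq.
    have s01 : 0 <= `|t| / q <= 1.
      by rewrite divr_ge0 ?(ltW q0) //= ler_pdivrMr // mul1r.
    have L1 : (fun K => \sum_(0 <= k < K) ev (e k) (incr j t v)) @ \oo --> g (x + t *: basis_vec R j).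
      rewrite (_ : incr j t v = fun i => (x + t *: basis_vec R j) i 0 - a i 0); last first.
        by apply/funext => i; rewrite /incr /v !mxE eqxx andbT addrAC.
      apply: H => i; rewrite !mxE eqxx andbT addrAC qr.
      apply: le_trans (ler_normD _ _) _; apply: lerD; first exact: xq.
      by case: (i == j); rewrite ?mulr1 ?mulr0 ?normr0 // ltW.
    have L2 : (fun K => \sum_(0 <= k < K) ev (e k) v) @ \oo --> g x.
      by apply: H => i; apply: le_trans (xq i) _; rewrite qr lerDl ltW.
    have L3 : (fun K => \sum_(0 <= k < K) ev (e k) (incr j t v) -
       \sum_(0 <= k < K) ev (e k) v - t * \sum_(0 <= k < K) ev (pd j (e k)) v) @ \oo
       --> g (x + t *: basis_vec R j) - g x - t * l.
      by apply: cvgB; [exact: cvgB|exact: cvgMl_tmp].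
    rewrite -[X in `|X|]subr0; apply: (lim_dist_le (J := 0%N) _ L3) => K _ /=.
    rewrite subr0 mulr_sumr -!sumrB.
    apply: le_trans (ler_norm_sum _ _ _) _.
    apply: (@le_trans _ _ (\sum_(0 <= k < K) (`|t| / q) ^+ 2 * mj (e k) (fun=> r))); last first.
      by rewrite -mulr_sumr ler_wpM2l ?sqr_ge0.
    apply: ler_sum => k _.
    apply: le_trans (pd_rem j (e k) t xq) _.
    rewrite -{1}[`|t|](divfK (lt0r_neq0 q0)).
    apply: le_trans (mrem_scale j (e k) _ (ltW q0) s01) _; first by move=> _; exact: ltW.
    rewrite ler_wpM2l ?sqr_ge0 //; apply: le_trans (mj_bound k q _); last by rewrite lexx ltW.
    rewrite /mrem; have := @mj_ge0 R m (e k) (fun=> q) (fun=> ltW q0).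
    have := @mj_ge0 R m (pd j (e k)) (fun=> q) (fun=> ltW q0).
    by move=> p1 p2; have := mulr_ge0 (ltW q0) p1; lra.
  apply: line_derivable.
  have E : (fun h => h^-1 *: (((fun s => g (x + s *: basis_vec R j)) \o shift 0) (h *: 1) -
       g (x + 0 *: basis_vec R j))) @ 0^' --> l.
    apply/cvgrPdist_le => eps eps0.
    pose c := M / q ^+ 2.
    have c0 : 0 <= c by rewrite divr_ge0 ?sqr_ge0.
    near=> h.
    have h0 : h != 0 by near: h; exact: nbhs_dnbhs_neq.
    have hq : `|h| <= q by near: h; exact: dnbhs0_le.
    have hc : `|h| <= eps / (c + 1).
      by near: h; apply: dnbhs0_le; rewrite divr_gt0 // ltr_wpDl.
    rewrite /= addr0 scale0r addr0 [h *: 1]mulr1 distrC.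
    rewrite -[X in `|X - l|]/(h^-1 * (g (x + h *: basis_vec R j) - g x)).
    have -> : h^-1 * (g (x + h *: basis_vec R j) - g x) - l =
       h^-1 * (g (x + h *: basis_vec R j) - g x - h * l).
      by rewrite [RHS]mulrBr mulKf.
    rewrite normrM normfV mulrC ler_pdivrMr ?normr_gt0 //.
    apply: le_trans (rem h hq) _.
    have -> : (`|h| / q) ^+ 2 * M = `|h| * c * `|h|.
      by rewrite /c exprMn exprVn; ring.
    rewrite ler_wpM2r //; apply: le_trans (ler_wpM2r c0 hc) _.
    rewrite mulrAC ler_pdivrMr ?ltr_wpDl //.
    by rewrite ler_wpM2l ?lerDl // ltW.
  apply: DeriveDef; first by apply/cvg_ex; exists l; exact: E.
  by apply: cvg_lim => //; exact: E.
split=> [x xq|]; first by have [l [d _]] := main x xq.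
split; first by exists (M / q); exact: pd_bd.
by move=> x xq; have [l [_ <-]] := main x xq.
Unshelve. all: by end_near. Qed.

Lemma an_at_partial m (a : 'cV[R]_m) g j : an_at a g -> an_at a (partial j g).
Proof.
move=> [r [e [r0 H]]]; exists (r / 2), (fun k => pd j (e k)).
by split; [rewrite divr_gt0|have [] := mseries_derive j r0 H].
Qed.

Lemma an_at_derivable m (a : 'cV[R]_m) g j : an_at a g -> derivable g a (basis_vec R j).
Proof.
move=> [r [e [r0 H]]]; have [+ _] := mseries_derive j r0 H; apply => i.
by rewrite subrr normr0 divr_ge0 // ltW.
Qed.

End majorized_series.

(** * Multi-index power series as series of polynomials, and back *)

Section box_sums.
Variables (R : realType) (m : nat).
Local Notation mi := {ffun 'I_m -> nat}.
Implicit Types (b : mi) (e : pexp R m) (v : 'cV[R]_m).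

Definition ppow (i : 'I_m) (n : nat) : pexp R m := iter n (PMul (PVar i)) (PCst 1).

Lemma ev_ppow i n x : ev (ppow i n) x = x i ^+ n.
Proof. by elim: n => //= n ->; rewrite exprS. Qed.

Lemma mj_ppow i n x : mj (ppow i n) x = x i ^+ n.
Proof. by elim: n => [|n /= ->]; rewrite ?exprS //= normr1. Qed.

Definition pmono_seq b (s : seq 'I_m) : pexp R m :=
  foldr (fun i => PMul (ppow i (b i))) (PCst 1) s.

Definition pterm (c : R) b : pexp R m := PMul (PCst c) (pmono_seq b (enum 'I_m)).

Lemma ev_pterm c b x : ev (pterm c b) x = c * \prod_i x i ^+ b i.
Proof.
rewrite /= -big_enum /=; congr (_ * _); elim: (enum _) => [|i s /= ->]; first by rewrite big_nil.
by rewrite big_cons ev_ppow.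
Qed.

Lemma mj_pterm c b x : mj (pterm c b) x = `|c| * \prod_i x i ^+ b i.
Proof.
rewrite /= -big_enum /=; congr (_ * _).
elim: (enum _) => [|i s /= ->]; first by rewrite big_nil /= normr1.
by rewrite big_cons mj_ppow.
Qed.

Definition plist (s : seq (pexp R m)) : pexp R m := foldr PAdd (PCst 0) s.

Lemma ev_plist s x : ev (plist s) x = \sum_(e <- s) ev e x.
Proof. by elim: s => [|e s /= ->]; rewrite ?big_nil ?big_cons. Qed.

Lemma mj_plist s x : mj (plist s) x = \sum_(e <- s) mj e x.
Proof. by elim: s => [|e s /= ->]; rewrite ?big_nil ?big_cons //= normr0. Qed.

Definition natf N (b : {ffun 'I_m -> 'I_N}) : mi := [ffun i => b i : nat].

Lemma box_sumE (t : mi -> R) N : box_sum t N = \sum_(b : {ffun 'I_m -> 'I_N}) t (natf b).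
Proof. by []. Qed.

(** Consecutive boxes differ by the shell of multi-indices with a maximal entry. Sizes start at 1 so
    that [inord] can map back into the smaller box. *)
Lemma box_sum_recr (t : mi -> R) N : box_sum t N.+2 = box_sum t N.+1 +
  \sum_(b : {ffun 'I_m -> 'I_N.+2} | [exists i, b i == ord_max]) t (natf b).
Proof.
rewrite [LHS]box_sumE (bigID (fun b : {ffun 'I_m -> 'I_N.+2} => [exists i, b i == ord_max])) /=.
rewrite addrC; congr (_ + _).
pose h (b : {ffun 'I_m -> 'I_N.+1}) : {ffun 'I_m -> 'I_N.+2} :=
  [ffun i => widen_ord (leqnSn _) (b i)].
pose h' (b : {ffun 'I_m -> 'I_N.+2}) : {ffun 'I_m -> 'I_N.+1} := [ffun i => inord (b i)].
rewrite (reindex_onto h h') /=; last first.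
  move=> b; rewrite negb_exists => /forallP bm; apply/ffunP => i.
  apply: val_inj; rewrite /h /h' !ffunE /= inordK //.
  by have := bm i; have := ltn_ord (b i); rewrite -(inj_eq val_inj) /= ltnS leq_eqVlt => /orP[->|].
rewrite box_sumE; apply: eq_big => [b|b _].
  have H1 : ~~ [exists i, h b i == ord_max].
    by rewrite negb_exists; apply/forallP => i; rewrite ffunE -(inj_eq val_inj) /= ltn_eqF.
  rewrite H1 /=; apply/eqP/ffunP => i; apply: val_inj.
  by rewrite /h /h' !ffunE /= inordK.
by congr t; apply/ffunP => i; rewrite !ffunE.
Qed.

(** The k-th shell gathered into one polynomial. The disjunct k = 0 matters for m = 0, where no
    entry can be maximal but the constant term must be counted. *)
Definition block (c : mi -> R) (k : nat) : pexp R m :=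
  plist [seq pterm (c (natf d)) (natf d) |
    d <- [seq d : {ffun 'I_m -> 'I_k.+1} <- enum {: {ffun 'I_m -> 'I_k.+1}} |
            (k == 0%N) || [exists i, d i == ord_max]]].

Lemma sum_blocks (t : mi -> R) (u : nat -> R) :
  (forall k, u k = \sum_(b : {ffun 'I_m -> 'I_k.+1} | (k == 0%N) || [exists i, b i == ord_max]) t (natf b)) ->
  forall N, \sum_(0 <= k < N.+1) u k = box_sum t N.+1.
Proof.
move=> H; elim=> [|N IH]; first by rewrite big_nat1 H.
by rewrite big_nat_recr //= IH H box_sum_recr.
Qed.

Lemma ev_block c N v : \sum_(0 <= k < N.+1) ev (block c k) (fun i => v i 0) =
  box_sum (power_term c v) N.+1.
Proof.
apply: sum_blocks => k; rewrite ev_plist big_map big_filter.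
by rewrite big_enum_cond; apply: eq_bigr => b _; rewrite ev_pterm.
Qed.

Lemma mj_block c N v : (forall i, 0 <= v i 0) ->
  \sum_(0 <= k < N.+1) mj (block c k) (fun i => v i 0) =
  box_sum (fun b => `|power_term c v b|) N.+1.
Proof.
move=> v0; apply: sum_blocks => k; rewrite mj_plist big_map big_filter.
rewrite big_enum_cond; apply: eq_bigr => b _; rewrite mj_pterm normrM.
by congr (_ * _); rewrite ger0_norm // prodr_ge0 // => i _; exact: exprn_ge0.
Qed.

(** Products are expanded but equal monomials are not collected, so value and majorant can both be
    read off the list; collecting, as [coef] does, can only decrease absolute values. *)
Fixpoint flat e : seq (R * mi) :=
  match e with
  | PCst c => [:: (c, [ffun=> 0%N])]
  | PVar i => [:: (1, [ffun j => (i == j) : nat])]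
  | PAdd a b => flat a ++ flat b
  | PMul a b => [seq (p.1 * q.1, [ffun i => (p.2 i + q.2 i)%N]) |
      p : R * mi <- flat a, q : R * mi <- flat b]
  end.

Lemma ev_flat e x : ev e x = \sum_(p <- flat e) p.1 * \prod_i x i ^+ p.2 i.
Proof.
elim: e => [c|i|a Ha b Hb|a Ha b Hb] /=.
- by rewrite big_seq1 big1 ?mulr1 // => i _; rewrite ffunE expr0.
- rewrite big_seq1 mul1r (bigD1 i) //= ffunE eqxx expr1 big1 ?mulr1 // => j ji.
  by rewrite ffunE eq_sym (negbTE ji) expr0.
- by rewrite big_cat -Ha -Hb.
- rewrite big_allpairs_dep Ha Hb mulr_suml; apply: eq_bigr => p _.
  rewrite mulr_sumr; apply: eq_bigr => q _ /=.
  rewrite mulrACA -big_split; congr (_ * _); apply: eq_bigr => i _.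
  by rewrite ffunE exprD.
Qed.

Lemma mj_flat e x : mj e x = \sum_(p <- flat e) `|p.1| * \prod_i x i ^+ p.2 i.
Proof.
elim: e => [c|i|a Ha b Hb|a Ha b Hb] /=.
- by rewrite big_seq1 big1 ?mulr1 // => i _; rewrite ffunE expr0.
- rewrite big_seq1 normr1 mul1r (bigD1 i) //= ffunE eqxx expr1 big1 ?mulr1 // => j ji.
  by rewrite ffunE eq_sym (negbTE ji) expr0.
- by rewrite big_cat -Ha -Hb.
- rewrite big_allpairs_dep Ha Hb mulr_suml; apply: eq_bigr => p _.
  rewrite mulr_sumr; apply: eq_bigr => q _ /=.
  rewrite normrM mulrACA -big_split; congr (_ * _); apply: eq_bigr => i _.
  by rewrite ffunE exprD.
Qed.

Definition coef e b : R := \sum_(p <- flat e | p.2 == b) p.1.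

(** Stated for any F in order to serve both the coefficients and their absolute values. *)
Lemma box_flat (s : seq (R * mi)) (F : R -> R) (w : mi -> R) N :
  box_sum (fun b => (\sum_(p <- s | p.2 == b) F p.1) * w b) N =
  \sum_(p <- s | [forall i, (p.2 i < N)%N]) F p.1 * w p.2.
Proof.
rewrite box_sumE.
under eq_bigr => b _ do rewrite mulr_suml big_mkcond.
rewrite exchange_big [RHS]big_mkcond /=; apply: eq_bigr => p _.
case: ifPn => [/forallP pN|pN].
  pose b0 : {ffun 'I_m -> 'I_N} := [ffun i => Ordinal (pN i)].
  have E : natf b0 = p.2 by apply/ffunP => i; rewrite !ffunE.
  rewrite (bigD1 b0) //= E eqxx big1 ?addr0 // => b bb0; case: eqP => // pb.
  by case/eqP: bb0; apply/ffunP => i; apply: val_inj; rewrite ffunE /= pb ffunE.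
apply: big1 => b _; case: eqP => // pb.
by case/negP: pN; apply/forallP => i; rewrite pb ffunE.
Qed.

Lemma box_coef e v N : box_sum (power_term (coef e) v) N =
  \sum_(p <- flat e | [forall i, (p.2 i < N)%N]) p.1 * \prod_i v i 0 ^+ p.2 i.
Proof. exact: (box_flat (flat e) id). Qed.

Lemma box_abs_coef e v r N : (forall i, `|v i 0| <= r) ->
  box_sum (fun b => `|power_term (coef e) v b|) N <= mj e (fun=> r).
Proof.
move=> vr; have r0 : forall i : 'I_m, 0 <= r by move=> i; exact: le_trans (normr_ge0 _) (vr i).
pose w b := \prod_i `|v i 0| ^+ b i.
apply: (@le_trans _ _ (box_sum (fun b => (\sum_(p <- flat e | p.2 == b) `|p.1|) * w b) N)).
  apply: ler_sum => b _; rewrite normrM normr_prod.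
  under [X in _ * X <= _]eq_bigr do rewrite normrX.
  by rewrite ler_wpM2r ?ler_norm_sum // prodr_ge0 // => i _; exact: exprn_ge0.
rewrite (box_flat _ (fun x => `|x|)) mj_flat big_mkcond /=; apply: ler_sum => p _.
case: ifP => _; last by rewrite mulr_ge0 // prodr_ge0 // => i _; rewrite exprn_ge0 // r0.
rewrite ler_wpM2l //; apply: ler_prod => i _; rewrite exprn_ge0 //=.
by apply: lerXn2r; rewrite ?nnegrE // r0.
Qed.

Lemma box_coef_le e v r N : (forall i, `|v i 0| <= r) ->
  `|box_sum (power_term (coef e) v) N| <= mj e (fun=> r).
Proof. by move=> vr; apply: le_trans (box_abs_coef e N vr); exact: ler_norm_sum. Qed.

Lemma box_coef_ev e v :
  \forall N \near \oo, box_sum (power_term (coef e) v) N = ev e (fun i => v i 0).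
Proof.
exists (\sum_(p <- flat e) \sum_i p.2 i).+1 => // N /= HN.
rewrite box_coef ev_flat big_mkcond /= big_seq [RHS]big_seq; apply: eq_bigr => p pe.
case: ifPn => // /negP[]; apply/forallP => i; apply: leq_trans HN; rewrite ltnS.
apply: (@leq_trans (\sum_i p.2 i)); first by rewrite (bigD1 i) //= leq_addr.
by rewrite (big_rem p pe) /= leq_addr.
Qed.

(** Cauchy's estimate for coefficients; it makes the coefficients of a majorized series summable one
    multi-index at a time. *)
Lemma coef_le e b r : 0 < r -> `|coef e b| <= mj e (fun=> r) / \prod_i r ^+ b i.
Proof.
move=> r0; have P0 (d : mi) : 0 < \prod_(i < m) r ^+ d i by rewrite prodr_gt0 // => i _; exact: exprn_gt0.
rewrite ler_pdivlMr //; apply: le_trans (ler_wpM2r (ltW (P0 b)) (ler_norm_sum _ _ _)) _.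
rewrite mulr_suml big_mkcond mj_flat /=; apply: ler_sum => p _.
by case: eqP => [->//|_]; rewrite mulr_ge0 // ltW.
Qed.

End box_sums.

Section analytic_at.
Variable R : realType.

Lemma analytic_an_at m (E : set 'cV[R]_m) g a : analytic_on E g -> E a -> an_at a g.
Proof.
move=> H /H[r [c [r0 Hc]]]; pose q := r / 2.
have q0 : 0 < q by rewrite divr_gt0.
have qr : q < r by rewrite /q; lra.
exists q, (block c); split=> //; split.
  (* At the corner of the polydisc of radius q, the box sums of absolute values are exactly the
     majorants of the blocks, so absolute convergence at this single point bounds them all. *)
  have /Hc[+ _] : ball a r (a + \col_i q).
    by apply/ball_colP; split=> // i; rewrite !mxE addrAC subrr add0r gtr0_norm.
  rewrite addrAC subrr add0r => C; set s := box_sum _ in C.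
  have B N : s N.+1 = \sum_(0 <= k < N.+1) mj (block c k) (fun=> q).
    rewrite /s -mj_block => [|i]; last by rewrite mxE ltW.
    by apply: eq_bigr => k _; congr mj; apply/funext => i; rewrite mxE.
  exists (Num.max 0 (limn (fun N => s N.+1))) => -[|K].
    by rewrite big_geq // le_max lexx.
  rewrite -B le_max; apply/orP; right.
  apply: (@nondecreasing_cvgn_le _ (fun N => s N.+1)); last first.
    by apply/cvg_ex; exists (limn s); rewrite cvg_shiftS.
  apply/nondecreasing_seqP => n; rewrite !B [leRHS]big_nat_recr //= lerDl.
  by apply: mj_ge0 => _; exact: ltW.
move=> x xq.
have /Hc[_] : ball a r x.
  by apply/ball_colP; split=> // i; exact: le_lt_trans (xq i) qr.
rewrite -cvg_shiftS => L; rewrite -cvg_shiftS.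
rewrite (_ : (fun n => _) = fun n => box_sum (power_term c (x - a)) n.+1) //.
apply/funext => N /=; rewrite -ev_block; apply: eq_bigr => k _; congr ev.
by apply/funext => i; rewrite !mxE.
Qed.

(** The coefficient of index b is the sum over k of those of the [e k]. In a fixed box, the limit in
    k is a finite sum of limits, and the tails in k are small uniformly in the box, which allows the
    two limits to be exchanged. *)
Lemma an_at_analytic m (E : set 'cV[R]_m) g :
  (forall a, E a -> an_at a g) -> analytic_on E g.
Proof.
move=> H a /H[r [e [r0 [[M HM] L]]]].
pose s b K : R := \sum_(0 <= k < K) coef (e k) b.
have C b : cvgn (s b).
  apply: (dominated_cvg (fun k => coef_le (e k) b r0) (M := M / \prod_i r ^+ b i)) => K.
  rewrite -mulr_suml ler_wpM2r // invr_ge0 prodr_ge0 // => i _.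
  by rewrite exprn_ge0 // ltW.
pose c b := limn (s b); exists r, c; split=> // x xr.
have vr i : `|(x - a) i 0| <= r.
  by have /ball_colP[_ /(_ i)/ltW] := xr; rewrite !mxE.
set v := x - a in vr *.
have LB N : (fun K => \sum_(0 <= k < K) box_sum (power_term (coef (e k)) v) N) @ \oo -->
    box_sum (power_term c v) N.
  rewrite (_ : (fun K => _) = fun K => box_sum (power_term (s^~ K) v) N); last first.
    apply/funext => K; rewrite exchange_big; apply: eq_bigr => b _ /=.
    by rewrite /power_term /s mulr_suml.
  by apply: cvg_finsum => b; apply: cvgMr_tmp; exact: C.
have LA N : (fun K => box_sum (fun b => `|power_term (s^~ K) v b|) N) @ \oo -->
    box_sum (fun b => `|power_term c v b|) N.
  by apply: cvg_finsum => b; apply: cvg_norm; apply: cvgMr_tmp; exact: C.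
have AM N : box_sum (fun b => `|power_term c v b|) N <= M.
  apply: le_trans (ler_norm _) _; rewrite -[X in `|X|]subr0.
  apply: (lim_dist_le (J := 0%N) _ (LA N)) => K _; rewrite subr0 ger0_norm; last first.
    by apply: sumr_ge0.
  apply: le_trans (HM K).
  apply: (@le_trans _ _ (\sum_(0 <= k < K) box_sum (fun b => `|power_term (coef (e k)) v b|) N)).
    rewrite exchange_big /=; apply: ler_sum => b _.
    rewrite /power_term /s mulr_suml; exact: ler_norm_sum.
  by apply: ler_sum => k _; exact: box_abs_coef.
split.
  have CN : cvgn (fun N => box_sum (fun b => `|power_term c v b|) N.+1).
    apply: nondecreasing_is_cvgn; last by exists M => _ [N _ <-].
    by apply/nondecreasing_seqP => n; rewrite box_sum_recr lerDl; exact: sumr_ge0.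
  apply/cvg_ex; exists (limn (fun N => box_sum (fun b => `|power_term c v b|) N.+1)).
  by rewrite -cvg_shiftS.
have Lx : (fun K => \sum_(0 <= k < K) ev (e k) (fun i => v i 0)) @ \oo --> g x.
  rewrite (_ : (fun i => v i 0) = fun i => x i 0 - a i 0); last by apply/funext => i; rewrite !mxE.
  by apply: L => i; have := vr i; rewrite !mxE.
apply/cvgrPdist_le => eps eps0.
have e2 : 0 < eps / 2 by rewrite divr_gt0.
have ej0 k : 0 <= mj (e k) (fun=> r) by apply: mj_ge0 => _; exact: ltW.
have [J HJ] := bounded_tail ej0 HM e2.
(* A box containing all exponents of finitely many polynomials evaluates them exactly. *)
have near_ev : \forall N \near \oo, \sum_(0 <= k < J) box_sum (power_term (coef (e k)) v) N =
    \sum_(0 <= k < J) ev (e k) (fun i => v i 0).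
  elim: (J) => [|J' IH]; first by apply: nearW => N; rewrite !big_geq.
  by apply: filterS2 IH (box_coef_ev (e J') v) => N h1 h2; rewrite !big_nat_recr //= h1 h2.
apply: filterS near_ev => N EN.
have h1 : `|g x - \sum_(0 <= k < J) ev (e k) (fun i => v i 0)| <= eps / 2.
  by apply: (tail_dist_le _ HJ Lx) => k; exact: ev_le_mj.
have h2 : `|box_sum (power_term c v) N - \sum_(0 <= k < J) ev (e k) (fun i => v i 0)| <= eps / 2.
  rewrite -EN; apply: (tail_dist_le _ HJ (LB N)) => k; exact: box_coef_le.
rewrite (_ : g x - _ = (g x - \sum_(0 <= k < J) ev (e k) (fun i => v i 0)) -
  (box_sum (power_term c v) N - \sum_(0 <= k < J) ev (e k) (fun i => v i 0))); last by ring.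
by apply: le_trans (ler_normB _ _) _; lra.
Qed.

End analytic_at.

(** * Operations on analytic germs, and their primitives *)

Section an_at_closure.
Variable R : realType.

Lemma an_at_near m (a : 'cV[R]_m) (g h : 'cV[R]_m -> R) r : 0 < r ->
  (forall x : 'cV[R]_m, (forall i, `|x i 0 - a i 0| <= r) -> g x = h x) -> an_at a g -> an_at a h.
Proof.
move=> r0 E [s [e [s0 H]]].
have m0 : 0 < Num.min r s by rewrite lt_min r0.
exists (Num.min r s), e; split => //.
apply: mseries_ext (mseriesW _ H); last by rewrite ge_min lexx orbT ltW.
by move=> x xr; apply: E => i; apply: le_trans (xr i) _; rewrite ge_min lexx.
Qed.

Lemma an_at_cst m (a : 'cV[R]_m) (c : R) : an_at a (fun=> c).
Proof. exact: (an_at_pexp a (PCst c)). Qed.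

Lemma an_at_coord m (a : 'cV[R]_m) i : an_at a (fun x => x i 0).
Proof. exact: (an_at_pexp a (PVar i)). Qed.

(** Sums and products are a polynomial in two variables composed with this map, so [an_at_comp]
    covers both. *)
Definition pair_col m (g h : 'cV[R]_m -> R) (x : 'cV[R]_m) : 'cV[R]_2 :=
  \col_i (if i == 0 then g x else h x).

Lemma an_at_pair m (a : 'cV[R]_m) g h i :
  an_at a g -> an_at a h -> an_at a (fun x => pair_col g h x i 0).
Proof.
move=> ag ah; rewrite (_ : (fun x => _) = if i == 0 then g else h); first by case: ifP.
by apply/funext => x; rewrite mxE; case: ifP.
Qed.

Lemma an_atD m (a : 'cV[R]_m) g h : an_at a g -> an_at a h -> an_at a (fun x => g x + h x).
Proof.
move=> ag ah.
have := an_at_comp (an_at_pexp (pair_col g h a) (PAdd (PVar 0) (PVar 1)))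
  (fun i => an_at_pair i ag ah).
by rewrite (_ : _ \o _ = fun x => g x + h x) //; apply/funext => x; rewrite /= !mxE.
Qed.

Lemma an_atM m (a : 'cV[R]_m) g h : an_at a g -> an_at a h -> an_at a (fun x => g x * h x).
Proof.
move=> ag ah.
have := an_at_comp (an_at_pexp (pair_col g h a) (PMul (PVar 0) (PVar 1)))
  (fun i => an_at_pair i ag ah).
by rewrite (_ : _ \o _ = fun x => g x * h x) //; apply/funext => x; rewrite /= !mxE.
Qed.

Lemma an_at_sum m (a : 'cV[R]_m) (I : Type) (s : seq I) (g : I -> 'cV[R]_m -> R) :
  (forall i, an_at a (g i)) -> an_at a (fun x => \sum_(i <- s) g i x).
Proof.
move=> H; elim: s => [|i s IH].
  rewrite (_ : (fun x => _) = fun=> 0); first exact: an_at_cst.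
  by apply/funext => x; rewrite big_nil.
rewrite (_ : (fun x => _) = fun x => g i x + \sum_(j <- s) g j x); first exact: an_atD.
by apply/funext => x; rewrite big_cons.
Qed.

(** The geometric series of 1 / (c + v) in powers of - v / c; at |v| <= |c| / 2 the majorants sum to
    at most 2 / |c|. *)
Lemma an_at_inv (b : 'cV[R]_1) : b 0 0 != 0 -> an_at b (fun y => (y 0 0)^-1).
Proof.
move=> b0; pose c := b 0 0; pose r := `|c| / 2.
have c0 : 0 < `|c| by rewrite normr_gt0.
have r0 : 0 < r by rewrite divr_gt0.
exists r, (fun k => PMul (PCst (c^-1 * (- c^-1) ^+ k)) (ppow R (0 : 'I_1) k)); split=> //; split.
  exists (`|c|^-1 * 2) => K.
  have -> : \sum_(0 <= k < K) mj (PMul (PCst (c^-1 * (- c^-1) ^+ k)) (ppow R (0 : 'I_1) k)) (fun=> r) =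
     `|c|^-1 * \sum_(0 <= k < K) (2^-1) ^+ k.
    rewrite mulr_sumr; apply: eq_bigr => k _ /=.
    rewrite mj_ppow normrM normrX normrN normfV -mulrA -exprMn; congr (_ * _ ^+ _).
    by rewrite /r mulrA mulVf ?mul1r // gt_eqF.
  rewrite ler_wpM2l ?invr_ge0 //.
  have -> : \sum_(0 <= k < K) (2^-1 : R) ^+ k = 2 - 2 * 2^-1 ^+ K.
    elim: K => [|K IH]; first by rewrite big_geq // expr0; lra.
    by rewrite big_nat_recr //= IH exprS; lra.
  by rewrite gerBl mulr_ge0 // exprn_ge0 // invr_ge0.
move=> x xr; pose v := x 0 0 - c.
have vr : `|v| <= r by exact: xr.
have z1 : `|- c^-1 * v| < 1.
  rewrite normrM normrN normfV mulrC ltr_pdivrMr // mul1r.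
  by apply: le_lt_trans vr _; rewrite /r; lra.
have := @cvg_geometric_series R c^-1 _ z1.
have -> : c^-1 * (1 - - c^-1 * v)^-1 = (x 0 0)^-1.
  rewrite -invfM; congr (_^-1).
  by rewrite mulNr opprK mulrDr mulr1 mulrA mulfV // mul1r /v addrC subrK.
rewrite /series /=.
rewrite (_ : (fun n => _) = (fun K => \sum_(0 <= k < K)
   ev (PMul (PCst (c^-1 * (- c^-1) ^+ k)) (ppow R (0 : 'I_1) k)) (fun i => x i 0 - b i 0))) //.
apply/funext => K; apply: eq_bigr => k _ /=.
by rewrite ev_ppow -mulrA -exprMn.
Qed.

Lemma an_atV m (a : 'cV[R]_m) g : g a != 0 -> an_at a g -> an_at a (fun x => (g x)^-1).
Proof.
move=> ga0 ag.
have := @an_at_comp R m 1 a (fun y => (y 0 0)^-1) (fun x => \col_i g x).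
rewrite (_ : _ \o _ = fun x => (g x)^-1); last by apply/funext => x; rewrite /= mxE.
apply=> [|i]; first by apply: an_at_inv; rewrite mxE.
by rewrite (_ : (fun x => _) = g) //; apply/funext => x; rewrite mxE.
Qed.

Lemma continuous_eps (T : topologicalType) (g : T -> R) (x : T) :
  (forall e : R, 0 < e -> \forall y \near x, `|g x - g y| <= e) ->
  {for x, continuous g}.
Proof. by move=> H; apply/cvgrPdist_le. Qed.

Lemma an_at_continuous m (a : 'cV[R]_m) g : an_at a g -> {for a, continuous g}.
Proof.
move=> [r [e [r0 H]]]; have [[M HM] _] := H.
have M0 : 0 <= M by have := HM 0%N; rewrite big_geq.
apply: continuous_eps => eps eps0.
pose t := Num.min 1 (eps / (M + 1)).
have M1 : 0 < M + 1 by rewrite ltr_wpDl.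
have t0 : 0 < t by rewrite lt_min ltr01 divr_gt0.
have t01 : 0 <= t <= 1 by rewrite ltW //= ge_min lexx.
have tM : t * M <= eps.
  apply: (@le_trans _ _ (eps / (M + 1) * M)).
    by rewrite ler_wpM2r // ge_min lexx orbT.
  by rewrite mulrAC ler_pdivrMr // ler_wpM2l ?lerDl // ltW.
apply/nbhs_ballP; exists (t * r) => /=; first exact: mulr_gt0.
move=> x /ball_colP[_ xa]; rewrite distrC.
have xtr i : `|x i 0 - a i 0| <= t * r := ltW (xa i).
have xr i : `|x i 0 - a i 0| <= r.
  by apply: le_trans (xtr i) _; rewrite ler_piMl ?(ltW r0) // ge_min lexx.
apply: le_trans tM; rewrite -[X in `|X|]subr0.
apply: (lim_dist_le (J := 0%N) _ (centre_cvg (ltW r0) H xr)) => K _.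
rewrite subr0; apply: le_trans (centre_bound (ltW r0) t01 HM K).
apply: le_trans (ler_norm_sum _ _ _) _; apply: ler_sum => k _; exact: ev_le_mj.
Qed.

(** The factor x_j turns n x^(n-1) into n x^n and avoids a truncated exponent at n = 0. *)
Lemma ev_pd_ppow m (i j : 'I_m) n (x : 'I_m -> R) :
  x j * ev (pd j (ppow R i n)) x = ((i == j) * n)%:R * x i ^+ n.
Proof.
elim: n => [|n IH] /=; first by rewrite muln0 mul0r mulr0.
rewrite ev_ppow (_ : x j * _ = (i == j)%:R * x j * x i ^+ n +
  x i * (x j * ev (pd j (ppow R i n)) x)); last by ring.
rewrite IH; have [->|ij] /= := eqVneq i j; last by rewrite !mul0n !mul0r mulr0 addr0.
by rewrite !mul1n mul1r -natr1 exprS; ring.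
Qed.

Lemma ev_pmono_seq m (b : {ffun 'I_m -> nat}) s (x : 'I_m -> R) :
  ev (pmono_seq R b s) x = \prod_(i <- s) x i ^+ b i.
Proof. by elim: s => [|i s /= ->]; rewrite ?big_nil // big_cons ev_ppow. Qed.

Lemma ev_pd_pmono m (b : {ffun 'I_m -> nat}) s j (x : 'I_m -> R) :
  x j * ev (pd j (pmono_seq R b s)) x =
  (\sum_(i <- s) (i == j) * b i)%N%:R * \prod_(i <- s) x i ^+ b i.
Proof.
elim: s => [|i s IH] /=; first by rewrite !big_nil mul0r mulr0.
rewrite (_ : x j * _ = x j * ev (pd j (ppow R i (b i))) x * ev (pmono_seq R b s) x +
  ev (ppow R i (b i)) x * (x j * ev (pd j (pmono_seq R b s)) x)); last by ring.
by rewrite ev_pd_ppow IH ev_ppow ev_pmono_seq !big_cons natrD; ring.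
Qed.

(** Antiderivation does not respect products, hence the flattened form: c x^b becomes c x_j x^b /
    (b_j + 1). *)
Definition anti m (j : 'I_m) (e : pexp R m) : pexp R m :=
  plist [seq PMul (PCst (p.1 / (p.2 j).+1%:R)) (PMul (PVar j) (pmono_seq R p.2 (enum 'I_m))) |
    p : R * {ffun 'I_m -> nat} <- flat e].

Lemma ev_pd_anti m (j : 'I_m) e (x : 'I_m -> R) : ev (pd j (anti j e)) x = ev e x.
Proof.
rewrite [RHS]ev_flat /anti; elim: (flat e) => [|p s IH] /=; first by rewrite big_nil.
rewrite big_cons -IH mul0r add0r eqxx mul1r; congr (_ + _).
rewrite ev_pd_pmono ev_pmono_seq !big_enum /=.
have -> : (\sum_(i < m) (i == j) * p.2 i)%N = p.2 j.
  by rewrite (bigD1 j) //= eqxx mul1n big1 ?addn0 // => i /negbTE ->.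
have n0 : (p.2 j).+1%:R != 0 :> R by rewrite pnatr_eq0.
set P := \prod_(i in _) _; rewrite -[P in P + _]mul1r -mulrDl nat1r.
by rewrite mulrA divfK.
Qed.

Lemma mj_anti m (j : 'I_m) e r : 0 <= r -> mj (anti j e) (fun=> r) <= r * mj e (fun=> r).
Proof.
move=> r0; rewrite [mj e _]mj_flat /anti mj_plist big_map mulr_sumr; apply: ler_sum => p _ /=.
have -> : mj (pmono_seq R p.2 (enum 'I_m)) (fun=> r) = \prod_(i < m) r ^+ p.2 i.
  rewrite -[RHS]big_enum /=; elim: (enum _) => [|i s /= ->]; first by rewrite big_nil /= normr1.
  by rewrite big_cons mj_ppow.
rewrite mulrCA ler_wpM2l // ler_wpM2r ?prodr_ge0 // => [i _|]; first exact: exprn_ge0.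
rewrite normrM normfV normr_nat ler_pdivrMr ?ltr0n //.
by rewrite ler_peMr // ler1n.
Qed.

(** H is rebuilt from its partial derivatives. Along the staircase from a to x, the k-th increment
    of H is that of the termwise antiderivative [G k] of its k-th partial derivative, since the
    difference has zero derivative in that direction. *)
Lemma an_at_primitive m (a : 'cV[R]_m) H r0 : 0 < r0 ->
  (forall (x : 'cV[R]_m) j, (forall i, `|x i 0 - a i 0| <= r0) -> derivable H x (basis_vec R j)) ->
  (forall j, an_at a (partial j H)) -> an_at a H.
Proof.
move=> r00 dH /choice[rj /choice[w Hw]].
have [r1 r10 r1r] := common_radius (fun j => (Hw j).1).
pose r := Num.min r0 r1.
have r_gt0 : 0 < r by rewrite lt_min r00.
have Sw j : mseries a r (w j) (partial j H).
  by apply: mseriesW (Hw j).2; rewrite ltW //= ge_min r1r orbT.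
pose G j (x : 'cV[R]_m) :=
  limn (fun K => \sum_(0 <= k < K) ev (anti j (w j k)) (fun i => x i 0 - a i 0)).
have SG j : mseries a r (fun k => anti j (w j k)) (G j).
  have [[M HM] _] := Sw j.
  have B K : \sum_(0 <= k < K) mj (anti j (w j k)) (fun=> r) <= r * M.
    apply: (@le_trans _ _ (\sum_(0 <= k < K) r * mj (w j k) (fun=> r))).
      by apply: ler_sum => k _; apply: mj_anti; exact: ltW.
    by rewrite -mulr_sumr ler_wpM2l // ltW.
  split; first by exists (r * M).
  by move=> x xr; apply: (dominated_cvg _ B) => k; exact: ev_le_mj.
pose q := r / 2.
have q0 : 0 < q by rewrite divr_gt0.
have qr : q <= r by rewrite /q; lra.
have qr0 : q <= r0 by apply: le_trans qr _; rewrite ge_min lexx.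
have GH j (x : 'cV[R]_m) : (forall i, `|x i 0 - a i 0| <= q) ->
    derivable (G j) x (basis_vec R j) /\ partial j (G j) x = partial j H x.
  move=> xq; have [d [_ L]] := mseries_derive j r_gt0 (SG j); split; first exact: d.
  have [_ L'] := Sw j.
  have xr i : `|x i 0 - a i 0| <= r := le_trans (xq i) qr.
  have := L x xq.
  under eq_fun do under eq_bigr do rewrite ev_pd_anti.
  move=> L1; exact: (cvg_unique _ L1 (L' x xr)).
have step (x : 'cV[R]_m) (k : 'I_m) : (forall i, `|x i 0 - a i 0| <= q) ->
    H (a + stair (x - a) k.+1) - H (a + stair (x - a) k) =
    G k (a + stair (x - a) k.+1) - G k (a + stair (x - a) k).
  move=> xq; set y := a + stair (x - a) k; set t := (x - a) k 0.
  have -> : a + stair (x - a) k.+1 = y + t *: basis_vec R k by rewrite stairS addrA.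
  have inb s : `|s| <= `|t| -> forall i, `|(y + s *: basis_vec R k) i 0 - a i 0| <= q.
    move=> st i; rewrite !mxE !eqxx andbT -[a i 0 + _ + _]addrA addrAC subrr add0r.
    have [->|ne] /= := eqVneq i k.
      by rewrite ltnn add0r mulr1 (le_trans st) // /t !mxE xq.
    by rewrite mulr0 addr0; case: ifP; rewrite ?normr0 ?(ltW q0) // xq.
  pose P (z : 'cV[R]_m) : R := H z - G k z.
  have dP s : `|s| <= `|t| -> is_derive (y + s *: basis_vec R k) (basis_vec R k) P 0.
    move=> st; have [dG pG] := GH k _ (inb s st).
    have dHs : derivable H (y + s *: basis_vec R k) (basis_vec R k).
      by apply: dH => i; exact: le_trans (inb s st i) qr0.
    apply: DeriveDef; first exact: (@derivableB _ _ _ H (G k)).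
    rewrite (@deriveB _ _ _ H (G k)) //.
    by move: pG; rewrite /partial => ->; rewrite subrr.
  have [s|s st E] := @partial_MVT R m P y k t; first by move=> st; have [] := dP s st.
  move: E; have [_] := dP s st; rewrite -/(partial k P _) => ->; rewrite mulr0 /P => E.
  lra.
have HE (x : 'cV[R]_m) : (forall i, `|x i 0 - a i 0| <= q) ->
    H a + \sum_(k < m) (G k (a + stair (x - a) k.+1) + -1 * G k (a + stair (x - a) k)) = H x.
  move=> xq; have := stair_telescope H a (x - a).
  rewrite (eq_bigr _ (fun k _ => step x k xq)) [a + (x - a)]addrC subrK => E.
  under eq_bigr do rewrite mulN1r.
  by rewrite -E addrC subrK.
apply: (an_at_near q0 HE); apply: an_atD; first exact: an_at_cst.
(* Every coordinate of a staircase point is a coordinate of x or of a, so these points depend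
   analytically on x. *)
have Gs (k : 'I_m) l : an_at a (fun x => G k (a + stair (x - a) l)).
  apply: (@an_at_comp R m m a (G k) (fun x => a + stair (x - a) l)).
    rewrite subrr [stair 0 l](_ : _ = 0) ?addr0; last by apply/matrixP => i j; rewrite !mxE if_same.
    by exists r, (fun n => anti k (w k n)).
  move=> i; case: (ltnP i l) => il.
    rewrite (_ : (fun x => _) = fun x : 'cV[R]_m => x i 0); first exact: an_at_coord.
    by apply/funext => x; rewrite !mxE il addrC subrK.
  rewrite (_ : (fun x => _) = fun=> a i 0); first exact: an_at_cst.
  by apply/funext => x; rewrite !mxE ltnNge il addr0.
by apply: an_at_sum => k; apply: an_atD => //; apply: an_atM => //; exact: an_at_cst.
Qed.

Lemma analytic_Cfin m (E : set 'cV[R]_m) g r : open E -> analytic_on E g -> Cfin E r g.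
Proof.
move=> oE; elim: r g => [|r IH] g ag.
  by split=> // x Ex; apply: an_at_continuous; exact: analytic_an_at ag Ex.
split=> [x Ex|j]; first by apply: an_at_continuous; exact: analytic_an_at ag Ex.
split=> [x Ex|]; first by apply: an_at_derivable; exact: analytic_an_at ag Ex.
apply: IH; apply: an_at_analytic => a Ea; apply: an_at_partial.
exact: analytic_an_at ag Ea.
Qed.

End an_at_closure.

(** * The smoothness classes treated uniformly *)

Definition prev (k : smoothness) : smoothness :=
  if k is SmoothFin r then SmoothFin r.-1 else k.

Definition at_least_C1 (k : smoothness) : bool :=
  if k is SmoothFin r then (0 < r)%N else true.

Lemma at_least_C2W k : at_least_C2 k -> at_least_C1 k.
Proof. by case: k => //= r; exact: ltnW. Qed.

Lemma at_least_C1_prev k : at_least_C2 k -> at_least_C1 (prev k).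
Proof. by case: k => //= -[|[]]. Qed.

Section C_on_closure.
Variables (R : realType) (m : nat) (E : set 'cV[R]_m).
Hypothesis oE : open E.
Implicit Types (k : smoothness) (g h : 'cV[R]_m -> R).

Lemma C_on_Cfin k r g : C_on k E g ->
  (if k is SmoothFin s then (r <= s)%N else true) -> Cfin E r g.
Proof.
by case: k => [s|_|] //= H rs; [exact: CfinW H|exact: analytic_Cfin].
Qed.

Lemma C_on_C1 k g : at_least_C1 k -> C_on k E g -> Cfin E 1 g.
Proof. by move=> k1 H; apply: C_on_Cfin H _; case: k k1. Qed.

Lemma C_on_C2 k g : at_least_C2 k -> C_on k E g -> Cfin E 2 g.
Proof. by move=> k1 H; apply: C_on_Cfin H _; case: k k1. Qed.

Lemma C_on_ext k g h : (forall x, E x -> g x = h x) -> C_on k E g -> C_on k E h.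
Proof.
move=> gh; case: k => [r|H r|H]; try exact: Cfin_ext.
  by apply: Cfin_ext (H r).
apply: an_at_analytic => a Ea.
have /nbhs_ballP[e /= e0 He] := open_near oE Ea.
apply: (@an_at_near _ _ _ g _ (e / 2)); first by rewrite divr_gt0.
  move=> x xe; apply: gh; apply: He; apply/ball_colP; split=> // i.
  by apply: le_lt_trans (xe i) _; lra.
exact: analytic_an_at H Ea.
Qed.

Lemma C_on_cst k c : C_on k E (fun=> c).
Proof.
case: k => [r|r|]; try exact: Cfin_cst.
by apply: an_at_analytic => a _; exact: an_at_cst.
Qed.

Lemma C_on_coord k i : C_on k E (fun x => x i 0).
Proof.
case: k => [r|r|]; try exact: Cfin_coord.
by apply: an_at_analytic => a _; exact: an_at_coord.
Qed.

Lemma C_onD k g h : C_on k E g -> C_on k E h -> C_on k E (fun x => g x + h x).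
Proof.
case: k => [r|G H r|G H]; [exact: CfinD|by apply: CfinD|].
by apply: an_at_analytic => a Ea; apply: an_atD; [exact: analytic_an_at G Ea|exact: analytic_an_at H Ea].
Qed.

Lemma C_onM k g h : C_on k E g -> C_on k E h -> C_on k E (fun x => g x * h x).
Proof.
case: k => [r|G H r|G H]; [exact: CfinM|by apply: CfinM|].
by apply: an_at_analytic => a Ea; apply: an_atM; [exact: analytic_an_at G Ea|exact: analytic_an_at H Ea].
Qed.

Lemma C_on_sum k (I : Type) (s : seq I) (g : I -> 'cV[R]_m -> R) :
  (forall i, C_on k E (g i)) -> C_on k E (fun x => \sum_(i <- s) g i x).
Proof.
move=> H; elim: s => [|i s IH].
  by apply: C_on_ext (C_on_cst k 0) => x _; rewrite big_nil.
by apply: C_on_ext (C_onD (H i) IH) => x _; rewrite big_cons.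
Qed.

Lemma C_onV k g : (forall x, E x -> g x != 0) -> C_on k E g -> C_on k E (fun x => (g x)^-1).
Proof.
move=> g0; case: k => [r|G r|G]; [exact: CfinV|by apply: CfinV|].
by apply: an_at_analytic => a Ea; apply: an_atV; [exact: g0|exact: analytic_an_at G Ea].
Qed.

Lemma C_on_partial k g j : at_least_C1 k -> C_on k E g -> C_on (prev k) E (partial j g).
Proof.
case: k => [[|r]|_ G r|_ G] //=; [by move=> _; exact: Cfin_partial|exact: Cfin_partial (G r.+1)|].
by apply: an_at_analytic => a Ea; apply: an_at_partial; exact: analytic_an_at G Ea.
Qed.

Lemma C_on_prevW k g : C_on k E g -> C_on (prev k) E g.
Proof. by case: k => [r||] //=; apply: CfinW; exact: leq_pred. Qed.

Lemma C_on_primitive k g : at_least_C1 k ->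
  (forall j x, E x -> derivable g x (basis_vec R j)) ->
  (forall j, C_on (prev k) E (partial j g)) -> C_on k E g.
Proof.
move=> k1 d H.
case: k k1 H => [[|r]|_|_] //=; first by move=> _ H; exact: Cfin_primitive.
  by move=> H r; apply: (@CfinW _ _ _ r r.+1); rewrite ?leqnSn //; apply: Cfin_primitive.
move=> H; apply: an_at_analytic => a Ea.
have /nbhs_ballP[e /= e0 He] := open_near oE Ea.
apply: (@an_at_primitive R m a g (e / 2)); first by rewrite divr_gt0.
  move=> x j xe; apply: d; apply: He; apply/ball_colP; split=> // i.
  by apply: le_lt_trans (xe i) _; lra.
by move=> j; exact: analytic_an_at (H j) Ea.
Qed.

End C_on_closure.

Lemma C_on_comp (R : realType) m p (E : set 'cV[R]_m) (E' : set 'cV[R]_p) k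
    (g : 'cV[R]_p -> R) (s : 'cV[R]_m -> 'cV[R]_p) : open E -> open E' ->
  (forall x, E x -> E' (s x)) -> C_map k E s -> C_on k E' g -> C_on k E (g \o s).
Proof.
move=> oE oE' ss; case: k => [r|S G r|S G]; first exact: Cfin_comp.
  by apply: (Cfin_comp oE oE' ss) => // i; exact: S.
apply: an_at_analytic => a Ea; apply: an_at_comp.
  exact: analytic_an_at G (ss a Ea).
by move=> i; exact: analytic_an_at (S i) Ea.
Qed.

(** * The Jacobian of F and the induced metric *)

Lemma cvg_mx (R : realType) (T : Type) (F : set_system T) {FF : Filter F} m n
    (u : T -> 'M[R]_(m, n)) (L : 'M[R]_(m, n)) :
  (forall i j, u t i j @[t --> F] --> L i j) -> u t @[t --> F] --> L.
Proof.
move=> H; apply/cvgrPdist_lt => e e0.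
have : \forall t \near F, forall ij : 'I_m * 'I_n, `|L ij.1 ij.2 - u t ij.1 ij.2| < e.
  apply: (@filter_forall _ _ (fun (ij : 'I_m * 'I_n) t => `|L ij.1 ij.2 - u t ij.1 ij.2| < e) F) => ij.
  by have /cvgrPdist_lt := H ij.1 ij.2; exact.
apply: filterS => t Ht; rewrite [ltLHS]/Num.Def.normr /= mx_normrE.
by apply/bigmax_ltP; split => //= -[i j] _; rewrite !mxE; exact: (Ht (i, j)).
Qed.

Section derivation_rules.
Variables (R : realType) (V : normedModType R).
Implicit Types (x v : V).

Lemma is_derive_finsum (I : finType) (f : I -> V -> R) (df : I -> R) x v :
  (forall i, is_derive x v (f i) (df i)) ->
  is_derive x v (fun y => \sum_i f i y) (\sum_i df i).
Proof.
move=> H; rewrite (_ : (fun y => _) = \sum_i f i); last first.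
  by apply/funext => y; rewrite fct_sumE.
elim/big_ind2 : _ => [|a b c d Hb Hd|i _]; [exact: is_derive_cst|exact: is_deriveD|exact: H].
Qed.

Lemma is_derive_mul (f g : V -> R) (df dg : R) x v :
  is_derive x v f df -> is_derive x v g dg ->
  is_derive x v (fun y => f y * g y) (f x * dg + g x * df).
Proof. by move=> Hf Hg; exact: (is_deriveM Hf Hg). Qed.

Lemma is_derive_add (f g : V -> R) (df dg : R) x v :
  is_derive x v f df -> is_derive x v g dg ->
  is_derive x v (fun y => f y + g y) (df + dg).
Proof. by move=> Hf Hg; exact: (is_deriveD Hf Hg). Qed.

Lemma is_derive_comp1 (p : R -> R) (h : V -> R) (dp dh : R) x v :
  is_derive (h x) 1 p dp -> is_derive x v h dh ->
  is_derive x v (fun y => p (h y)) (dp * dh).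
Proof.
move=> Hp [Hh Eh]; apply: line_derivable.
have H1 : is_derive (0 : R) 1 (fun s : R => h (x + s *: v)) dh.
  have := @derivable_line R _ _ h x v 0; rewrite scale0r addr0 -Eh; exact.
have Hp' : is_derive ((fun s : R => h (x + s *: v)) 0) 1 p dp by rewrite /= scale0r addr0.
exact: (is_derive1_comp Hp' H1).
Qed.

End derivation_rules.

(** * The exponential of t A: derivative and orthogonality *)

Section matrix_exponential.
Variables (R : realType) (N : nat) (A : 'M[R]_N).

Definition exp_entry (j k : 'I_N) (i : nat) : R := i`!%:R^-1 * (A ^+ i) j k.

Let K : R := \sum_j \sum_k `|A j k|.

Let K_ge0 : 0 <= K. Proof. by apply: sumr_ge0 => j _; exact: sumr_ge0. Qed.

Lemma exprmx_bound i j k : `|(A ^+ i) j k| <= K ^+ i.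
Proof.
elim: i j k => [|i IH] j k.
  by rewrite expr0 expr0 mxE normr_nat; case: (j == k).
rewrite exprS mxE; apply: le_trans (ler_norm_sum _ _ _) _.
apply: (@le_trans _ _ (\sum_l `|A j l| * K ^+ i)).
  by apply: ler_sum => l _; rewrite normrM ler_wpM2l.
rewrite -mulr_suml exprS ler_wpM2r ?exprn_ge0 //.
by rewrite /K [leRHS](bigD1 j) //= lerDl sumr_ge0 // => l _; exact: sumr_ge0.
Qed.

(** The free constant C lets one bound serve the entry series and its first two derived series, as
    each derivation only multiplies C by K. *)
Lemma exp_bounded_cvg (c : nat -> R) C x :
  (forall i, `|c i| <= C * (i`!%:R^-1 * K ^+ i)) -> cvgn (pseries c x).
Proof.
move=> H; have C0 : 0 <= C.
  by have := H 0%N; rewrite expr0 invr1 !mulr1; apply: le_trans.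
apply: (@dominated_cvg R _ (fun i => C * exp_coeff (K * `|x|) i)
   (C * limn (series (exp_coeff (K * `|x|))))) => [i|n].
  rewrite normrM normrX /exp_coeff /= exprMn.
  apply: le_trans (ler_wpM2r (exprn_ge0 _ (normr_ge0 _)) (H i)) _.
  by rewrite le_eqVlt; apply/orP; left; apply/eqP; ring.
rewrite -mulr_sumr ler_wpM2l //.
apply: (@nondecreasing_cvgn_le _ (series (exp_coeff (K * `|x|)))); last exact: is_cvg_series_exp_coeff.
apply/nondecreasing_seqP => m; rewrite /series /= big_nat_recr //= lerDl.
by rewrite exp_coeff_ge0 // mulr_ge0.
Qed.

Lemma exp_entry_bound j k i : `|exp_entry j k i| <= 1 * (i`!%:R^-1 * K ^+ i).
Proof.
rewrite mul1r normrM ger0_norm ?invr_ge0 // ler_wpM2l ?invr_ge0 //.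
exact: exprmx_bound.
Qed.

Lemma pseries_diffs_bound (c : nat -> R) C :
  (forall i, `|c i| <= C * (i`!%:R^-1 * K ^+ i)) ->
  forall i, `|pseries_diffs c i| <= (C * K) * (i`!%:R^-1 * K ^+ i).
Proof.
move=> H i; rewrite /pseries_diffs normrM normr_nat.
apply: le_trans (ler_wpM2l (ler0n _ _) (H i.+1)) _.
rewrite factS natrM invfM exprS le_eqVlt; apply/orP; left; apply/eqP.
have i0 : i.+1%:R != 0 :> R by rewrite pnatr_eq0.
rewrite mulrCA [i.+1%:R * (_ * _)]mulrA [i.+1%:R * (_ * _)]mulrA mulfV // mul1r.
by ring.
Qed.

Lemma pseries_diffs_exp_entry j k :
  pseries_diffs (exp_entry j k) = fun i => \sum_l exp_entry j l i * A l k.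
Proof.
apply/funext => i; rewrite /pseries_diffs /exp_entry factS natrM invfM.
have i0 : i.+1%:R != 0 :> R by rewrite pnatr_eq0.
rewrite !mulrA mulfV // mul1r exprSr mxE mulr_sumr.
by apply: eq_bigr => l _; rewrite mulrA.
Qed.

Lemma scale_exprmx t i j k : ((t *: A) ^+ i) j k = t ^+ i * (A ^+ i) j k.
Proof.
elim: i j k => [|i IH] j k; first by rewrite !expr0 mul1r.
rewrite exprS mxE [A ^+ i.+1]exprS mxE mulr_sumr; apply: eq_bigr => l _.
by rewrite IH mxE exprS; ring.
Qed.

Lemma expmxE t j k : expmx (t *: A) j k = limn (pseries (exp_entry j k) t).
Proof.
pose L : 'M[R]_N := \matrix_(j, k) limn (pseries (exp_entry j k) t).
rewrite /expmx (_ : limn _ = L); first by rewrite mxE.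
apply: cvg_lim => //; apply: cvg_mx => i l; rewrite mxE.
rewrite (_ : (fun r => _) = pseries (exp_entry i l) t).
  exact: (@exp_bounded_cvg _ _ t (exp_entry_bound i l)).
apply/funext => r; rewrite summxE /pseries /series /= big_mkord; apply: eq_bigr => s _.
by rewrite mxE scale_exprmx /exp_entry; ring.
Qed.

Lemma is_derive_expmx (t : R) j k :
  is_derive t (1 : R) (fun t : R => expmx (t *: A) j k) ((expmx (t *: A) *m A) j k).
Proof.
rewrite (_ : (fun t : R => _) = fun t => limn (pseries (exp_entry j k) t)); last first.
  by apply/funext => s; rewrite expmxE.
have B0 := exp_entry_bound j k; have B1 := pseries_diffs_bound B0.
have B2 := pseries_diffs_bound B1.
have -> : (expmx (t *: A) *m A) j k = limn (pseries (pseries_diffs (exp_entry j k)) t).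
  apply/esym/cvg_lim => //; rewrite mxE.
  rewrite pseries_diffs_exp_entry.
  rewrite (_ : pseries _ t = fun r => \sum_l pseries (exp_entry j l) t r * A l k).
    apply: cvg_finsum => l; apply: cvgMr_tmp; rewrite expmxE.
    exact: (@exp_bounded_cvg _ _ t (exp_entry_bound j l)).
  apply/funext => r; rewrite /pseries /series /=.
  under [RHS]eq_bigr do rewrite mulr_suml.
  rewrite exchange_big; apply: eq_bigr => s _ /=.
  by rewrite mulr_suml; apply: eq_bigr => l _; ring.
(* Termwise differentiation asks for convergence, up to the second derived series, at a point of
   modulus larger than |t|. *)
apply: (@pseries_snd_diffs R (exp_entry j k) (`|t| + 1) t).
- exact: (@exp_bounded_cvg _ _ _ B0).
- exact: (@exp_bounded_cvg _ _ _ B1).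
- exact: (@exp_bounded_cvg _ _ _ B2).
- by rewrite [ltRHS]ger0_norm ?addr_ge0 // ltrDl.
Qed.

Lemma expmx0 : expmx (0 *: A) = 1%:M.
Proof.
apply/matrixP => j k; rewrite expmxE; apply: cvg_lim => //.
rewrite -cvg_shiftS (_ : (fun n => _) = fun=> 1%:M j k); first exact: cvg_cst.
apply/funext => n; rewrite /pseries /series /= big_nat_recl // big1.
  by rewrite addr0 /exp_entry expr0 fact0 invr1 mul1r mulr1.
by move=> i _; rewrite expr0n mulr0.
Qed.

(** With U' = U A, the product U tU has derivative U (A + tA) tU = 0. In this order the
    antisymmetric sum stands in the middle; [mulmx1C] then swaps the factors. *)
Lemma expmx_orthogonal t : A^T = - A -> (expmx (t *: A))^T *m expmx (t *: A) = 1%:M.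
Proof.
move=> antiA; apply: mulmx1C; apply/matrixP => j k.
pose p (s : R) := (expmx (s *: A) *m (expmx (s *: A))^T) j k.
have p' s : is_derive s (1 : R) p 0.
  have -> : 0 = \sum_l (expmx (s *: A) j l * (expmx (s *: A) *m A) k l +
     expmx (s *: A) k l * (expmx (s *: A) *m A) j l).
    rewrite big_split /=.
    have -> : \sum_l expmx (s *: A) j l * (expmx (s *: A) *m A) k l =
       (expmx (s *: A) *m (expmx (s *: A) *m A)^T) j k.
      by rewrite [RHS]mxE; apply: eq_bigr => l _; rewrite [_^T _ _]mxE.
    have -> : \sum_l expmx (s *: A) k l * (expmx (s *: A) *m A) j l =
       (expmx (s *: A) *m A *m (expmx (s *: A))^T) j k.
      by rewrite [RHS]mxE; apply: eq_bigr => l _; rewrite [_^T _ _]mxE mulrC.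
    by rewrite trmx_mul antiA !mulNmx mulmxN mulmxA [X in X + _]mxE addNr.
  rewrite (_ : p = fun s => \sum_l expmx (s *: A) j l * expmx (s *: A) k l); last first.
    by apply/funext => u; rewrite /p mxE; apply: eq_bigr => l _; rewrite mxE.
  by apply: is_derive_finsum => l; apply: is_derive_mul; exact: is_derive_expmx.
have := @is_derive_0_is_cst R p t 0 p'; rewrite /p => ->.
by rewrite expmx0 trmx1 mulmx1.
Qed.

End matrix_exponential.

(** * The Jacobian matrix of F *)

Section jacobian_of_F.
Variables (R : realType) (n N : nat) (alpha : R) (A : 'M[R]_N).
Variables (f : 'cV[R]_n -> 'cV[R]_N) (h : 'cV[R]_(n + 1) -> R).

(** The derivative of exp(h A) is taken with A on the right, so the exponential factors out on the
    left and leaves dh (alpha I + A) f + df. This is the origin of f*. *)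
Lemma is_derive_Fmap (z w : 'cV[R]_(n + 1)) (df : 'cV[R]_N) (dh : R) i :
  (forall k, is_derive z w (fun y => f (usubmx y) k 0) (df k 0)) ->
  is_derive z w h dh ->
  is_derive z w (fun y => Fmap alpha A f h y i 0)
    ((expR (alpha * h z) *: (expmx (h z *: A) *m
       (dh *: fstar alpha A f (usubmx z) + df))) i 0).
Proof.
move=> Hf Hh; set U := expmx (h z *: A).
have HU k : is_derive z w (fun y => expmx (h y *: A) i k) ((U *m A) i k * dh).
  exact: (is_derive_comp1 (is_derive_expmx A (h z) i k) Hh).
have HS := is_derive_finsum (fun k => is_derive_mul (HU k) (Hf k)).
have Hah : is_derive z w (fun y => alpha * h y) (alpha * dh).
  have := is_derive_mul (is_derive_cst alpha z w) Hh.
  by rewrite mulr0 addr0.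
have HE : is_derive z w (fun y => expR (alpha * h y)) (expR (alpha * h z) * (alpha * dh)).
  have := @is_derive_comp1 R _ expR (fun y => alpha * h y) (expR (alpha * h z))
    (alpha * dh) z w (is_derive_expR _) Hah.
  exact.
have := is_derive_mul HE HS.
rewrite (_ : (fun y => _ * _) = fun y => Fmap alpha A f h y i 0); last first.
  by apply/funext => y; rewrite /Fmap mxE [in RHS]mxE.
set r := (X in is_derive _ _ _ X) => Hr.
suff <- : r = (expR (alpha * h z) *: (U *m (dh *: fstar alpha A f (usubmx z) + df))) i 0 by [].
rewrite /r -/U [RHS]mxE /fstar mulmxDl mul_scalar_mx scalerDr !mulmxDr -!scalemxAr mulmxA.
rewrite big_split /=.
have -> : \sum_k U i k * df k 0 = (U *m df) i 0 by rewrite mxE.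
have -> : \sum_k f (usubmx z) k 0 * ((U *m A) i k * dh) = dh * (U *m A *m f (usubmx z)) i 0.
  by rewrite [in RHS]mxE mulr_sumr; apply: eq_bigr => k _; ring.
have -> : \sum_k U i k * f (usubmx z) k 0 = (U *m f (usubmx z)) i 0 by rewrite mxE.
by rewrite !mxE; ring.
Qed.

Lemma usubmx_basis (i : 'I_n) : usubmx (basis_vec R (lshift 1 i)) = basis_vec R i.
Proof.
by apply/matrixP => k j; rewrite !mxE (inj_eq (@lshift_inj _ _)).
Qed.

Lemma usubmx_basis_r (i : 'I_1) : usubmx (basis_vec R (rshift n i)) = 0.
Proof. by apply/matrixP => k j; rewrite !mxE eq_lrshift. Qed.

Lemma is_derive_usubmx (V : normedModType R) (g : 'cV[R]_n -> V) (z w : 'cV[R]_(n + 1)) l :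
  is_derive (usubmx z) (usubmx w) g l -> is_derive z w (fun y => g (usubmx y)) l.
Proof.
move=> [dg El]; apply: line_derivable.
rewrite (_ : (fun s => _) = fun s : R => g (usubmx z + s *: usubmx w)).
  by have := @derivable_line R _ _ g (usubmx z) (usubmx w) 0; rewrite scale0r addr0 -El; exact.
by apply/funext => s; rewrite !linearD /= !linearZ.
Qed.

Lemma Jac_Fmap (z : 'cV[R]_(n + 1)) :
  (forall k j, derivable (fun x => f x k 0) (usubmx z) (basis_vec R j)) ->
  (forall j, derivable h z (basis_vec R j)) ->
  Jac (Fmap alpha A f h) z = expR (alpha * h z) *: (expmx (h z *: A) *m
    row_mx (Jac f (usubmx z) + fstar alpha A f (usubmx z) *m \row_j partial (lshift 1 j) h z)
      (partial (rshift n ord0) h z *: fstar alpha A f (usubmx z))).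
Proof.
move=> df dh; apply/matrixP => i j; rewrite mul_mx_row scale_row_mx -[j]splitK mxE.
case: (fintype.split j) => k /=.
- rewrite row_mxEl.
  have H l : is_derive z (basis_vec R (lshift 1 k)) (fun y => f (usubmx y) l 0)
      (col k (Jac f (usubmx z)) l 0).
    apply: (@is_derive_usubmx _ (fun x => f x l 0)); rewrite usubmx_basis !mxE.
    by apply: DeriveDef => //; exact: df.
  have [_ E] := is_derive_Fmap i H (DeriveDef (dh (lshift 1 k)) erefl).
  rewrite /partial E [LHS]mxE [RHS]mxE; congr (_ * _); rewrite ![(_ *m _) _ _]mxE.
  apply: eq_bigr => l _; congr (_ * _); rewrite !mxE addrC big_ord1 mxE; congr (_ + _).
  by rewrite mulrC mxE.
- rewrite row_mxEr (ord1 k).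
  have H l : is_derive z (basis_vec R (rshift n ord0)) (fun y => f (usubmx y) l 0)
      ((0 : 'cV[R]_N) l 0).
    apply: (@is_derive_usubmx _ (fun x => f x l 0)); rewrite usubmx_basis_r mxE.
    exact: is_derive0.
  have [_ E] := is_derive_Fmap i H (DeriveDef (dh (rshift n ord0)) erefl).
  by rewrite /partial E addr0.
Qed.

End jacobian_of_F.

(** * Retraction to the unit interval, and vanishing gradients *)

Section constancy.
Variable R : realType.

Lemma continuous_retract (S T U : topologicalType) (A : set T) (c : S -> T) (g : T -> U) :
  {within A, continuous g} -> (forall s, A (c s)) -> continuous c -> continuous (g \o c).
Proof.
move=> /subspace_continuousP H Ac cc s P /(H _ (Ac s)) Pg.
have Q : nbhs s (fun u => A (c u) -> P (g (c u))) := cc s _ Pg.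
by apply: filterS Q => u; apply; exact: Ac.
Qed.

(** Paths and homotopies are controlled only on the unit interval; composed with this retraction
    they become continuous everywhere, with all their values in D. *)
Definition clamp (t : R) : R := Num.max 0 (Num.min 1 t).

Lemma clamp_itv t : unit_itv (clamp t).
Proof. by rewrite /unit_itv /= in_itv /= /clamp le_max lexx ge_max ler01 ge_min lexx. Qed.

Lemma clamp_id t : unit_itv t -> clamp t = t.
Proof.
rewrite /unit_itv /= in_itv /= => /andP[t0 t1].
by rewrite /clamp (min_idPr t1) (max_idPr t0).
Qed.

Lemma clamp_le0 (t : R) : t <= 0 -> clamp t = 0.
Proof. by move=> t0; rewrite /clamp (max_idPl _) // ge_min t0 orbT. Qed.

Lemma clamp_ge1 (t : R) : 1 <= t -> clamp t = 1.
Proof. by move=> t1; rewrite /clamp (min_idPl t1) (max_idPr _) // ler01. Qed.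

Lemma clamp_continuous : continuous clamp.
Proof.
move=> t; apply: (@continuous_max R R (fun=> 0) (fun s => Num.min 1 s)).
  exact: cst_continuous.
by apply: (@continuous_min R R (fun=> 1) id); [exact: cst_continuous|exact: cvg_id].
Qed.

Lemma box_cst m (a : 'cV[R]_m) (r : R) (g : 'cV[R]_m -> R) :
  (forall x j, ball a r x -> is_derive x (basis_vec R j) g 0) ->
  forall x, ball a r x -> g x = g a.
Proof.
move=> H x xr; have /ball_colP[r0 xa] := xr; apply/eqP; rewrite -subr_eq0; apply/eqP.
rewrite -[x in g x](subrK a) addrC [- g a + _]addrC [x - a + a]addrC stair_telescope.
apply: big1 => k _; rewrite stairS addrA; set y := a + stair (x - a) k; set t := (x - a) k 0.
have inb s : `|s| <= `|t| -> ball a r (y + s *: basis_vec R k).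
  move=> st; apply/ball_colP; split=> // i.
  rewrite !mxE !eqxx andbT -[a i 0 + _ + _]addrA addrAC subrr add0r.
  have [->|ne] /= := eqVneq i k.
    by rewrite ltnn add0r mulr1 (le_lt_trans st) // /t !mxE xa.
  by rewrite mulr0 addr0; case: ifP; rewrite ?normr0 // xa.
have [s|s st ->] := @partial_MVT R m g y k t.
  by move=> st; have [] := H _ k (inb s st).
by have [_] := H _ k (inb s st); rewrite /partial => ->; rewrite mulr0.
Qed.

(** Paths are merely continuous, so there is no chain rule: g is constant on small balls, hence g
    along the path is locally constant and has derivative 0. *)
Lemma partial0_cst m (D : set 'cV[R]_m) (g : 'cV[R]_m -> R) :
  open D -> path_connected D ->
  (forall x j, D x -> is_derive x (basis_vec R j) g 0) ->
  forall x y, D x -> D y -> g x = g y.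
Proof.
move=> oD pcD H x y Dx Dy.
have [c [[cc cD] c0 c1]] := pcD x y Dx Dy.
have ccl : continuous (c \o clamp).
  by apply: continuous_retract cc _ clamp_continuous; exact: clamp_itv.
have u' t : is_derive (t : R) (1 : R) (g \o (c \o clamp)) 0.
  have Dt : D (c (clamp t)) by apply: cD; exact: clamp_itv.
  have /nbhs_ballP[r /= r0 rD] := open_near oD Dt.
  apply: (@near_eq_is_derive R R R (cst (g (c (clamp t))))).
  have Q : nbhs t (fun s => ball (c (clamp t)) r (c (clamp s))) :=
    ccl t _ (nbhsx_ballx (c (clamp t)) r r0).
  apply: filterS Q => s Bs; apply/esym; apply: (box_cst _ Bs) => z j /rD Dz; exact: H.
have := @is_derive_0_is_cst R _ 0 1 u'.
by rewrite /= !clamp_id ?c0 ?c1 // /unit_itv /= in_itv /= ?lexx ?ler01.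
Qed.

End constancy.

(** * Gram matrices and orthogonal projection *)

Section gram.
Variables (R : realType) (n N : nat).
Implicit Types (u v : 'cV[R]_N) (J : 'M[R]_(N, n)).

Lemma dotE p (u v : 'cV[R]_p) : dot u v = \sum_i u i 0 * v i 0.
Proof. by rewrite /dot mxE; apply: eq_bigr => i _; rewrite mxE. Qed.

Lemma dotC p (u v : 'cV[R]_p) : dot u v = dot v u.
Proof. by rewrite !dotE; apply: eq_bigr => i _; rewrite mulrC. Qed.

Lemma tr_mul_dot p (u v : 'cV[R]_p) : u^T *m v = (dot u v)%:M.
Proof. exact: mx11_scalar. Qed.

Lemma dot_ge0 p (u : 'cV[R]_p) : 0 <= dot u u.
Proof. by rewrite dotE sumr_ge0 // => i _; rewrite -expr2 sqr_ge0. Qed.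

Lemma dot_gt0 p (u : 'cV[R]_p) : u != 0 -> 0 < dot u u.
Proof.
move=> u0; rewrite lt_neqAle dot_ge0 andbT eq_sym; apply: contraNneq u0.
rewrite dotE => /eqP; rewrite psumr_eq0 => [/allP H|i _]; last by rewrite -expr2 sqr_ge0.
apply/eqP/matrixP => i j; rewrite (ord1 j) mxE.
have := H i; rewrite mem_index_enum => /(_ isT).
by rewrite /= mulf_eq0 orbb => /eqP.
Qed.

(** For v != 0, the orthogonal projection onto the complement of v. *)
Definition proj_perp (v : 'cV[R]_N) : 'M[R]_N := 1%:M - (dot v v)^-1 *: (v *m v^T).

Lemma proj_perp_tr v : (proj_perp v)^T = proj_perp v.
Proof. by rewrite /proj_perp linearB /= trmx1 linearZ /= trmx_mul trmxK. Qed.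

Lemma proj_perp_self v : v != 0 -> proj_perp v *m v = 0.
Proof.
move=> v0; rewrite /proj_perp mulmxBl mul1mx -scalemxAl -mulmxA tr_mul_dot.
by rewrite mul_mx_scalar scalerA mulVf ?scale1r ?subrr // gt_eqF ?dot_gt0.
Qed.

Lemma proj_perp_idem v : v != 0 -> proj_perp v *m proj_perp v = proj_perp v.
Proof.
move=> v0; rewrite {2}/proj_perp mulmxBr mulmx1 -scalemxAr mulmxA.
by rewrite proj_perp_self // mul0mx scaler0 subr0.
Qed.

Definition perp_gram J v : 'M[R]_n := J^T *m proj_perp v *m J.

Lemma perp_gramE J v : v != 0 ->
  perp_gram J v = (proj_perp v *m J)^T *m (proj_perp v *m J).
Proof.
move=> v0; rewrite /perp_gram trmx_mul proj_perp_tr -!mulmxA; congr (_ *m _).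
by rewrite !mulmxA proj_perp_idem.
Qed.

Lemma mulmx_span J (u : 'cV[R]_n) :
  J *m u \in <<[seq col j J | j <- enum 'I_n]>>%VS.
Proof.
rewrite (_ : J *m u = \sum_j u j 0 *: col j J).
  apply: memv_suml => j _; apply: memvZ; apply: memv_span.
  by apply/mapP; exists j; rewrite ?mem_enum.
apply/matrixP => i k; rewrite (ord1 k) mxE summxE; apply: eq_bigr => j _.
by rewrite !mxE mulrC.
Qed.

(** If the projection of J u vanishes, then J u is a multiple of v. A nonzero multiple would put v
    in the span of the columns, so J u = 0, and the invertible Gram matrix gives u = 0. *)
Lemma perp_gram_posdef J v (s : R) : 0 < s -> \det (J^T *m J) != 0 ->
  v \notin <<[seq col j J | j <- enum 'I_n]>>%VS -> sym_posdef (s *: perp_gram J v).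
Proof.
move=> s0 dJ vJ; have v0 : v != 0 by apply: contraNneq vJ => ->; exact: mem0v.
split=> [|u u0].
  by rewrite linearZ /= perp_gramE // trmx_mul trmxK.
have -> : dot u (s *: perp_gram J v *m u) =
    s * dot (proj_perp v *m J *m u) (proj_perp v *m J *m u).
  rewrite perp_gramE //; move: (_ *m J) => M.
  by rewrite /dot -scalemxAl -scalemxAr mxE trmx_mul !mulmxA.
rewrite mulr_gt0 // dot_gt0 //; apply: contra_neqN u0 => /eqP.
rewrite -mulmxA /proj_perp mulmxBl mul1mx -scalemxAl -mulmxA tr_mul_dot mul_mx_scalar scalerA.
move/eqP; rewrite subr_eq0 => /eqP E.
set a := _ * _ in E.
have a0 : a = 0.
  apply/eqP; apply: contraNT vJ => a0.
  have -> : v = J *m (a^-1 *: u) by rewrite -scalemxAr E scalerA mulVf // scale1r.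
  exact: mulmx_span.
have : J^T *m J \in unitmx by rewrite unitmxE unitfE.
by move=> JU; rewrite -(mulKmx JU u) -mulmxA E a0 scale0r mulmx0 mulmx0.
Qed.

End gram.

(** * The Gram matrix of DF compared with the metric *)

Section metric_of_F.
Variables (R : realType) (n N : nat).
Hypothesis hn : (0 < n)%N.
Variables (alpha : R) (A : 'M[R]_N) (f : 'cV[R]_n -> 'cV[R]_N) (H : 'cV[R]_n -> R).
Local Notation fs := (fstar alpha A f).

Lemma mx_of_gmetric p : mx_of_metric (gmetric alpha A f H) p = qmx alpha A f H p.
Proof.
apply/matrixP => i j; rewrite mxE /gmetric /metric_of_mx /dot /basis_vec.
by rewrite trmx_delta -rowE -colE !mxE.
Qed.

Definition conf x : R :=
  expR (- (2 * n.+1%:R / n%:R) * alpha * H x) * (dot (fs x) (fs x)) `^ (n%:R^-1).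

Lemma qmxE x : qmx alpha A f H x = conf x *: perp_gram (Jac f x) (fs x).
Proof. by []. Qed.

Lemma conf_gt0 x : fs x != 0 -> 0 < conf x.
Proof. by move=> v0; rewrite mulr_gt0 ?expR_gt0 // powR_gt0 // dot_gt0. Qed.

(** The determinant of an n x n matrix extracts this n-th power, which undoes the exponents with
    denominator n. *)
Lemma confX x : fs x != 0 ->
  conf x ^+ n = expR (- (2 * n.+1%:R) * alpha * H x) * dot (fs x) (fs x).
Proof.
move=> v0; have n0 : n%:R != 0 :> R by rewrite pnatr_eq0 -lt0n.
rewrite /conf exprMn -expRM_natl -powR_mulrn ?powR_ge0 // -powRrM mulVf // powRr1 ?dot_ge0 //.
by congr (expR _ * _); field.
Qed.

Lemma det_qmx x : fs x != 0 -> \det (qmx alpha A f H x) =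
  expR (- (2 * n.+1%:R) * alpha * H x) * dot (fs x) (fs x) * \det (perp_gram (Jac f x) (fs x)).
Proof. by move=> v0; rewrite qmxE detZ confX. Qed.

Variable h : 'cV[R]_(n + 1) -> R.
Hypothesis hA : A^T = - A.

Variable z : 'cV[R]_(n + 1).
Local Notation x := (usubmx z).
Local Notation dh := (\row_j partial (lshift 1 j) h z).
Local Notation ht := (partial (rshift n ord0) h z).
Local Notation K := (Jac f x + fs x *m dh).
Hypothesis df : forall k j, derivable (fun x => f x k 0) x (basis_vec R j).
Hypothesis dh_ex : forall j, derivable h z (basis_vec R j).
Hypothesis fs0 : fs x != 0.

Lemma gram_Fmap : (Jac (Fmap alpha A f h) z)^T *m Jac (Fmap alpha A f h) z =
  expR (alpha * h z) ^+ 2 *: block_mx (K^T *m K) (ht *: (K^T *m fs x))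
    (ht *: (fs x)^T *m K) (ht ^+ 2 * dot (fs x) (fs x))%:M.
Proof.
rewrite Jac_Fmap //; set M := _ *m row_mx _ _.
have Z (e : R) : (e *: M)^T *m (e *: M) = e ^+ 2 *: (M^T *m M).
  by rewrite [(e *: M)^T]linearZ /= -scalemxAl -scalemxAr scalerA expr2.
rewrite Z /M; congr (_ *: _).
rewrite trmx_mul mulmxA -[_ *m (expmx _)^T *m _]mulmxA expmx_orthogonal // mulmx1.
rewrite tr_row_mx mul_col_row [(_ *: fs x)^T]linearZ /= -!scalemxAr -!scalemxAl tr_mul_dot.
by rewrite !scale_scalar_mx mulrA -expr2.
Qed.

Lemma star_gradient :
  is_diag_mx ((Jac (Fmap alpha A f h) z)^T *m Jac (Fmap alpha A f h) z) ->
  (Jac (Fmap alpha A f h) z)^T *m Jac (Fmap alpha A f h) z \in unitmx ->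
  dh = - ((dot (fs x) (fs x))^-1 *: ((fs x)^T *m Jac f x)).
Proof.
rewrite gram_Fmap scale_block_mx is_diag_block_mx // => /and4P[/eqP ur _ _ _] GU.
have e0 : expR (alpha * h z) ^+ 2 != 0 by rewrite sqrf_eq0 expR_eq0.
move: (ur); rewrite scalerA => /eqP; rewrite scaler_eq0 mulf_eq0 (negbTE e0) /= => /orP[/eqP ht0|/eqP K0].
  (* If h_t vanished, so would the last diagonal entry, and the Gram matrix would be singular. *)
  move: GU; rewrite unitmxE ur det_lblock ht0 expr0n mul0r scale_scalar_mx mulr0 det_scalar1.
  by rewrite mulr0 unitr0.
have d0 : dot (fs x) (fs x) != 0 by rewrite gt_eqF ?dot_gt0.
have : (K^T *m fs x)^T = 0 by rewrite K0 trmx0.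
rewrite trmx_mul trmxK mulmxDr mulmxA tr_mul_dot mul_scalar_mx => /eqP.
rewrite addrC addr_eq0 => /eqP E.
by rewrite -[LHS]scale1r -(mulVf d0) -scalerA E scalerN.
Qed.

Hypothesis dhE : dh = - ((dot (fs x) (fs x))^-1 *: ((fs x)^T *m Jac f x)).

Lemma gram_FmapE : (Jac (Fmap alpha A f h) z)^T *m Jac (Fmap alpha A f h) z =
  expR (alpha * h z) ^+ 2 *: block_mx (perp_gram (Jac f x) (fs x)) 0
    0 (ht ^+ 2 * dot (fs x) (fs x))%:M.
Proof.
(* The prescribed gradient subtracts from each column of J_f its component along f*, so K is the
   projected Jacobian and the off-diagonal blocks vanish. *)
have KE : K = proj_perp (fs x) *m Jac f x.
  rewrite dhE /proj_perp mulmxBl mul1mx mulmxN -scalemxAr -scalemxAl mulmxA.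
  by [].
rewrite gram_Fmap KE -perp_gramE // trmx_mul proj_perp_tr -mulmxA proj_perp_self // mulmx0.
rewrite -scalemxAl mulmxA -[(fs x)^T *m proj_perp _]trmxK trmx_mul trmxK proj_perp_tr.
by rewrite proj_perp_self // trmx0 mul0mx !scaler0.
Qed.

Lemma diag_gram_Fmap :
  is_diag_mx ((Jac (Fmap alpha A f h) z)^T *m Jac (Fmap alpha A f h) z) =
  is_diag_mx (qmx alpha A f H x).
Proof.
have Z p (c : R) (M : 'M[R]_p) : c != 0 -> is_diag_mx (c *: M) = is_diag_mx M.
  move=> c0; apply/is_diag_mxP/is_diag_mxP => HM i j ij; last by rewrite mxE HM // mulr0.
  by have /eqP := HM i j ij; rewrite mxE mulf_eq0 (negbTE c0) /= => /eqP.
rewrite gram_FmapE Z ?sqrf_eq0 ?expR_eq0 // is_diag_block_mx // !eqxx scalar_mx_is_diag andbT /=.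
by rewrite qmxE Z // gt_eqF // conf_gt0.
Qed.

Lemma det_gram_Fmap :
  \det ((Jac (Fmap alpha A f h) z)^T *m Jac (Fmap alpha A f h) z) =
  expR (2 * n.+1%:R * alpha * (h z + H x)) * ht ^+ 2 * \det (qmx alpha A f H x).
Proof.
rewrite gram_FmapE detZ det_ublock det_scalar1 det_qmx //.
have -> : expR (alpha * h z) ^+ 2 ^+ (n + 1) = expR ((n.+1 * 2)%:R * (alpha * h z)).
  by rewrite addn1 -exprM mulnC -expRM_natl.
rewrite mulrDr expRD.
have -> : 2 * n.+1%:R * alpha * h z = (n.+1 * 2)%:R * (alpha * h z).
  by rewrite natrM; ring.
(* These two inverse factors trade h for h + H in the exponent. *)
have E : expR (2 * n.+1%:R * alpha * H x) * expR (- (2 * n.+1%:R) * alpha * H x) = 1.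
  by rewrite -expRD !mulNr subrr expR0.
set a := expR ((n.+1 * 2)%:R * _).
set b := expR _ in E *; set c := expR _ in E *.
set d := dot _ _; set G := \det _; set t := partial _ _ _.
transitivity (a * (G * (t ^+ 2 * d)) * (b * c)); first by rewrite E mulr1.
by ring.
Qed.

End metric_of_F.

(** * Equivalence of (a) and (b) *)

Section cylinder_facts.
Variables (R : realType) (n : nat) (D : set 'cV[R]_n).

Lemma usubmx_continuous : continuous (@usubmx R n 1 1).
Proof.
move=> z; apply: continuous_col => i.
rewrite (_ : (fun y => _) = fun y : 'cV[R]_(n + 1) => y (lshift 1 i) 0); first exact: coord_continuous.
by apply/funext => y; rewrite mxE.
Qed.

Lemma cylinder_open : open D -> open (cylinder D).
Proof.
move=> oD; apply: openI.
  by apply: open_comp => // z _; exact: usubmx_continuous.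
rewrite (_ : (fun z => _) = (fun z : 'cV[R]_(n + 1) => z (rshift n ord0) 0) @^-1` [set t | 0 < t]).
  by apply: open_comp => [z _|]; [exact: coord_continuous|exact: open_gt].
by apply/funext => z /=; rewrite mxE.
Qed.

Lemma cylinder_col x t : D x -> 0 < t -> cylinder D (col_mx x (t%:M : 'M[R]_1)).
Proof. by move=> Dx t0; rewrite /cylinder /= col_mxKu col_mxKd mxE eqxx. Qed.

Lemma C_map_usubmx k : open D -> C_map k (cylinder D) (@usubmx R n 1 1).
Proof.
move=> oD i; apply: C_on_ext (C_on_coord (cylinder D) k (lshift 1 i)).
  exact: cylinder_open.
by move=> x _; rewrite mxE.
Qed.

Lemma col_mx_line x (t s : R) (v : 'cV[R]_n) :
  col_mx (x + s *: v) (t%:M : 'M[R]_1) = col_mx x t%:M + s *: col_mx v 0.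
Proof. by rewrite scale_col_mx scaler0 add_col_mx addr0. Qed.

Lemma basis_vec_lshift (j : 'I_n) : basis_vec R (lshift 1 j) = col_mx (basis_vec R j) 0.
Proof.
rewrite -[LHS]vsubmxK usubmx_basis; congr col_mx.
by apply/matrixP => i k; rewrite !mxE eq_rlshift.
Qed.

Lemma col_mx_line_r x (t s : R) :
  col_mx x (t%:M : 'M[R]_1) + s *: basis_vec R (rshift n ord0) = col_mx x (t + s)%:M.
Proof.
rewrite -[basis_vec _ _]vsubmxK usubmx_basis_r scale_col_mx scaler0 add_col_mx addr0.
congr col_mx; apply/matrixP => i k.
by rewrite !mxE !ord1 !eqxx mulr1 !mulr1n.
Qed.

End cylinder_facts.

Section main_equivalence.
Variables (R : realType) (n N : nat).
Hypothesis hn : (0 < n)%N.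
Variables (k : smoothness) (D : set 'cV[R]_n) (alpha : R) (A : 'M[R]_N).
Hypotheses (k1 : at_least_C1 k) (oD : open D) (pcD : path_connected D).
Variables (f : 'cV[R]_n -> 'cV[R]_N) (H : 'cV[R]_n -> R).
Hypotheses (hf : C_map k D f) (hA : A^T = - A) (hii : cond_ii D alpha A f).
Local Notation fs := (fstar alpha A f).

Definition omega (j : 'I_n) (x : 'cV[R]_n) : R :=
  dot (fs x) (col j (Jac f x)) / dot (fs x) (fs x).

Lemma fstar_neq0 x : D x -> fs x != 0.
Proof. by move=> /hii[_]; apply: contraNneq => ->; exact: mem0v. Qed.

Lemma fstar_C_on (p : smoothness) i : C_map p D f -> C_on p D (fun x => fs x i 0).
Proof.
move=> H1.
apply: (@C_on_ext _ _ _ oD _ (fun x => \sum_l (alpha%:M + A) i l * f x l 0)).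
  by move=> x _; rewrite [RHS]mxE.
by apply: C_on_sum => // l; apply: C_onM => //; exact: C_on_cst.
Qed.

(** The first derivatives of f in the numerator cost one order of smoothness, which taking the
    primitive H regains. *)
Lemma omega_C_on j : C_on (prev k) D (omega j).
Proof.
have Hp : C_map (prev k) D f by move=> i; apply: C_on_prevW; exact: hf.
apply: (@C_on_ext _ _ _ oD _ (fun x =>
  (\sum_i fs x i 0 * partial j (fun y => f y i 0) x) * (\sum_i fs x i 0 * fs x i 0)^-1)).
  move=> x _; rewrite /omega !dotE; congr (_ / _).
  by apply: eq_bigr => i _; rewrite !mxE.
apply: C_onM => //.
  apply: C_on_sum => // i; apply: C_onM => //; first exact: fstar_C_on.
  exact: C_on_partial.
apply: C_onV => // [x Dx|].
  by rewrite -dotE gt_eqF // dot_gt0 // fstar_neq0.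
by apply: C_on_sum => // i; apply: C_onM => //; exact: fstar_C_on.
Qed.

Hypothesis hH : is_H D alpha A f H.

Lemma is_derive_H x j : D x -> is_derive x (basis_vec R j) H (omega j x).
Proof. by move=> /hH /(_ j)[d e]; exact: DeriveDef. Qed.

Lemma H_C_on : C_on k D H.
Proof.
apply: C_on_primitive => // [j x Dx|j]; first by have [] := is_derive_H j Dx.
by apply: C_on_ext (omega_C_on j) => // x Dx; have [_ <-] := is_derive_H j Dx.
Qed.

Lemma row_omega x : \row_j omega j x = (dot (fs x) (fs x))^-1 *: ((fs x)^T *m Jac f x).
Proof.
apply/matrixP => i j; rewrite (ord1 i) !mxE /omega mulrC; congr (_ * _).
by rewrite dotE; apply: eq_bigr => l _; rewrite !mxE.
Qed.

Lemma f_derivable x i j : D x -> derivable (fun y => f y i 0) x (basis_vec R j).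
Proof. by move=> Dx; apply: Cfin_derivable Dx; exact: C_on_C1 (hf i). Qed.

(* psi solves exp((n + 1) alpha psi) psi' = kappa, where psi' = dpsi. *)
Definition psi (t : R) : R := if alpha == 0 then t else ln t * (n.+1%:R * alpha)^-1.

Definition dpsi (t : R) : R := if alpha == 0 then 1 else t^-1 * (n.+1%:R * alpha)^-1.

Lemma is_derive_psi (t : R) : 0 < t -> is_derive t (1 : R) psi (dpsi t).
Proof.
rewrite /psi /dpsi => t0; case: ifP => a0; first exact: is_derive_id.
have := is_derive_mul (is_derive1_ln t0) (is_derive_cst (n.+1%:R * alpha)^-1 t (1 : R)).
by rewrite mulr0 add0r [cst _ _ / _]mulrC.
Qed.

Definition kappa : R := if alpha == 0 then 1 else (n.+1%:R * alpha)^-1.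

Lemma kappa_neq0 : kappa != 0.
Proof.
rewrite /kappa; case: ifPn => [_|a0]; first exact: oner_neq0.
by rewrite invr_neq0 // mulf_neq0 // pnatr_eq0.
Qed.

Lemma psiE (t : R) : 0 < t ->
  expR (2 * n.+1%:R * alpha * psi t) * dpsi t ^+ 2 = kappa ^+ 2.
Proof.
rewrite /psi /dpsi /kappa => t0; case: eqP => [->|/eqP a0].
  by rewrite mulr0 mul0r expR0 mul1r.
have -> : 2 * n.+1%:R * alpha * (ln t * (n.+1%:R * alpha)^-1) = 2%:R * ln t.
  have n0 : n.+1%:R != 0 :> R by rewrite pnatr_eq0.
  rewrite -mulrA -[2 * _ * _]mulrA; congr (_ * _); rewrite mulrCA.
  by rewrite mulrA [alpha * _]mulrC mulrCA mulfV ?mulr1 // mulf_neq0.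
rewrite expRM_natl lnK ?posrE // exprMn mulrA -exprMn mulfV ?gt_eqF //.
by rewrite expr1n mul1r.
Qed.

Definition hpsi (z : 'cV[R]_(n + 1)) : R := - H (usubmx z) + psi (z (rshift n ord0) 0).

Lemma is_derive_hpsi_l z j : cylinder D z ->
  is_derive z (basis_vec R (lshift 1 j)) hpsi (- omega j (usubmx z)).
Proof.
move=> [Dz _].
have H1 : is_derive z (basis_vec R (lshift 1 j)) (fun y => H (usubmx y)) (omega j (usubmx z)).
  by apply: is_derive_usubmx; rewrite usubmx_basis; exact: is_derive_H.
have H2 : is_derive z (basis_vec R (lshift 1 j))
    (fun y : 'cV[R]_(n + 1) => psi (y (rshift n ord0) 0)) 0.
  apply: line_derivable.
  rewrite (_ : (fun s => _) = cst (psi (z (rshift n ord0) 0))).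
    exact: (is_derive_cst (psi (z (rshift n ord0) 0)) (0 : R) (1 : R)).
  by apply/funext => s; rewrite !mxE eq_rlshift /= mulr0 addr0.
have := is_derive_add (is_deriveN H1) H2.
by rewrite addr0.
Qed.

Lemma is_derive_hpsi_r z : cylinder D z ->
  is_derive z (basis_vec R (rshift n ord0)) hpsi (dpsi (z (rshift n ord0) 0)).
Proof.
move=> [Dz]; rewrite mxE => t0.
have H1 : is_derive z (basis_vec R (rshift n ord0)) (fun y => H (usubmx y)) 0.
  by apply: is_derive_usubmx; rewrite usubmx_basis_r; exact: is_derive0.
have H2 := is_derive_comp1 (is_derive_psi t0) (is_derive_coord z (rshift n ord0) (rshift n ord0)).
have := is_derive_add (is_deriveN H1) H2.
by rewrite oppr0 add0r eqxx mulr1.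
Qed.

Lemma hpsi_derivable z j : cylinder D z -> derivable hpsi z (basis_vec R j).
Proof.
move=> Dz; rewrite -[j]splitK; case: (fintype.split j) => i /=.
  by have [] := is_derive_hpsi_l i Dz.
by rewrite (ord1 i); have [] := is_derive_hpsi_r Dz.
Qed.

(** The partial derivatives are - omega and either 1 or a multiple of 1 / t. All are of class
    [prev k], so the primitive lemma gives the class of [hpsi], including its logarithm. *)
Lemma hpsi_C_on : C_on k (cylinder D) hpsi.
Proof.
have oC := cylinder_open oD.
apply: C_on_primitive => // [j z Dz|j]; first exact: hpsi_derivable.
rewrite -[j]splitK; case: (fintype.split j) => i /=.
  apply: (@C_on_ext _ _ _ oC _ (fun z => -1 * omega i (usubmx z))).
    by move=> z Dz; have [_ E] := is_derive_hpsi_l i Dz; rewrite /partial E mulN1r.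
  apply: C_onM => //; first exact: C_on_cst.
  apply: (@C_on_comp _ _ _ _ D _ (omega i)) => //; last exact: omega_C_on.
    by move=> z [].
  exact: C_map_usubmx.
rewrite (ord1 i).
apply: (@C_on_ext _ _ _ oC _ (fun z : 'cV[R]_(n + 1) => dpsi (z (rshift n ord0) 0))).
  by move=> z Dz; have [_ E] := is_derive_hpsi_r Dz; rewrite /partial E.
rewrite /dpsi; case: (alpha == 0); first exact: C_on_cst.
apply: C_onM => //; last exact: C_on_cst.
apply: C_onV => //; last exact: C_on_coord.
by move=> z [_]; rewrite mxE => t0; rewrite gt_eqF.
Qed.

Lemma qmx_posdef x : D x -> sym_posdef (qmx alpha A f H x).
Proof.
move=> Dx; rewrite qmxE; have [h1 h2] := hii Dx.
by apply: perp_gram_posdef => //; apply: conf_gt0; exact: fstar_neq0.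
Qed.

(** The diagonal entries are values of the form on basis vectors. Positivity is what makes the
    constant determinant of (b) a square. *)
Lemma diag_posdef_det m (q : 'M[R]_m) : sym_posdef q -> is_diag_mx q -> 0 < \det q.
Proof.
move=> [_ pos] dq; rewrite det_trig ?is_diag_mx_is_trig // prodr_gt0 // => i _.
have : basis_vec R i != 0 :> 'cV[R]_m.
  apply/eqP => /matrixP/(_ i 0); rewrite !mxE !eqxx => /eqP.
  by rewrite oner_eq0.
by move=> /pos; rewrite /dot /basis_vec trmx_delta -rowE -colE !mxE.
Qed.

(** At fixed t, the functions h and - H have the same gradient on the path-connected D; this
    separates the variables in h. *)
Lemma h_plus_H_cst (h : 'cV[R]_(n + 1) -> R) x y t :
  (forall z j, cylinder D z ->
     is_derive z (basis_vec R (lshift 1 j)) h (- omega j (usubmx z))) ->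
  D x -> D y -> 0 < t ->
  h (col_mx x t%:M) + H x = h (col_mx y t%:M) + H y.
Proof.
move=> dh Dx Dy t0.
apply: (@partial0_cst R n D (fun x => h (col_mx x t%:M) + H x)) => // u j Du.
rewrite -(addNr (omega j u)); apply: is_derive_add; last exact: is_derive_H.
have [d E] := dh _ j (cylinder_col Du t0); rewrite col_mxKu in E; rewrite -E.
apply: line_derivable.
rewrite (_ : (fun s => _) = fun s : R => h (col_mx u t%:M + s *: basis_vec R (lshift 1 j))).
  by have := @derivable_line R _ _ h (col_mx u t%:M) (basis_vec R (lshift 1 j)) 0;
    rewrite scale0r addr0; apply.
by apply/funext => s; rewrite basis_vec_lshift -col_mx_line.
Qed.

Lemma main_iff :
  (exists h : 'cV[R]_(n + 1) -> R,
     [/\ C_on k (cylinder D) h,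
         star (cylinder D) (Fmap alpha A f h) &
         starstar (cylinder D) (Fmap alpha A f h)])
  <->
  (diagonal_metric D (gmetric alpha A f H) /\
   constant_det_metric D (gmetric alpha A f H)).
Proof.
have oC := cylinder_open oD.
split=> [[h [Ch st [c [c0 dc]]]]|[dg [c dc]]].
- have dh z j : cylinder D z -> derivable h z (basis_vec R j).
    by move=> Dz; apply: Cfin_derivable Dz; exact: C_on_C1 Ch.
  have grad z : cylinder D z ->
      \row_j partial (lshift 1 j) h z =
      - ((dot (fs (usubmx z)) (fs (usubmx z)))^-1 *: ((fs (usubmx z))^T *m Jac f (usubmx z))).
    move=> Dz; have [h1 h2] := st z Dz; have [Dx _] := Dz.
    apply: (star_gradient hA _ _ _ h1 h2) => [i j|j|]; [exact: f_derivable|exact: dh|exact: fstar_neq0].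
  have dhl z j : cylinder D z ->
      is_derive z (basis_vec R (lshift 1 j)) h (- omega j (usubmx z)).
    move=> Dz; apply: DeriveDef; first exact: dh.
    have := grad z Dz; rewrite -row_omega => /matrixP/(_ 0 j).
    by rewrite !mxE.
  (* The slice t = 1 suffices: there the Gram determinant is a factor that will turn out independent
     of x, times det q_f. *)
  have detE x : D x -> c ^+ 2 =
     expR (2 * n.+1%:R * alpha * (h (col_mx x 1%:M) + H x)) *
     partial (rshift n ord0) h (col_mx x 1%:M) ^+ 2 * \det (qmx alpha A f H x).
    move=> Dx; have Dz := cylinder_col Dx ltr01.
    rewrite -(dc _ Dz) (@det_gram_Fmap _ _ _ hn _ _ _ H) ?col_mxKu //.
    - by move=> i j; exact: f_derivable.
    - by move=> j; exact: dh.
    - exact: fstar_neq0.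
    - by have := grad _ Dz; rewrite col_mxKu.
  split.
    move=> x Dx; rewrite mx_of_gmetric; have Dz := cylinder_col Dx ltr01.
    have [h1 _] := st _ Dz; move: h1; rewrite (@diag_gram_Fmap _ _ _ _ _ _ H) ?col_mxKu //.
    - by move=> i j; exact: f_derivable.
    - by move=> j; exact: dh.
    - exact: fstar_neq0.
    - by have := grad _ Dz; rewrite col_mxKu.
  (* The constant is the value at a base point; for empty D any number serves. *)
  case: (pselect (exists x0, D x0)) => [[x0 Dx0]|noD]; last first.
    by exists 0 => x Dx; case: noD; exists x.
  exists (\det (qmx alpha A f H x0)) => x Dx; rewrite mx_of_gmetric.
  have Ex := detE x Dx; have E0 := detE x0 Dx0.
  have hE t : 0 < t -> h (col_mx x t%:M) + H x = h (col_mx x0 t%:M) + H x0.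
    by move=> t0; exact: h_plus_H_cst.
  (* Near t = 1 the functions h(x, t) and h(x0, t) of t differ by the constant H x0 - H x, so their
     derivatives agree. *)
  have pE : partial (rshift n ord0) h (col_mx x 1%:M) = partial (rshift n ord0) h (col_mx x0 1%:M).
    have [_ <-] // : is_derive (col_mx x (1%:M : 'M[R]_1)) (basis_vec R (rshift n ord0)) h
      (partial (rshift n ord0) h (col_mx x0 1%:M)).
    apply: line_derivable.
    apply: (@near_eq_is_derive _ _ _ (fun s : R =>
      h (col_mx x0 1%:M + s *: basis_vec R (rshift n ord0)) + (H x0 - H x))).
      have : \forall s \near (0 : R), 0 < 1 + s.
        apply/nbhs_ballP; exists 1 => //= s; rewrite /ball /= sub0r normrN => s1.
        by have := ler_norm (- s); rewrite normrN; lra.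
      apply: filterS => s s1; rewrite !col_mx_line_r; have := hE _ s1; lra.
    rewrite -[X in is_derive _ _ _ X]addr0; apply: is_derive_add.
    have := @derivable_line R _ _ h (col_mx x0 1%:M) (basis_vec R (rshift n ord0)) 0.
    by rewrite scale0r addr0; apply; apply: dh; exact: cylinder_col.
  move: Ex; rewrite hE // pE {1}E0 => E.
  (* The factor common to x and x0 is nonzero, its product with a determinant being c^2, and can be
     cancelled. *)
  have : expR (2 * n.+1%:R * alpha * (h (col_mx x0 1%:M) + H x0)) *
     partial (rshift n ord0) h (col_mx x0 1%:M) ^+ 2 != 0.
    by apply: contraNneq c0 => Z; rewrite -sqrf_eq0 E0 Z mul0r.
  by move=> nz; apply: (mulfI nz); rewrite -E.
- have gradE z : cylinder D z -> \row_j partial (lshift 1 j) hpsi z =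
      - ((dot (fs (usubmx z)) (fs (usubmx z)))^-1 *: ((fs (usubmx z))^T *m Jac f (usubmx z))).
    move=> Dz; rewrite -row_omega; apply/matrixP => i j; rewrite !mxE.
    by have [_ <-] := is_derive_hpsi_l j Dz.
  have detE z : cylinder D z ->
     \det ((Jac (Fmap alpha A f hpsi) z)^T *m Jac (Fmap alpha A f hpsi) z) =
     kappa ^+ 2 * \det (qmx alpha A f H (usubmx z)).
    move=> Dz; have [Dx t0] := Dz; rewrite (@det_gram_Fmap _ _ _ hn _ _ _ H) //.
    + have [_ E] := is_derive_hpsi_r Dz; rewrite /partial E.
      by rewrite /hpsi addrAC addNr add0r psiE //; move: t0; rewrite mxE.
    + by move=> i j; exact: f_derivable.
    + by move=> j; exact: hpsi_derivable.
    + exact: fstar_neq0.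
    + exact: gradE.
  have dpos x : D x -> 0 < \det (qmx alpha A f H x).
    move=> Dx; apply: diag_posdef_det; first exact: qmx_posdef.
    by have := dg x Dx; rewrite mx_of_gmetric.
  exists hpsi; split; first exact: hpsi_C_on.
    move=> z Dz; have [Dx t0] := Dz; split.
      rewrite (@diag_gram_Fmap _ _ _ _ _ _ H) //.
      + by have := dg _ Dx; rewrite mx_of_gmetric.
      + by move=> i j; exact: f_derivable.
      + by move=> j; exact: hpsi_derivable.
      + exact: fstar_neq0.
      + exact: gradE.
    rewrite unitmxE unitfE detE // mulf_neq0 ?sqrf_eq0 ?kappa_neq0 //.
    by rewrite gt_eqF // dpos.
  (* The Gram determinant is kappa^2 c. If c <= 0, the positivity of det q_f leaves D empty, and any
     nonzero witness serves. *)
  case: (ltP 0 c) => c0.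
    exists (kappa * Num.sqrt c); split.
      by rewrite mulf_neq0 ?kappa_neq0 // gt_eqF // sqrtr_gt0.
    move=> z Dz; have [Dx _] := Dz; rewrite detE // -mx_of_gmetric dc // exprMn sqr_sqrtr //.
    exact: ltW.
  exists 1; split; first exact: oner_neq0.
  move=> z [Dx _]; have := dpos _ Dx; rewrite -mx_of_gmetric dc // => /(le_lt_trans c0).
  by rewrite ltxx.
Qed.

End main_equivalence.

(** * Existence of H *)

Lemma is_derive_inv (R : realType) (V : normedModType R) (g : V -> R) (dg : R) (x v : V) :
  g x != 0 -> is_derive x v g dg -> is_derive x v (fun y => (g y)^-1) (- (g x) ^- 2 * dg).
Proof.
move=> g0 [d <-]; apply: DeriveDef; first exact: (@derivableV _ _ g).
exact: (@deriveV _ _ g).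
Qed.

(** * Symmetry of second derivatives *)

Section second_derivatives.
Variables (R : realType) (m : nat).

(** The mean value theorem is applied in the direction i and then in the direction j. The second
    difference is symmetric in i and j, so exchanging them compares the two mixed derivatives. *)
Lemma second_difference (g : 'cV[R]_m -> R) (x : 'cV[R]_m) i j (s : R) :
  (forall y : 'cV[R]_m, (forall k, `|y k 0 - x k 0| <= 2 * `|s|) ->
     derivable g y (basis_vec R i) /\ derivable (partial i g) y (basis_vec R j)) ->
  exists2 y : 'cV[R]_m, (forall k, `|y k 0 - x k 0| <= 2 * `|s|) &
    g (x + s *: basis_vec R i + s *: basis_vec R j) - g (x + s *: basis_vec R i) -
    g (x + s *: basis_vec R j) + g x = s * (s * partial j (partial i g) y).
Proof.
move=> H.
have dist (u v : R) k : `|u| <= `|s| -> `|v| <= `|s| ->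
    `|(x + u *: basis_vec R i + v *: basis_vec R j) k 0 - x k 0| <= 2 * `|s|.
  move=> us vs; rewrite !mxE !eqxx !andbT -[x k 0 + _ + _]addrA addrAC subrr add0r.
  apply: le_trans (ler_normD _ _) _.
  have := normr_ge0 s.
  by case: (k == i); case: (k == j); rewrite ?mulr1 ?mulr0 ?normr0; lra.
have s0 : `|0 : R| <= `|s| by rewrite normr0.
pose p (u : R) := g (x + u *: basis_vec R i + s *: basis_vec R j) - g (x + u *: basis_vec R i).
pose dp (u : R) := partial i g (x + u *: basis_vec R i + s *: basis_vec R j) -
  partial i g (x + u *: basis_vec R i).
have p' (u : R) : `|u| <= `|s| -> is_derive u (1 : R) p (dp u).
  move=> us; apply: is_deriveB.
    rewrite (_ : (fun u => _) = fun u : R => g ((x + s *: basis_vec R j) + u *: basis_vec R i)).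
      rewrite /dp addrAC; apply: derivable_line; rewrite addrAC.
      by have [] := H _ (fun k => dist u s k us (lexx _)).
    by apply/funext => w; rewrite addrAC.
  apply: derivable_line; apply: (proj1 (H _ _)) => k.
  by have := dist u 0 k us s0; rewrite scale0r addr0.
have [u us E] := MVT_between p'.
have [v vs E'] : exists2 v, `|v| <= `|s| &
    dp u = s * partial j (partial i g) (x + u *: basis_vec R i + v *: basis_vec R j).
  by apply: partial_MVT => v vs; apply: (proj2 (H _ _)) => k; exact: dist.
exists (x + u *: basis_vec R i + v *: basis_vec R j); first by move=> k; exact: dist.
by rewrite -E' -E /p scale0r addr0 opprB addrA addrAC.
Qed.

(** The intermediate points for the two orders of differentiation differ, so equality is known only
    for pairs of points close to x. *)
Lemma eq_by_nearby (u v : 'cV[R]_m -> R) (x : 'cV[R]_m) :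
  {for x, continuous u} -> {for x, continuous v} ->
  (forall r : R, 0 < r -> exists y z, [/\ ball x r y, ball x r z & u y = v z]) ->
  u x = v x.
Proof.
move=> cu cv H; apply/eqP; rewrite -subr_eq0 -normr_le0; apply/ler_addgt0Pr => e e0.
rewrite add0r.
have e2 : 0 < e / 2 by rewrite divr_gt0.
have /nbhs_ballP[r /= r0 Hr] : \forall y \near x, `|u x - u y| < e / 2 /\ `|v x - v y| < e / 2.
  by apply: filterI; [have /cvgrPdist_lt := cu|have /cvgrPdist_lt := cv]; exact.
have [y [z [/Hr[h1 _] /Hr[_ h2] yz]]] := H r r0.
rewrite yz in h1; rewrite -(subrKA (v z)) [leRHS]splitr.
apply: le_trans (ler_normD _ _) _; apply: lerD; first exact: ltW.
by rewrite distrC ltW.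
Qed.

Lemma partial_commute (E : set 'cV[R]_m) (g : 'cV[R]_m -> R) (x : 'cV[R]_m) i j :
  open E -> Cfin E 2 g -> E x -> partial j (partial i g) x = partial i (partial j g) x.
Proof.
move=> oE g2 Ex.
have c2 k l : {for x, continuous (partial k (partial l g))}.
  by apply: Cfin_continuous Ex; apply: Cfin_partial; exact: Cfin_partial g2.
apply: eq_by_nearby (c2 j i) (c2 i j) _ => r0 r00.
have /nbhs_ballP[r1 /= r10 Hr] := open_near oE Ex.
pose r := Num.min r0 r1.
(* The intermediate points lie within 2 s = r / 2 of x, hence in the open ball of radius r. *)
pose s : R := r / 4.
have r_gt0 : 0 < r by rewrite lt_min r00.
have s0 : 0 < s by rewrite divr_gt0.
have inr (y : 'cV[R]_m) : (forall k, `|y k 0 - x k 0| <= 2 * `|s|) -> ball x r y.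
  move=> H; apply/ball_colP; split=> // k; apply: le_lt_trans (H k) _.
  by rewrite gtr0_norm // /s; lra.
have D k l (y : 'cV[R]_m) : (forall k, `|y k 0 - x k 0| <= 2 * `|s|) ->
    derivable g y (basis_vec R k) /\ derivable (partial k g) y (basis_vec R l).
  move=> /inr yr; have Ey : E y.
    by apply: Hr; apply: le_ball yr; rewrite ge_min lexx orbT.
  split; first exact: Cfin_derivable g2 Ey.
  by apply: Cfin_derivable Ey; exact: Cfin_partial g2.
have [y yx E1] := second_difference (D i j).
have [z zx E2] := second_difference (D j i).
have rr0 : r <= r0 by rewrite ge_min lexx.
exists y, z; split; [exact: le_ball rr0 _ (inr _ yx)|exact: le_ball rr0 _ (inr _ zx)|].
apply: (mulfI (lt0r_neq0 s0)); apply: (mulfI (lt0r_neq0 s0)).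
apply: etrans (esym E1) _; apply: etrans _ E2.
rewrite [x + s *: basis_vec R j + _]addrAC; congr (_ + _).
exact: addrAC.
Qed.

End second_derivatives.

(** * Closedness of the form omega *)

Section closedness.
Variables (R : realType) (n N : nat) (k : smoothness) (D : set 'cV[R]_n).
Variables (alpha : R) (A : 'M[R]_N) (f : 'cV[R]_n -> 'cV[R]_N).
Hypotheses (k2 : at_least_C2 k) (oD : open D) (hf : C_map k D f).
Hypotheses (hA : A^T = - A) (hi : cond_i D alpha A f) (hii : cond_ii D alpha A f).
Local Notation fs := (fstar alpha A f).
Local Notation "''f_' j" := (fun x => col j (Jac f x)) (at level 8, j at level 2).

Lemma is_derive_dot (u v : 'cV[R]_n -> 'cV[R]_N) (du dv : 'cV[R]_N) x w :
  (forall i, is_derive x w (fun y => u y i 0) (du i 0)) ->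
  (forall i, is_derive x w (fun y => v y i 0) (dv i 0)) ->
  is_derive x w (fun y => dot (u y) (v y)) (dot du (v x) + dot (u x) dv).
Proof.
move=> Hu Hv; rewrite (_ : (fun y => _) = fun y => \sum_i u y i 0 * v y i 0); last first.
  by apply/funext => y; rewrite dotE.
have -> : dot du (v x) + dot (u x) dv = \sum_i (u x i 0 * dv i 0 + v x i 0 * du i 0).
  rewrite !dotE -big_split; apply: eq_bigr => i _ /=; ring.
by apply: is_derive_finsum => i; exact: is_derive_mul.
Qed.

Lemma is_derive_fstar x j i : D x ->
  is_derive x (basis_vec R j) (fun y => fs y i 0) (((alpha%:M + A) *m col j (Jac f x)) i 0).
Proof.
move=> Dx; rewrite (_ : (fun y => _) = fun y => \sum_l (alpha%:M + A) i l * f y l 0); last first.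
  by apply/funext => y; rewrite mxE.
rewrite mxE; apply: is_derive_finsum => l.
rewrite (_ : _ * _ = (alpha%:M + A) i l * col j (Jac f x) l 0 + f x l 0 * 0); last by rewrite mulr0 addr0.
apply: (is_derive_mul (is_derive_cst ((alpha%:M + A) i l) x (basis_vec R j))).
rewrite !mxE; apply: DeriveDef => //; exact: (f_derivable (at_least_C2W k2) oD hf).
Qed.

Definition second i j x : 'cV[R]_N := \col_l partial j (partial i (fun y => f y l 0)) x.

Lemma is_derive_fj x i j l : D x ->
  is_derive x (basis_vec R j) (fun y => col i (Jac f y) l 0) (second i j x l 0).
Proof.
move=> Dx; rewrite mxE (_ : (fun y => col i (Jac f y) l 0) = partial i (fun y => f y l 0)); last first.
  by apply/funext => y; rewrite !mxE.
by apply: DeriveDef => //; apply: Cfin_derivable Dx; apply: Cfin_partial; exact: C_on_C2 (hf l).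
Qed.

Lemma secondC x i j : D x -> second i j x = second j i x.
Proof.
move=> Dx; apply/matrixP => l c; rewrite [LHS]mxE [RHS]mxE.
exact: (partial_commute i j oD (C_on_C2 oD k2 (hf l)) Dx).
Qed.

Lemma dot_skew (u : 'cV[R]_N) v : dot u (A *m v) = - dot (A *m u) v.
Proof. by rewrite /dot trmx_mul hA mulmxN mulNmx [in RHS]mxE opprK mulmxA. Qed.

Lemma partial_omega x i j : D x ->
  partial j (omega alpha A f i) x =
  (dot ((alpha%:M + A) *m 'f_j x) ('f_i x) + dot (fs x) (second i j x)) / dot (fs x) (fs x) -
  dot (fs x) ('f_i x) * (dot ((alpha%:M + A) *m 'f_j x) (fs x) *+ 2) / dot (fs x) (fs x) ^+ 2.
Proof.
move=> Dx; set d := dot (fs x) (fs x).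
have d0 : d != 0 by rewrite gt_eqF // dot_gt0 // (fstar_neq0 hii).
have H1 := is_derive_dot (fun l => is_derive_fstar j l Dx) (fun l => is_derive_fj i j l Dx).
have H2 := is_derive_dot (fun l => is_derive_fstar j l Dx) (fun l => is_derive_fstar j l Dx).
have H3 := @is_derive_inv R _ (fun y => dot (fs y) (fs y)) _ x _ d0 H2.
have [_ E] := is_derive_mul H1 H3.
rewrite [LHS]E -/d [dot (fs x) (_ *m _)]dotC mulr2n.
set a := dot _ (second _ _ _); set b := dot _ (fs x); set c := dot _ _; set e := dot _ _.
by move: (d^-1) (d ^- 2) a b c e => d1 d2 a b c e; ring.
Qed.

(** The second derivatives and the terms in alpha are symmetric in i and j and drop out. What
    remains of the difference is - 2 / |f*|^4 times the (i, j) entry of tJ Q J, which is the origin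
    of Q and of condition (i). *)
Lemma omega_closed x i j : D x ->
  partial j (omega alpha A f i) x = partial i (omega alpha A f j) x.
Proof.
move=> Dx; rewrite !partial_omega // (secondC i j Dx); set d := dot (fs x) (fs x).
have d0 : d != 0 by rewrite gt_eqF // dot_gt0 // (fstar_neq0 hii).
have Bf u v : dot ((alpha%:M + A) *m u) v = alpha * dot u v + dot (A *m u) v.
  by rewrite mulmxDl mul_scalar_mx !dotE mulr_sumr -big_split; apply: eq_bigr => l _ /=;
    rewrite !mxE; ring.
have /matrixP/(_ i j) := hi Dx; rewrite [in RHS]mxE.
have -> : ((Jac f x)^T *m Qmx alpha A f x *m Jac f x) i j =
   dot ('f_i x) (Qmx alpha A f x *m 'f_j x).
  rewrite -mulmxA [LHS]mxE dotE; apply: eq_bigr => l _.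
  congr (_ * _); first by rewrite !mxE.
  by rewrite [in RHS]colE mulmxA -colE [RHS]mxE.
have -> : Qmx alpha A f x *m 'f_j x = dot (fs x) (A *m 'f_j x) *: fs x +
   dot (fs x) ('f_j x) *: (A *m fs x) - d *: (A *m 'f_j x).
  rewrite /Qmx mulmxBl mulmxDl -!mulmxA !tr_mul_dot -!scalemxAl.
  by rewrite !mul_mx_scalar -!scalemxAr.
have dotD3 (u v w y : 'cV[R]_N) (b c e : R) :
    dot u (b *: v + c *: w - e *: y) = b * dot u v + c * dot u w - e * dot u y.
  rewrite !dotE !mulr_sumr -sumrN -!big_split; apply: eq_bigr => l _ /=.
  by rewrite !mxE; ring.
rewrite dotD3 [dot (fs x) (A *m _)]dotC [dot ('f_i x) (A *m fs x)]dot_skew.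
rewrite [dot ('f_i x) (A *m 'f_j x)]dotC ![dot ((_ + _) *m col _ _) _]Bf.
have Sij : dot (A *m 'f_i x) ('f_j x) = - dot (A *m 'f_j x) ('f_i x).
  by rewrite dotC dot_skew.
rewrite [dot ('f_i x) ('f_j x)]dotC Sij.
rewrite ![dot (col _ _) (fs x)]dotC => Q0; apply/eqP; rewrite -subr_eq0; apply/eqP.
move: Q0.
set p := dot (fs x) ('f_i x); set q := dot (fs x) ('f_j x).
set aq := dot (A *m 'f_j x) (fs x); set ap := dot (A *m 'f_i x) (fs x).
set apq := dot (A *m 'f_j x) ('f_i x).
set S := dot (fs x) _; set T := dot _ _; move: p q aq ap apq S T => p q aq ap apq S T.
clearbody d => Q0; rewrite !mulr2n.
transitivity (- (2 / d ^+ 2) * (aq * p + q * - ap - d * apq)); last by rewrite Q0 mulr0.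
by field.
Qed.

End closedness.

(** * The Poincare lemma on a ball *)

Section local_primitive.
Variable R : realType.
Local Notation mu := (@lebesgue_measure R).

Lemma within_continuous_for (T U : topologicalType) (S : set T) (g : T -> U) :
  (forall t, S t -> {for t, continuous g}) -> {within S, continuous g}.
Proof.
move=> H; apply/subspace_continuousP => t St.
by apply: cvg_within_filter; exact: H.
Qed.

(** E is a primitive in t of the differentiated integrand at s = 0, so the integral obtained by
    differentiating under the sign is evaluated by the fundamental theorem of calculus. *)
Lemma is_derive_integral (p dp : R -> R -> R) (E : R -> R) (d : R) : 0 < d ->
  (forall s t : R, `|s| <= d -> 0 <= t <= 1 -> is_derive s (1 : R) (p^~ t) (dp s t)) ->
  (forall s t : R, `|s| <= d -> 0 <= t <= 1 -> {for t, continuous (p s)}) ->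
  (forall q : R * R, `|q.1| <= d -> 0 <= q.2 <= 1 ->
     {for q, continuous (fun q : R * R => dp q.1 q.2)}) ->
  (forall t : R, 0 <= t <= 1 -> is_derive t (1 : R) E (dp 0 t)) ->
  is_derive (0 : R) (1 : R) (fun s => \int[mu]_(t in `[0, 1]) p s t)%R (E 1 - E 0).
Proof.
move=> d0 Hp Hc Hdc HE.
have d00 : `|0 : R| <= d by rewrite normr0 ltW.
(* Compactness of the rectangle makes a constant a dominating function. *)
have [M HM] : exists M : R, forall s t : R, `|s| <= d -> 0 <= t <= 1 -> `|dp s t| <= M.
  have : compact ((fun q : R * R => dp q.1 q.2) @` (`[- d, d] `*` `[0, 1])).
    apply: continuous_compact; last by apply: compact_setX; exact: segment_compact.
    apply: within_continuous_for => q [/=]; rewrite !in_itv /= => q1 q2.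
    by apply: Hdc => //; rewrite ler_norml.
  move=> /compact_bounded[M [Mr HM]]; exists (M + 1) => s t sd t01.
  apply: (HM (M + 1)); first by rewrite ltrDl.
  by exists (s, t) => //; split => /=; rewrite in_itv //= -ler_norml.
have M0 : 0 <= M by apply: le_trans (HM 0 0 _ _); rewrite ?normr_ge0 ?lexx ?ler01.
have m01 : measurable (`[0, 1]%classic : set (measurableTypeR R)) by exact: measurable_itv.
have I0 : `]- d, d[%classic (0 : R) by rewrite /= in_itv /= d0 oppr_lt0 d0.
have sd s : `]- d, d[%classic s -> `|s| <= d.
  by rewrite /= in_itv /= => /andP[? ?]; rewrite ler_norml !ltW.
have intf (s : R) : `]- d, d[%classic s -> mu.-integrable `[0, 1] (EFin \o p s).
  move=> /sd s1; apply: continuous_compact_integrable; first exact: segment_compact.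
  by apply: within_continuous_for => t; rewrite /= in_itv /= => t01; exact: Hc.
have der (s t : R) : `]- d, d[%classic s -> `[0, 1]%classic t -> derivable (p^~ t) s 1.
  by move=> /sd s1; rewrite /= in_itv /= => t01; have [] := Hp s t s1 t01.
have intG : mu.-integrable `[0, 1] (EFin \o (fun=> M)).
  apply: continuous_compact_integrable; first exact: segment_compact.
  by apply: within_continuous_for => t _; exact: cst_continuous.
have pE (s t : R) : `|s| <= d -> 0 <= t <= 1 -> partial1of2 p s t = dp s t.
  by move=> s1 t1; have [_ <-] := Hp s t s1 t1; rewrite partial1of2E.
have G_ub (s t : R) : `]- d, d[%classic s -> `[0, 1]%classic t -> `|partial1of2 p s t| <= M.
  by move=> /sd s1; rewrite /= in_itv /= => t01; rewrite pE // HM.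
apply: DeriveDef.
  exact: (derivable_under_integral m01 I0 intf der (fun=> M0) intG G_ub).
rewrite -derive1E (differentiation_under_integral m01 I0 intf der (fun=> M0) intG G_ub).
rewrite (@eq_Rintegral _ _ _ mu `[0, 1] (dp 0)); last first.
  by move=> t; rewrite inE /= in_itv /= => t01; rewrite pE.
rewrite /Rintegral (@continuous_FTC2 R (dp 0) E 0 1) //.
- apply: within_continuous_for => t; rewrite /= in_itv /= => t01.
  have c2 : {for t, continuous (fun t : R => ((0, t) : R * R))}.
    have h1 : (fun=> 0 : R) @ t --> (0 : R) by exact: cvg_cst.
    have h2 : id @ t --> t by exact: cvg_id.
    exact: (cvg_pair h1 h2).
  exact: (@continuous_comp _ _ _ (fun t : R => ((0, t) : R * R)) (fun q => dp q.1 q.2) t c2 (Hdc (0, t) d00 t01)).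
- have cE (t : R) : 0 <= t <= 1 -> {for t, continuous E}.
    by move=> t01; apply: differentiable_continuous; apply/derivable1_diffP; have [] := HE t t01.
  split.
  + by move=> t; rewrite in_itv /= => /andP[t0 t1]; have [] := HE t _; rewrite ?ltW.
  + by apply: cvg_at_right_filter; apply: cE; rewrite lexx ler01.
  + by apply: cvg_at_left_filter; apply: cE; rewrite lexx ler01.
- move=> t; rewrite in_itv /= => /andP[t0 t1]; rewrite derive1E.
  have t01 : 0 <= t <= 1 by rewrite !ltW.
  by have [_ ->] := HE t t01.
Qed.

Variables (m : nat) (a : 'cV[R]_m) (r : R) (w : 'I_m -> 'cV[R]_m -> R).
Hypothesis w1 : forall i, Cfin (ball a r) 1 (w i).
Hypothesis w_closed : forall x i j, ball a r x -> partial j (w i) x = partial i (w j) x.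

Definition radial (x : 'cV[R]_m) : R :=
  (\int[mu]_(t in `[0%R, 1%R]) (\sum_i w i (a + t *: (x - a)) * (x - a) i 0))%R.

(** By closedness, the derivative in x_j of the integrand at t is the derivative in t of t w_j(a + t
    (x - a)), whose increment over the unit interval is w_j(x). *)
Lemma is_derive_radial x j : ball a r x -> is_derive x (basis_vec R j) radial (w j x).
Proof.
move=> xr; have /ball_colP[r0 xa] := xr.
have oB : open (ball a r) by exact: ball_open.
pose v := x - a; pose e := basis_vec R j : 'cV[R]_m.
(* Half of a common lower bound of these gaps keeps the segments from a to x + s e_j inside the ball
   for |s| <= d. *)
have gap i : 0 < r - `|v i 0| by rewrite subr_gt0 /v !mxE.
have [d2 d20 d2E] := common_radius gap.
pose d := d2 / 2; have d0 : 0 < d by rewrite divr_gt0.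
have d2d : d2 = d + d by rewrite /d; lra.
pose y (s t : R) : 'cV[R]_m := a + t *: (v + s *: e).
have yE s t i : y s t i 0 = a i 0 + t * (v i 0 + s * (i == j)%:R).
  by rewrite /y /e !mxE eqxx andbT.
have yr s t : `|s| <= d -> 0 <= t <= 1 -> ball a r (y s t).
  move=> sd /andP[t0 t1]; apply/ball_colP; split=> // i.
  rewrite yE addrAC subrr add0r normrM ger0_norm //.
  apply: (@le_lt_trans _ _ (`|v i 0| + d)); last by have := d2E i; lra.
  apply: (@le_trans _ _ (`|v i 0 + s * (i == j)%:R|)); first by rewrite ler_piMl.
  apply: le_trans (ler_normD _ _) _; rewrite lerD2l normrM normr_nat.
  by case: (i == j); rewrite ?mulr1 // mulr0 ltW.
have wdiff i z : ball a r z -> differentiable (w i) z.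
  by move=> zr; exact: (Cfin_differentiable oB (w1 i) zr).
pose p (s t : R) := \sum_i w i (y s t) * (v i 0 + s * (i == j)%:R).
pose dp (s t : R) := \sum_i (w i (y s t) * (i == j)%:R +
  (v i 0 + s * (i == j)%:R) * (\sum_l (t * (l == j)%:R) * partial l (w i) (y s t))).
pose E (t : R) := t * w j (y 0 t).
have key : is_derive (0 : R) (1 : R) (fun s => \int[mu]_(t in `[0, 1]) p s t)%R (E 1 - E 0).
  apply: (is_derive_integral (dp := dp) d0).
  - move=> s t sd t01; apply: is_derive_finsum => i; apply: is_derive_mul.
      apply: (@is_derive_curve R m R (w i) (y^~ t) (fun l => t * (l == j)%:R)).
        exact: wdiff (yr s t sd t01).
      move=> l; rewrite (_ : (fun s => _) = fun s : R => (a l 0 + t * v l 0) + s * (t * (l == j)%:R)).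
        exact: is_derive_affine.
      by apply/funext => u; rewrite yE; ring.
    exact: is_derive_affine.
  - move=> s t sd t01; apply: cvg_finsum => i; apply: cvgMr_tmp.
    apply: (@continuous_comp _ _ _ (y s) (w i)).
      apply: continuous_col => l.
      rewrite (_ : (fun u => _) = fun u : R => a l 0 + u * (v l 0 + s * (l == j)%:R)); last first.
        by apply/funext => u; rewrite yE.
      by apply: cvgD; [exact: cvg_cst|apply: cvgMr_tmp; exact: cvg_id].
    by apply: differentiable_continuous; apply: wdiff; exact: yr.
  - move=> [s t] /= sd t01.
    have ycont : {for (s, t), continuous (fun q : R * R => y q.1 q.2)}.
      apply: continuous_col => l.
      rewrite (_ : (fun u => _) = fun u : R * R => a l 0 + u.2 * (v l 0 + u.1 * (l == j)%:R)); last first.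
        by apply/funext => u; rewrite yE.
      apply: cvgD; first exact: cvg_cst.
      apply: cvgM; first exact: cvg_snd.
      by apply: cvgD; [exact: cvg_cst|apply: cvgMr_tmp; exact: cvg_fst].
    have comp (g : 'cV[R]_m -> R) : {for y s t, continuous g} ->
        g (y q.1 q.2) @[q --> nbhs (s, t)] --> g (y s t).
      by move=> cg; exact: (@continuous_comp _ _ _ (fun q : R * R => y q.1 q.2) g (s, t) ycont cg).
    apply: cvg_finsum => i; apply: cvgD.
      apply: cvgMr_tmp; apply: comp; apply: differentiable_continuous.
      by apply: wdiff; exact: yr.
    apply: cvgM.
      by apply: cvgD; [exact: cvg_cst|apply: cvgMr_tmp; exact: cvg_fst].
    apply: cvg_finsum => l; apply: cvgM; first by apply: cvgMr_tmp; exact: cvg_snd.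
    apply: (comp (partial l (w i))).
    exact: Cfin_continuous (Cfin_partial l (w1 i)) (yr s t sd t01).
  - move=> t t01; have d00 : `|0 : R| <= d by rewrite normr0 ltW.
    have -> : dp 0 t = t * (\sum_l v l 0 * partial l (w j) (y 0 t)) + w j (y 0 t) * 1.
      rewrite /dp big_split /= addrC mulr1; congr (_ + _).
        rewrite mulr_sumr; apply: eq_bigr => i _; rewrite mul0r addr0 mulrCA; congr (_ * _).
        rewrite (bigD1 j) //= eqxx mulr1 big1 ?addr0 => [|l /negbTE ->]; last by rewrite mulr0 mul0r.
        by rewrite w_closed //; exact: yr.
      rewrite (bigD1 j) //= eqxx mulr1 big1 ?addr0 // => l /negbTE ->.
      by rewrite mulr0.
    apply: is_derive_mul.
    apply: (@is_derive_curve R m R (w j) (y 0) (fun l => v l 0)).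
      exact: wdiff (yr 0 t d00 t01).
    move=> l; rewrite (_ : (fun s => _) = fun s : R => a l 0 + s * v l 0).
      exact: is_derive_affine.
    by apply/funext => u; rewrite yE mul0r addr0.
have -> : w j x = E 1 - E 0.
  by rewrite /E mul0r subr0 mul1r /y scale0r addr0 scale1r /v addrC subrK.
apply: line_derivable.
suff -> : (fun s : R => radial (x + s *: basis_vec R j)) =
    (fun s => \int[mu]_(t in `[0, 1]) p s t)%R by exact: key.
apply/funext => s; rewrite /radial; apply: eq_Rintegral => t _; apply: eq_bigr => i _.
by rewrite /y /v addrAC; congr (_ * _); rewrite !mxE eqxx andbT.
Qed.

End local_primitive.

(** * Integration along curves in a simply connected domain *)

Section global_primitive.
Variables (R : realType) (m : nat) (D : set 'cV[R]_m) (w : 'I_m -> 'cV[R]_m -> R).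
Implicit Types (a x y z : 'cV[R]_m) (r : R).

Definition primitive_on a r (L : 'cV[R]_m -> R) : Prop :=
  ball a r `<=` D /\ forall x j, ball a r x -> is_derive x (basis_vec R j) L (w j x).

Lemma ball_segment a r x y (t : R) :
  ball a r x -> ball a r y -> 0 <= t <= 1 -> ball a r (x + t *: (y - x)).
Proof.
move=> /ball_colP[r0 xa] /ball_colP[_ ya] /andP[t0 t1]; apply/ball_colP; split=> // i.
have -> : (x + t *: (y - x)) i 0 - a i 0 = (1 - t) * (x i 0 - a i 0) + t * (y i 0 - a i 0).
  by rewrite !mxE; ring.
apply: le_lt_trans (ler_normD _ _) _; rewrite !normrM ger0_norm ?subr_ge0 // [`|t|]ger0_norm //.
have := xa i; have := ya i; set u := `|_ - _|; set v := `|_ - _| => ur vr.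
have [->|t10] := eqVneq t 0; first by rewrite subr0 mul1r mul0r addr0.
have h1 : t * u < t * r by rewrite ltr_pM2l // lt_neqAle eq_sym t10.
have h2 : (1 - t) * v <= (1 - t) * r by rewrite ler_wpM2l ?subr_ge0 // ltW.
lra.
Qed.

Lemma segment_continuous x y : continuous (fun t : R => x + t *: (y - x)).
Proof.
move=> t; apply: continuous_col => i.
rewrite (_ : (fun u => _) = fun u : R => x i 0 + u * (y i 0 - x i 0)).
  by apply: cvgD; [exact: cvg_cst|apply: cvgMr_tmp; exact: cvg_id].
by apply/funext => u; rewrite !mxE.
Qed.

(** The intersection of two balls is convex, hence path-connected, and the difference of the two
    primitives has zero gradient there. *)
Lemma primitive_unique a b r s L M x y :
  primitive_on a r L -> primitive_on b s M ->
  ball a r x -> ball a r y -> ball b s x -> ball b s y ->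
  L y - L x = M y - M x.
Proof.
move=> [_ HL] [_ HM] ax ay bx by_.
pose E := ball a r `&` ball b s.
have oE : open E by apply: openI; exact: ball_open.
have pE : path_connected E.
  move=> u v [au bu] [av bv]; exists (fun t => u + t *: (v - u)); split.
  - split; first by apply: continuous_subspaceT; exact: segment_continuous.
    by move=> t; rewrite /unit_itv /= in_itv /= => t01; split; exact: ball_segment.
  - by rewrite scale0r addr0.
  - by rewrite scale1r addrC subrK.
have H z j : E z -> is_derive z (basis_vec R j) (fun z => L z - M z) 0.
  by move=> [az bz]; rewrite -(subrr (w j z)); apply: is_deriveB; [exact: HL|exact: HM].
have := partial0_cst oE pE H (conj ax bx) (conj ay by_).
move=> e; lra.
Qed.

Definition good x y : Prop := exists a r L, [/\ primitive_on a r L, ball a r x & ball a r y].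

(* The integral of w along the segment from x to y, when good x y. *)
Definition incr_along x y : R :=
  xget 0 [set v | exists a r L, [/\ primitive_on a r L, ball a r x, ball a r y & v = L y - L x]].

Lemma incr_alongE a r L x y :
  primitive_on a r L -> ball a r x -> ball a r y -> incr_along x y = L y - L x.
Proof.
move=> HL ax ay; rewrite /incr_along; case: xgetP => [v _ [b [s [M [HM bx by_ ->]]]]|].
  exact: primitive_unique HM HL bx by_ ax ay.
by move=> /(_ (L y - L x)) []; exists a, r, L.
Qed.

Lemma incr_alongC x y : good x y -> incr_along y x = - incr_along x y.
Proof.
by move=> [a [r [L [HL ax ay]]]]; rewrite !(incr_alongE HL) // opprB.
Qed.

Lemma incr_along_refl x : good x x -> incr_along x x = 0.
Proof. by move=> [a [r [L [HL ax _]]]]; rewrite (incr_alongE HL) // subrr. Qed.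

Hypotheses (oD : open D) (scD : simply_connected D).
Hypothesis local : forall a r, 0 < r -> ball a r `<=` D -> exists L, primitive_on a r L.

Lemma local_at x : D x -> exists r L, 0 < r /\ primitive_on x r L.
Proof.
move=> Dx; have /nbhs_ballP[r /= r0 rD] := open_near oD Dx.
by have [L HL] := local r0 rD; exists r, L.
Qed.

(** A Lebesgue number argument for the cover of the square by preimages of balls with a primitive.
    As K is total, the neighbours q may leave the square. *)
Lemma lebesgue_mesh (K : R * R -> 'cV[R]_m) : continuous K -> (forall p, D (K p)) ->
  exists M0 : nat, forall M, (M0 <= M)%N -> forall p : R * R, unit_itv p.1 -> unit_itv p.2 ->
    exists a r L, primitive_on a r L /\
      forall q : R * R, `|q.1 - p.1| <= M%:R^-1 -> `|q.2 - p.2| <= M%:R^-1 -> ball a r (K q).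
Proof.
move=> cK DK.
pose P (M : nat) (p : R * R) : Prop := exists a r L, primitive_on a r L /\
  forall q : R * R, `|q.1 - p.1| <= M%:R^-1 -> `|q.2 - p.2| <= M%:R^-1 -> ball a r (K q).
have /compact_near_coveringP cov : compact (@unit_itv R `*` @unit_itv R).
  by apply: compact_setX; exact: segment_compact.
have := cov nat \oo P _.
case.
  move=> p _; have [r [L [r0 HL]]] := local_at (DK p).
  have /nbhs_ballP[d /= d0 dK] := cK p _ (nbhsx_ballx (K p) r r0).
  exists (ball p (d / 2), [set M : nat | M%:R^-1 < d / 2]) => /=.
    split; first by apply: nbhsx_ballx; rewrite divr_gt0.
    have dn : 0 < d / 2 by rewrite divr_gt0.
    have [M0 _ HM0] := near_infty_natSinv_lt (PosNum dn).
    by exists M0.+1 => // -[//|M] /= M0M; apply: HM0.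
  move=> [q M] /= [[q1 q2] Md]; exists (K p), r, L; split=> // u u1 u2.
  apply: dK; split => /=; rewrite /ball /= in q1 q2 *.
    rewrite (_ : p.1 - u.1 = (p.1 - q.1) - (u.1 - q.1)); last by ring.
    by apply: le_lt_trans (ler_normB _ _) _; lra.
  rewrite (_ : p.2 - u.2 = (p.2 - q.2) - (u.2 - q.2)); last by ring.
  by apply: le_lt_trans (ler_normB _ _) _; lra.
move=> M0 _ HM0; exists M0 => M M0M p p1 p2.
by apply: (HM0 M M0M p).
Qed.

Definition curve (c : R -> 'cV[R]_m) : Prop := continuous c /\ forall t, D (c t).

Definition riemann (M : nat) (c : R -> 'cV[R]_m) : R :=
  \sum_(0 <= j < M) incr_along (c (j%:R / M%:R)) (c (j.+1%:R / M%:R)).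

Lemma mesh_itv (M j : nat) : (j <= M)%N -> unit_itv (j%:R / M%:R : R).
Proof.
move=> jM; rewrite /unit_itv /= in_itv /= divr_ge0 //=.
have [->|M0] := posnP M; first by rewrite invr0 mulr0 ler01.
by rewrite ler_pdivrMr ?ltr0n // mul1r ler_nat.
Qed.

Lemma mesh_step (M j : nat) : `|j.+1%:R / M%:R - j%:R / M%:R| <= (M%:R^-1 : R).
Proof. by rewrite -mulrBl -natrB // subSnn mul1r ger0_norm // invr_ge0. Qed.

Lemma curve_mesh c : curve c -> exists M0 : nat, forall M j, (M0 <= M)%N -> (j <= M)%N ->
  exists a r L, primitive_on a r L /\
    forall t, `|t - j%:R / M%:R| <= M%:R^-1 -> ball a r (c t).
Proof.
move=> [cc cD].
have cK : continuous (c \o (snd : R * R -> R)).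
  by move=> p; apply: (@continuous_comp _ _ _ snd c); [exact: cvg_snd|exact: cc].
have [M0 HM0] := lebesgue_mesh cK (fun p => cD p.2).
exists M0 => M j M0M jM.
have u0 : unit_itv (0 : R) by rewrite /unit_itv /= in_itv /= lexx ler01.
have [a [r [L [HL HB]]]] := HM0 M M0M (0, j%:R / M%:R) u0 (mesh_itv jM).
exists a, r, L; split=> // t tj; apply: (HB (0, t)) => //=.
by rewrite subrr normr0 invr_ge0.
Qed.

(** On a fine mesh the increments of local primitives are exact, so the sums are eventually constant
    and no limit is taken. Powers of two suit both refinement by halving and concatenation, which
    doubles the number of pieces. *)
Definition integral_along (c : R -> 'cV[R]_m) (v : R) : Prop :=
  exists p0, forall p, (p0 <= p)%N -> riemann (2 ^ p) c = v.

Lemma integral_along_unique c u v : integral_along c u -> integral_along c v -> u = v.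
Proof.
move=> [p Hp] [q Hq]; rewrite -(Hp (maxn p q)) ?leq_maxl // Hq ?leq_maxr //.
Qed.

Lemma sum_double (M : nat) (F : nat -> R) :
  \sum_(0 <= j < M.*2) F j = \sum_(0 <= j < M) (F j.*2 + F j.*2.+1).
Proof.
elim: M => [|M IH]; first by rewrite !big_geq.
by rewrite doubleS !big_nat_recr //= IH addrA.
Qed.

Lemma double_mesh (M j : nat) : (j.*2%:R / M.*2%:R : R) = j%:R / M%:R.
Proof.
by rewrite -!muln2 !natrM -mulf_div divff ?mulr1 // pnatr_eq0.
Qed.

Lemma riemann_double c : curve c -> exists M0 : nat, forall M, (M0 <= M)%N ->
  riemann M.*2 c = riemann M c.
Proof.
move=> /curve_mesh[M0 HM0]; exists M0 => M M0M.
rewrite /riemann sum_double; apply: eq_big_nat => j /andP[_ jM].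
have [a [r [L [HL HB]]]] := HM0 M j M0M (ltnW jM).
have b0 : ball a r (c (j%:R / M%:R)) by apply: HB; rewrite subrr normr0 invr_ge0.
have b2 : ball a r (c (j.+1%:R / M%:R)) by apply: HB; exact: mesh_step.
have b1 : ball a r (c (j.*2.+1%:R / M.*2%:R)).
  apply: HB; rewrite -(double_mesh M j); apply: le_trans (mesh_step _ _) _.
  have M00 : (0 < M)%N := leq_ltn_trans (leq0n j) jM.
  by rewrite lef_pV2 ?posrE ?ltr0n ?double_gt0 // ler_nat -addnn leq_addr.
rewrite -doubleS !double_mesh !(incr_alongE HL) //; lra.
Qed.

Lemma integral_along_exists c : curve c -> exists v, integral_along c v.
Proof.
move=> /riemann_double[M0 HM0]; exists (riemann (2 ^ M0) c), M0 => p.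
elim: p => [|p IH]; first by rewrite leqn0 => /eqP ->.
rewrite leq_eqVlt ltnS => /predU1P[-> //|M0p]; rewrite -IH // expnS mul2n HM0 //.
by apply: leq_trans M0p _; apply: ltnW; exact: ltn_expl.
Qed.

Definition rev_curve (c : R -> 'cV[R]_m) (t : R) : 'cV[R]_m := c (1 - t).

Lemma curve_rev c : curve c -> curve (rev_curve c).
Proof.
move=> [cc cD]; split=> [t|t]; last exact: cD.
apply: (@continuous_comp _ _ _ (fun t : R => 1 - t) c); last exact: cc.
by apply: cvgB; [exact: cvg_cst|exact: cvg_id].
Qed.

Lemma integral_along_rev c v : curve c -> integral_along c v ->
  integral_along (rev_curve c) (- v).
Proof.
move=> /curve_mesh[M0 HM0] [p0 Hp0]; exists (maxn M0 p0) => p.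
rewrite geq_max => /andP[M0p p0p]; rewrite -(Hp0 p p0p) /riemann big_nat_rev /= add0n -sumrN.
apply: eq_big_nat => j /andP[_ jM]; set M := (2 ^ p)%N in jM *.
have M0M : (M0 <= M)%N by apply: leq_trans M0p _; apply: ltnW; exact: ltn_expl.
have M00 : (M%:R : R) != 0 by rewrite pnatr_eq0 -lt0n; exact: leq_ltn_trans jM.
have rE i : (i <= M)%N -> (1 - (M - i)%:R / M%:R : R) = i%:R / M%:R.
  by move=> iM; rewrite natrB // mulrBl divff // subKr.
have sE : (M - j.+1).+1 = (M - j)%N by lia.
rewrite /rev_curve sE !rE // 1?ltnW // incr_alongC //.
have [a [r [L [HL HB]]]] := HM0 M j M0M (ltnW jM).
exists a, r, L; split=> //; apply: HB; last exact: mesh_step.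
by rewrite subrr normr0 invr_ge0.
Qed.

(** On each half of the interval one summand is constant and cancels against the common endpoint. In
    this form continuity needs no gluing at 1 / 2. *)
Definition cat_curve (c1 c2 : R -> 'cV[R]_m) (t : R) : 'cV[R]_m :=
  c1 (clamp (2 * t)) + c2 (clamp (2 * t - 1)) - c2 0.

Lemma cat_curve_l c1 c2 t : t <= 1 / 2 -> cat_curve c1 c2 t = c1 (clamp (2 * t)).
Proof. by move=> t2; rewrite /cat_curve (@clamp_le0 R (2 * t - 1)) ?addrK //; lra. Qed.

Lemma cat_curve_r c1 c2 t : c1 1 = c2 0 -> 1 / 2 <= t ->
  cat_curve c1 c2 t = c2 (clamp (2 * t - 1)).
Proof.
by move=> e t2; rewrite /cat_curve (@clamp_ge1 R (2 * t)) ?e; [rewrite addrAC subrr add0r|lra].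
Qed.

Lemma cat_curve0 c1 c2 : cat_curve c1 c2 0 = c1 0.
Proof. by rewrite cat_curve_l ?mulr0 ?clamp_le0 // divr_ge0. Qed.

Lemma cat_curve1 c1 c2 : c1 1 = c2 0 -> cat_curve c1 c2 1 = c2 1.
Proof.
have e : (2 * 1 - 1 : R) = 1 by ring.
by move=> c12; rewrite cat_curve_r ?e ?clamp_ge1 // ler_pdivrMr ?mul1r ?ler1n.
Qed.

Lemma curve_cat c1 c2 : curve c1 -> curve c2 -> c1 1 = c2 0 -> curve (cat_curve c1 c2).
Proof.
move=> [cc1 D1] [cc2 D2] e; split=> t; last first.
  by have [t2|/ltW t2] := leP t (1 / 2); [rewrite cat_curve_l|rewrite cat_curve_r].
have l1 : (fun s : R => 2 * s) @ t --> 2 * t by apply: cvgMl_tmp; exact: cvg_id.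
have l2 : (fun s : R => 2 * s - 1) @ t --> 2 * t - 1 by apply: cvgB => //; exact: cvg_cst.
have comp (b : R -> 'cV[R]_m) (h : R -> R) : continuous b -> h @ t --> h t ->
    (fun s => b (clamp (h s))) @ t --> b (clamp (h t)).
  move=> cb ch; apply: (@continuous_comp _ _ _ h (fun s => b (clamp s)) t ch).
  by apply: continuous_comp; [exact: clamp_continuous|exact: cb].
exact: (cvgB (cvgD (comp c1 _ cc1 l1) (comp c2 _ cc2 l2)) (cvg_cst _)).
Qed.

Lemma riemann_cat c1 c2 M : (0 < M)%N -> c1 1 = c2 0 ->
  riemann M.*2 (cat_curve c1 c2) = riemann M c1 + riemann M c2.
Proof.
move=> M0 e; have M00 : (M%:R : R) != 0 by rewrite pnatr_eq0 -lt0n.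
have dE j : (2 * (j%:R / M.*2%:R) : R) = j%:R / M%:R.
  rewrite -muln2 natrM invfM [_^-1 * _]mulrC !mulrA; congr (_ / _).
  by rewrite [2 * _]mulrC mulfK // pnatr_eq0.
have le1 j : (j <= M)%N -> (j%:R / M.*2%:R : R) <= 1 / 2.
  by move=> /mesh_itv; rewrite /unit_itv /= in_itv /= -dE => /andP[_]; lra.
have ge1 j : (1 / 2 : R) <= (M + j)%:R / M.*2%:R.
  have : (1 : R) <= 2 * ((M + j)%:R / M.*2%:R).
    by rewrite dE ler_pdivlMr ?ltr0n // mul1r ler_nat leq_addr.
  lra.
have lE j : (j <= M)%N -> cat_curve c1 c2 (j%:R / M.*2%:R) = c1 (j%:R / M%:R).
  by move=> jM; rewrite cat_curve_l ?le1 // dE clamp_id //; exact: mesh_itv.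
have rE j : (j <= M)%N -> cat_curve c1 c2 ((M + j)%:R / M.*2%:R) = c2 (j%:R / M%:R).
  move=> jM; rewrite cat_curve_r ?ge1 // dE natrD mulrDl divff // addrAC subrr add0r.
  by rewrite clamp_id //; exact: mesh_itv.
rewrite /riemann (@big_cat_nat _ _ _ M) /= -?addnn ?leq_addr //; congr (_ + _).
  by apply: eq_big_nat => j /andP[_ jM]; rewrite addnn !lE // ltnW.
rewrite -{1}[M in \sum_(M <= _ < _) _]add0n big_addn addnK.
by apply: eq_big_nat => j /andP[_ jM]; rewrite addnn -addSn ![(_ + M)%N]addnC !rE // ltnW.
Qed.

Lemma integral_along_cat c1 c2 u v : c1 1 = c2 0 ->
  integral_along c1 u -> integral_along c2 v -> integral_along (cat_curve c1 c2) (u + v).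
Proof.
move=> e [p Hp] [q Hq]; exists (maxn p q).+1 => -[//|s]; rewrite ltnS geq_max => /andP[ps qs].
by rewrite expnS mul2n riemann_cat ?expn_gt0 // Hp // Hq.
Qed.

Lemma integral_along_segment a r L x y : primitive_on a r L -> ball a r x -> ball a r y ->
  integral_along (fun t => x + clamp t *: (y - x)) (L y - L x).
Proof.
move=> HL ax ay; exists 0%N => p _; set M := (2 ^ p)%N.
have M00 : (M%:R : R) != 0 by rewrite pnatr_eq0 -lt0n expn_gt0.
pose z j := x + clamp (j%:R / M%:R) *: (y - x).
have zb j : ball a r (z j).
  by apply: ball_segment => //; have := clamp_itv (j%:R / M%:R : R); rewrite /unit_itv /= in_itv.
rewrite /riemann (eq_big_nat _ _ (F2 := fun j => L (z j.+1) - L (z j))); last first.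
  by move=> j _; exact: incr_alongE HL (zb j) (zb j.+1).
rewrite telescope_sumr // /z mul0r divff // (clamp_ge1 (lexx (1 : R))) (clamp_le0 (lexx (0 : R))).
by rewrite scale0r addr0 scale1r [x + _]addrC subrK.
Qed.

(* Stokes on a grid so fine that every cell of the homotopy lies in a ball with a primitive. *)
Lemma integral_along_loop c : curve c -> c 0 = c 1 -> integral_along c 0.
Proof.
move=> [cc cD] c01.
have [|K [Kc KD K0 K1 Ks]] := scD.2 c _ c01.
  by split=> //; exact: continuous_subspaceT.
pose cl (p : R * R) : R * R := (clamp p.1, clamp p.2).
have clI p : (@unit_itv R `*` @unit_itv R) (cl p) by split; exact: clamp_itv.
have clc : continuous cl.
  move=> p.
  have h1 : (fun p : R * R => clamp p.1) @ p --> clamp p.1.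
    by apply: continuous_comp; [exact: cvg_fst|exact: clamp_continuous].
  have h2 : (fun p : R * R => clamp p.2) @ p --> clamp p.2.
    by apply: continuous_comp; [exact: cvg_snd|exact: clamp_continuous].
  exact: (cvg_pair h1 h2).
have [M0 HM0] := lebesgue_mesh (continuous_retract Kc clI clc) (fun p => KD _ (clI p)).
exists M0 => p M0p; set M := (2 ^ p)%N.
have M0M : (M0 <= M)%N by apply: leq_trans M0p _; apply: ltnW; exact: ltn_expl.
have M00 : (M%:R : R) != 0 by rewrite pnatr_eq0 -lt0n expn_gt0.
pose x i j := K (i%:R / M%:R, j%:R / M%:R).
pose row i := \sum_(0 <= j < M) incr_along (x i j) (x i j.+1).
have refl z : D z -> incr_along z z = 0.
  move=> /local_at[r [L [r0 HL]]]; apply: incr_along_refl.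
  by exists z, r, L; split=> //; exact: ballxx.
have unit0 : unit_itv (0 : R) by rewrite /unit_itv /= in_itv /= lexx ler01.
have unit1 : unit_itv (1 : R) by rewrite /unit_itv /= in_itv /= lexx ler01.
(* In each cell a primitive makes the increments around the boundary cancel. The transversal edges
   then telescope, and the two outer ones are trivial because the homotopy fixes the endpoints. *)
have rowS i : (i < M)%N -> row i.+1 = row i.
  move=> iM; apply/eqP; rewrite -subr_eq0 -sumrB.
  rewrite (eq_big_nat _ _ (F2 := fun j => incr_along (x i j.+1) (x i.+1 j.+1) -
      incr_along (x i j) (x i.+1 j))); last first.
    move=> j /andP[_ jM].
    have [a [r [L [HL HB]]]] := HM0 M M0M (i%:R / M%:R, j%:R / M%:R)
      (mesh_itv (ltnW iM)) (mesh_itv (ltnW jM)).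
    have xb k l : (k <= M)%N -> (l <= M)%N -> (k = i \/ k = i.+1) -> (l = j \/ l = j.+1) ->
        ball a r (x k l).
      move=> kM lM ki lj; have := HB (k%:R / M%:R, l%:R / M%:R).
      rewrite /cl /= !clamp_id; try exact: mesh_itv.
      by apply; [case: ki|case: lj] => ->; rewrite ?subrr ?normr0 ?invr_ge0 //; exact: mesh_step.
    have [ji ij] := (ltnW iM, ltnW jM).
    have b00 : ball a r (x i j) by apply: xb => //; left.
    have b01 : ball a r (x i j.+1) by apply: xb => //; [left|right].
    have b10 : ball a r (x i.+1 j) by apply: xb => //; [right|left].
    have b11 : ball a r (x i.+1 j.+1) by apply: xb => //; right.
    rewrite !(incr_alongE HL) //; lra.
  have edge j : x i j = c 0 -> x i.+1 j = c 0 -> incr_along (x i j) (x i.+1 j) = 0.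
    by move=> -> ->; exact: refl.
  rewrite telescope_sumr // !edge ?subrr // /x ?divff // ?mul0r;
    by have [] := Ks _ (@mesh_itv M _ (ltnW iM)); have [] := Ks _ (@mesh_itv M _ iM).
have row0 i : (i <= M)%N -> row i = row 0%N.
  by elim: i => // i IH iM; rewrite rowS // IH // ltnW.
transitivity (row 0%N).
  apply: eq_big_nat => j /andP[_ jM].
  by rewrite /x mul0r !K0 //; apply: mesh_itv => //; exact: ltnW.
rewrite -(row0 M) // /row /x divff //; apply: big1_seq => j; rewrite mem_index_iota => /andP[_ /andP[_ jM]].
by rewrite !K1 ?refl //; apply: mesh_itv => //; exact: ltnW.
Qed.

Lemma global_primitive : exists H : 'cV[R]_m -> R,
  forall x j, D x -> is_derive x (basis_vec R j) H (w j x).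
Proof.
have [[x0 Dx0]|nD] := pselect (exists x, D x); last first.
  by exists (fun=> 0) => x j Dx; case: nD; exists x.
pose P x v := exists c, [/\ curve c, c 0 = x0, c 1 = x & integral_along c v].
have unit0 : unit_itv (0 : R) by rewrite /unit_itv /= in_itv /= lexx ler01.
have unit1 : unit_itv (1 : R) by rewrite /unit_itv /= in_itv /= lexx ler01.
have Pex x : D x -> exists v, P x v.
  move=> Dx; have [c [[cc cD] c0 c1]] := scD.1 x0 x Dx0 Dx.
  have Cc : curve (fun t => c (clamp t)).
    split=> [|t]; last by apply: cD; exact: clamp_itv.
    exact: (continuous_retract cc (@clamp_itv R) (@clamp_continuous R)).
  have [v Hv] := integral_along_exists Cc.
  by exists v, (fun t => c (clamp t)); rewrite /= !clamp_id.
(* One curve followed by the reverse of the other is a loop, along which the integral is 0. *)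
have Puniq x u v : P x u -> P x v -> u = v.
  move=> [c [Cc c0 c1 cu]] [d [Cd d0 d1 dv]].
  have e : c 1 = rev_curve d 0 by rewrite /rev_curve subr0 c1 d1.
  have := integral_along_cat e cu (integral_along_rev Cd dv).
  move=> /integral_along_unique/(_ (integral_along_loop (curve_cat Cc (curve_rev Cd) e) _)).
  move=> E; apply/eqP; rewrite -subr_eq0; apply/eqP; apply: E.
  by rewrite cat_curve0 cat_curve1 // /rev_curve subrr d0.
pose H x := xget 0 (P x).
have HP x : D x -> P x (H x).
  by move=> /Pex[v Pv]; rewrite /H; case: xgetP => [u ->|/(_ v)].
exists H => x j Dx; have [r [L [r0 HL]]] := local_at Dx.
have xx : ball x r x by exact: ballxx.
(* Appending the segment from x to y to a curve ending at x shows that H differs from the local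
   primitive by a constant near x. *)
have HE y : ball x r y -> H y = L y + (H x - L x).
  move=> xy; have Dy : D y by apply: HL.1.
  have [c [Cc c0 c1 cv]] := HP x Dx.
  apply: (Puniq y) (HP y Dy) _.
  pose s t := x + clamp t *: (y - x).
  have Cs : curve s.
    split=> [t|t]; last first.
      apply: HL.1; apply: ball_segment => //.
      by have := clamp_itv t; rewrite /unit_itv /= in_itv.
    exact: (continuous_comp (@clamp_continuous R t) (@segment_continuous x y (clamp t))).
  have e : c 1 = s 0 by rewrite /s clamp_le0 // scale0r addr0.
  exists (cat_curve c s); split; first exact: curve_cat.
  - by rewrite cat_curve0.
  - by rewrite cat_curve1 // /s (clamp_ge1 (lexx (1 : R))) scale1r addrC subrK.
  have := integral_along_cat e cv (integral_along_segment HL xx xy).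
  by congr integral_along; lra.
apply: (@near_eq_is_derive R _ R (fun y => L y + (H x - L x))).
  have Q : nbhs x (ball x r) by exact: nbhsx_ballx.
  by apply: filterS Q => y /HE.
rewrite -[w j x]addr0; apply: is_deriveD; exact: HL.2.
Qed.

End global_primitive.

(** * Uniqueness of H, and reparametrization *)

Section theorem.
Variable R : realType.

Lemma CfinS m (E E' : set 'cV[R]_m) r (g : 'cV[R]_m -> R) :
  E' `<=` E -> Cfin E r g -> Cfin E' r g.
Proof.
move=> sE; elim: r g => [|r IH] g [cg dg]; split=> //; try by move=> x /sE; exact: cg.
by move=> j; have [dj Cj] := dg j; split=> [x /sE|]; [exact: dj|exact: IH].
Qed.

Lemma is_H_exists n N (k : smoothness) (D : set 'cV[R]_n) (alpha : R) (A : 'M[R]_N)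
    (f : 'cV[R]_n -> 'cV[R]_N) :
  at_least_C2 k -> open D -> simply_connected D -> C_map k D f -> A^T = - A ->
  cond_i D alpha A f -> cond_ii D alpha A f -> exists H, is_H D alpha A f H.
Proof.
move=> k2 oD scD hf hA hi hii.
have [a r _ rD|H HH] := @global_primitive R n D (omega alpha A f) oD scD.
  exists (radial a (omega alpha A f)); split=> // x j ax.
  apply: (@is_derive_radial R n a r) => // [i|y i l ay].
    apply: CfinS rD _; apply: (C_on_C1 oD (at_least_C1_prev k2)).
    exact (omega_C_on (at_least_C2W k2) oD hf hii i).
  by apply: (omega_closed k2 oD hf hA hi hii); exact: rD.
exists H => x Dx j; have [d e] := HH x j Dx.
by split.
Qed.

Lemma is_H_unique n N (D : set 'cV[R]_n) (alpha : R) (A : 'M[R]_N)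
    (f : 'cV[R]_n -> 'cV[R]_N) H1 H2 : open D -> path_connected D ->
  is_H D alpha A f H1 -> is_H D alpha A f H2 -> exists c, forall x, D x -> H2 x = H1 x + c.
Proof.
move=> oD pcD h1 h2.
have [[x0 Dx0]|nD] := pselect (exists x, D x); last first.
  by exists 0 => x Dx; case: nD; exists x.
exists (H2 x0 - H1 x0) => x Dx.
have d0 (y : 'cV[R]_n) j : D y -> is_derive y (basis_vec R j) (fun y => H2 y - H1 y) 0.
  move=> Dy; rewrite -(subrr (omega alpha A f j y)).
  exact (is_deriveB (is_derive_H h2 j Dy) (is_derive_H h1 j Dy)).
by have := partial0_cst oD pcD d0 Dx0 Dx; lra.
Qed.

Lemma Jac_comp m n p (f : 'cV[R]_n -> 'cV[R]_p) (s : 'cV[R]_m -> 'cV[R]_n) (x : 'cV[R]_m) :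
  (forall i, differentiable (fun y => f y i 0) (s x)) ->
  (forall i j, derivable (fun y => s y i 0) x (basis_vec R j)) ->
  Jac (f \o s) x = Jac f (s x) *m Jac s x.
Proof.
move=> df ds; apply/matrixP => i j; rewrite [LHS]mxE [RHS]mxE.
have [_ E] := partial_comp (df i) (fun l => ds l j).
by apply: etrans E _; apply: eq_bigr => l _; rewrite [Jac f _ _ _]mxE [Jac s _ _ _]mxE mulrC.
Qed.

(** * Change of coordinates by a diffeomorphism *)

Section reparametrization.
Variables (n N : nat) (k : smoothness) (D : set 'cV[R]_n).
Variables (s t : 'cV[R]_n -> 'cV[R]_n).
Hypotheses (k1 : at_least_C1 k) (oD : open D).
Hypotheses (hs : C_map k D s) (ht : C_map k D t).
Hypotheses (st : forall x, D x -> D (s x) /\ t (s x) = x).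
Implicit Types (x u v : 'cV[R]_n).

Lemma C_map_differentiable p (g : 'cV[R]_n -> 'cV[R]_p) x i : C_map k D g -> D x ->
  differentiable (fun y => g y i 0) x.
Proof. by move=> hg; apply: (Cfin_differentiable oD (C_on_C1 oD k1 (hg i))). Qed.

Lemma C_map_derivable p (g : 'cV[R]_n -> 'cV[R]_p) x i j : C_map k D g -> D x ->
  derivable (fun y => g y i 0) x (basis_vec R j).
Proof. by move=> hg Dx; have [_ /(_ j)[d _]] := C_on_C1 oD k1 (hg i); exact: d. Qed.

Lemma Jac_comp_diffeo p (f : 'cV[R]_n -> 'cV[R]_p) x : C_map k D f -> D x ->
  Jac (f \o s) x = Jac f (s x) *m Jac s x.
Proof.
move=> hf Dx; apply: Jac_comp => [i|i j]; last exact: C_map_derivable hs Dx.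
by apply: C_map_differentiable hf (st Dx).1.
Qed.

(** Differentiating t o s = id on the open set D yields a left inverse of the Jacobian. *)
Lemma Jac_diffeo_unit x : D x -> Jac s x \in unitmx.
Proof.
move=> Dx; suff /mulmx1_unit[] : Jac t (s x) *m Jac s x = 1%:M by [].
rewrite -(Jac_comp_diffeo ht Dx); apply/matrixP => i j; rewrite !mxE.
have E : \forall y \near x, (fun y => (t \o s) y i 0) y = (fun y : 'cV[R]_n => y i 0) y.
  by apply: filterS (open_near oD Dx) => y Dy /=; rewrite (st Dy).2.
have [_ <-] := is_derive_coord x i j.
by apply: near_eq_derive.
Qed.

Variables (alpha : R) (A : 'M[R]_N) (f : 'cV[R]_n -> 'cV[R]_N) (H : 'cV[R]_n -> R).
Hypotheses (hf : C_map k D f) (hii : cond_ii D alpha A f) (hH : is_H D alpha A f H).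

(** The columns of J_f J_s stay in the span of those of J_f, and the Gram determinant only gains the
    nonzero factor (det J_s)^2. *)
Lemma cond_ii_comp : cond_ii D alpha A (f \o s).
Proof.
move=> x Dx; have [d0 fJ] := hii (st Dx).1.
have E := Jac_comp_diffeo hf Dx; rewrite E; split.
  have := Jac_diffeo_unit Dx; rewrite unitmxE unitfE => ds.
  rewrite trmx_mul -mulmxA (mulmxA (Jac f _)^T) !det_mulmx det_tr.
  by rewrite !mulf_neq0 // -det_mulmx.
apply: contra fJ; apply: subvP; apply/span_subvP => _ /mapP[j _ ->].
by rewrite colE -mulmxA; exact: mulmx_span.
Qed.

(** By the chain rule both the gradient of H and the row of the omega are multiplied by J_s on the
    right, while f* is just composed with s. *)
Lemma is_H_comp : is_H D alpha A (f \o s) (H \o s).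
Proof.
move=> x Dx j; have Ds := (st Dx).1.
have dH := Cfin_differentiable oD (C_on_C1 oD k1 (H_C_on k1 oD hf hii hH)) Ds.
have ds i : derivable (fun y => s y i 0) x (basis_vec R j) by exact: C_map_derivable hs Dx.
have [d E] := partial_comp dH ds.
split=> //; apply: etrans E _.
transitivity ((\row_i omega alpha A (f \o s) i x) 0 j); last by rewrite mxE.
rewrite row_omega (Jac_comp_diffeo hf Dx) mulmxA scalemxAl -(row_omega alpha A f (s x)) mxE.
apply: eq_bigr => i _; rewrite [_ 0 i]mxE [Jac s _ _ _]mxE mulrC.
by have [_ <-] := is_derive_H hH i Ds.
Qed.

Lemma pullback_gmetric p u v : D p ->
  pullback s (gmetric alpha A f H) p u v = gmetric alpha A (f \o s) (H \o s) p u v.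
Proof.
move=> Dp; rewrite /pullback /gmetric /metric_of_mx !qmxE (Jac_comp_diffeo hf Dp).
rewrite /perp_gram /dot; congr (_ _ _ _).
by rewrite !trmx_mul -!scalemxAl -!scalemxAr !mulmxA.
Qed.

End reparametrization.

End theorem.

Theorem theorem3 (R : realType) (n N : nat) (hn : (0 < n)%N) (hnN : (n < N)%N)
    (k : smoothness) (hk : at_least_C2 k)
    (D : set 'cV[R]_n) (hDopen : open D) (hDsc : simply_connected D)
    (f : 'cV[R]_n -> 'cV[R]_N) (hf : C_map k D f)
    (alpha : R) (A : 'M[R]_N) (hA : A^T = - A)
    (hi : cond_i D alpha A f) (hii : cond_ii D alpha A f) :
  (exists H : 'cV[R]_n -> R, is_H D alpha A f H) /\
  (forall H1 H2 : 'cV[R]_n -> R, is_H D alpha A f H1 -> is_H D alpha A f H2 ->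
     exists c : R, forall x, D x -> H2 x = H1 x + c) /\
  forall H : 'cV[R]_n -> R, is_H D alpha A f H ->
    (forall x, D x -> sym_posdef (qmx alpha A f H x)) /\
    ((exists h : 'cV[R]_(n + 1) -> R,
        [/\ C_on k (cylinder D) h,
            star (cylinder D) (Fmap alpha A f h) &
            starstar (cylinder D) (Fmap alpha A f h)])
     <->
     (diagonal_metric D (gmetric alpha A f H) /\
      constant_det_metric D (gmetric alpha A f H))) /\
    forall s : 'cV[R]_n -> 'cV[R]_n, diffeo_on k D s ->
      is_H D alpha A (f \o s) (H \o s) /\
      (forall p, D p -> forall u v : 'cV[R]_n,
         pullback s (gmetric alpha A f H) p u v =
         gmetric alpha A (f \o s) (H \o s) p u v) /\
      ((exists h : 'cV[R]_(n + 1) -> R,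
          [/\ C_on k (cylinder D) h,
              star (cylinder D) (Fmap alpha A (f \o s) h) &
              starstar (cylinder D) (Fmap alpha A (f \o s) h)])
       <->
       (diagonal_metric D (pullback s (gmetric alpha A f H)) /\
        constant_det_metric D (pullback s (gmetric alpha A f H)))).
Proof.
have k1 := at_least_C2W hk; have pcD := hDsc.1.
split; first exact: is_H_exists hk hDopen hDsc hf hA hi hii.
split=> [H1 H2 h1 h2|H hH]; first exact: is_H_unique hDopen pcD h1 h2.
split=> [x Dx|]; first exact: (qmx_posdef H hii Dx).
split=> [|s [hs [t [ht st _]]]]; first exact: main_iff.
have hH' := is_H_comp k1 hDopen hs st hf hii hH.
have pb := pullback_gmetric k1 hDopen hs st alpha A H hf.
split=> //; split=> [p Dp u v|]; first exact: pb.
have hf' : C_map k D (f \o s).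
  by move=> i; apply: (C_on_comp hDopen hDopen _ hs (hf i)) => x /st[].
(* The equivalence for f o s with its primitive H o s concerns the metric built from f o s; it
   remains to identify this metric with the pullback on D. *)
apply: (iff_trans (main_iff hn k1 hDopen pcD hf' hA
  (cond_ii_comp k1 hDopen hs ht st hf hii) hH')).
have E p : D p -> mx_of_metric (pullback s (gmetric alpha A f H)) p =
    mx_of_metric (gmetric alpha A (f \o s) (H \o s)) p.
  by move=> Dp; apply/matrixP => i j; rewrite !mxE pb.
split=> -[dg [c dc]]; split=> [p Dp|].
- by rewrite E //; exact: dg.
- by exists c => p Dp; rewrite E //; exact: dc.
- by rewrite -E //; exact: dg.
- by exists c => p Dp; rewrite -E //; exact: dc.
Qed.
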